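(* Let $a_+,a_->0$, $a=(a_++a_-)/2$, $\alpha=2\pi/(a_+a_-)$, $\eta\in\mathbb{R}$ and $y>0$. The relativistic Toda eigenfunction $F^T(\eta;x,y)$ defined in the context has the asymptotic behavior $$F^T(\eta;x,y)=O\big(\exp(\alpha a x/4)\big),\qquad x\to-\infty,$$ and $$F^T(\eta;x,y)\sim u^T(\eta;y)^{1/2}e^{i\alpha xy/2}+u^T(\eta;-y)^{1/2}e^{-i\alpha xy/2},\qquad x\to\infty,$$ where $\sim$ means that the difference of both sides converges to $0$, and $$u^T(\eta;y)=e^{-i\alpha\eta y}\,\frac{G(-y+ia)}{G(y+ia)}.$$
   Context: Hyperbolic gamma functions: for $|\mathrm{Im}\,z|<a$ set $g(z)=\int_0^\infty\frac{dt}{t}\left(\frac{\sin 2tz}{2\sinh(a_+t)\sinh(a_-t)}-\frac{z}{a_+a_-t}\right)$. Then $G(z)=\exp(ig(z))$ for $|\mathrm{Im}\,z|<a$, extended meromorphically to $\mathbb{C}$ by $G(z+ia_\delta/2)/G(z-ia_\delta/2)=2\cosh(\pi z/a_{-\delta})$, $\delta=+,-$. Put $\chi=\frac{\pi}{24}\left(\frac{a_+}{a_-}+\frac{a_-}{a_+}\right)$, $G_R(z)=e^{ig_R(z)}=G(z)e^{i\chi+i\alpha z^2/4}$ with $g_R=g+\chi+\alpha z^2/4$; for real $u$, $G_R(u)^{1/2}=e^{ig_R(u)/2}$ (tends to $1$ as $u\to\infty$). For $y>0$ one has $G(y+ia)G(-y+ia)=4\sinh(\pi y/a_+)\sinh(\pi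 y/a_-)>0$, and its positive square root is taken. The square roots of $u^T$ are $u^T(\eta;\pm y)^{1/2}=e^{\mp i\alpha\eta y/2}\,[G(y+ia)G(-y+ia)]^{1/2}/G(\pm y+ia)$. Relativistic Toda eigenfunction: for $\eta,x\in\mathbb{R}$, $y>0$, $$F^T(\eta;x,y)=\left(\frac{G(y+ia)G(-y+ia)}{a_+a_-G_R(x-\eta)}\right)^{1/2}e^{i\alpha y^2/4}\int_{\mathbb{R}}dz\,G_R(z+(x-\eta)/2-ia/2)\,G_R(-z+(x-\eta)/2-ia/2)\,e^{i\alpha zy}.$$ *)

(* Defs.v *)
From HB Require Import structures.
From mathcomp Require Import all_boot all_order all_algebra.
From mathcomp Require Import complex.
From mathcomp Require Import all_classical all_reals all_analysis.
From mathcomp Require Import ring lra.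

Set Implicit Arguments.
Unset Strict Implicit.
Unset Printing Implicit Defensive.
Import Order.TTheory GRing.Theory Num.Theory.
Import numFieldNormedType.Exports.
Local Open Scope classical_set_scope.
Local Open Scope ring_scope.
Local Open Scope complex_scope.

Notation Re := complex.Re.
Notation Im := complex.Im.
Notation normc := Normc.normc.

Section ComplexFunctions.
Context {R : realType}.
Implicit Types (z : R[i]) (t : R).

Definition cexp z : R[i] :=
  (expR (Re z) * cos (Im z)) +i* (expR (Re z) * sin (Im z)).

Definition ccosh z : R[i] := (cexp z + cexp (- z)) / 2.

Definition csin z : R[i] := (cexp ('i * z) - cexp (- ('i * z))) / (2 * 'i).

Definition sinh t : R := (expR t - expR (- t)) / 2.

Definition cintegral (D : set R) (f : R -> R[i]) : R[i] :=
  Rintegral lebesgue_measure D (fun t => Re (f t)) +i*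
  Rintegral lebesgue_measure D (fun t => Im (f t)).

End ComplexFunctions.

Section Toda.
Context {R : realType}.
Variables ap am : R.
Implicit Types (z : R[i]) (eta u x y : R).

Definition amean : R := (ap + am) / 2.

Definition alpha : R := 2 * pi / (ap * am).

Definition chi : R := pi / 24 * (ap / am + am / ap).

(* The integral converges only in the strip [`|Im z| < amean]. *)
Definition g z : R[i] :=
  cintegral `]0, +oo[%classic (fun t =>
    (csin ((2 * t)%:C * z) / (2 * sinh (ap * t) * sinh (am * t))%:C
     - z / (ap * am * t)%:C) / t%:C).

(* The meromorphic extension of [cexp ('i * g z)], computed by repeated use of
     G (z + i ap / 2) = 2 cosh (pi z / am) G (z - i ap / 2)
   until the argument lies in the strip.  The extension being unique, this
   single equation determines it; the equation with [ap] and [am] exchanged is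
   then a consequence.  The fuel [n] is only there for structural recursion, see
   [G_up] and [G_down].  At the poles, division by zero gives the value 0. *)
Fixpoint G_rec (n : nat) z : R[i] :=
  if n isn't n'.+1 then cexp ('i * g z)
  else if amean <= Im z then
    2 * ccosh (pi%:C * (z - (ap / 2)*i) / am%:C) * G_rec n' (z - ap*i)
  else if Im z <= - amean then
    G_rec n' (z + ap*i) / (2 * ccosh (pi%:C * (z + (ap / 2)*i) / am%:C))
  else cexp ('i * g z).

Definition G z : R[i] := G_rec (Num.truncn (`|Im z| / ap)).+1 z.

Definition gR z : R[i] := g z + chi%:C + alpha%:C * z ^+ 2 / 4.

Definition GR z : R[i] :=
  G z * cexp ('i * chi%:C + 'i * alpha%:C * z ^+ 2 / 4).

Definition sqrt_GR u : R[i] := cexp ('i * gR u%:C / 2).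

(* [sqrtc] of a nonnegative complex number is its nonnegative square root. *)
Definition sqrt_GG y : R[i] := sqrtc (G (y +i* amean) * G ((- y) +i* amean)).

Definition uT eta y : R[i] :=
  cexp (- ('i * (alpha * eta * y)%:C)) * (G ((- y) +i* amean) / G (y +i* amean)).

(* The paper's choice of [u^T (eta; y)^(1/2)], for y of either sign (note that
   [sqrt_GG] is even in y); see [sqrt_uT_sqr]. *)
Definition sqrt_uT eta y : R[i] :=
  cexp (- ('i * (alpha * eta * y / 2)%:C)) * (sqrt_GG y / G (y +i* amean)).

(* The square root of the prefactor is taken factorwise, with [sqrt_GR] for
   the factor G_R (x - eta). *)
Definition FT eta x y : R[i] :=
  sqrt_GG y / ((Num.sqrt (ap * am))%:C * sqrt_GR (x - eta))
  * cexp ('i * (alpha * y ^+ 2 / 4)%:C)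
  * cintegral setT (fun t =>
      GR ((t + (x - eta) / 2) -i* (amean / 2))
      * GR ((- t + (x - eta) / 2) -i* (amean / 2))
      * cexp ('i * (alpha * t * y)%:C)).

Lemma G_strip z : `|Im z| < amean -> G z = cexp ('i * g z).
Proof.
rewrite ltr_norml => /andP[h1 h2].
by rewrite /G /= leNgt h2 /= leNgt h1.
Qed.

Lemma G_recE n z : 0 < ap -> 0 < am ->
  `|Im z| < amean + n%:R * ap -> G_rec n z = G z.
Proof.
move=> ap0 am0 hz.
have a0 : 0 < amean by rewrite divr_gt0 ?addr_gt0.
have apa : ap < 2 * amean by rewrite /amean mulrC divfK // ltrDl.
have strip0 m (w : R[i]) : `|Im w| < amean -> G_rec m w = cexp ('i * g w).
  rewrite ltr_norml => /andP[h1 h2].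
  by case: m => //= m; rewrite leNgt h2 /= leNgt h1.
have E : forall k m (w : R[i]), `|Im w| < amean + k%:R * ap ->
    `|Im w| < amean + m%:R * ap -> G_rec k w = G_rec m w.
  elim=> [|k IH] [|m] w; rewrite ?mul0r ?addr0; try by move=> *; rewrite !strip0.
  rewrite -[k.+1%:R]natr1 -[m.+1%:R]natr1 !(mulrDl _ 1) !mul1r => hk hm /=.
  have kp : 0 <= k%:R * ap by rewrite mulr_ge0 // ltW.
  have mp : 0 <= m%:R * ap by rewrite mulr_ge0 // ltW.
  case: ifP => h1; last case: ifP => h2 //.
    have wE : Im (w - ap*i) = Im w - ap by case: (w).
    move: hk hm; rewrite !ltr_norml => /andP[_ hk] /andP[_ hm].
    by congr (_ * _); apply: IH; rewrite wE ltr_norml; apply/andP; split; lra.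
  have wE : Im (w + ap*i) = Im w + ap by case: (w).
  move: hk hm; rewrite !ltr_norml => /andP[hk _] /andP[hm _].
  by congr (_ / _); apply: IH; rewrite wE ltr_norml; apply/andP; split; lra.
apply: E hz _; apply: (@lt_trans _ _ ((Num.truncn (`|Im z| / ap)).+1%:R * ap)).
  by rewrite -ltr_pdivrMr // truncnS_gt.
by rewrite ltrDr.
Qed.

Lemma G_up z : 0 < ap -> 0 < am -> amean <= Im z ->
  G z = 2 * ccosh (pi%:C * (z - (ap / 2)*i) / am%:C) * G (z - ap*i).
Proof.
move=> ap0 am0 hz; rewrite {1}/G /= hz; congr (_ * _); apply: G_recE => //.
have a0 : 0 < amean by rewrite divr_gt0 ?addr_gt0.
have apa : ap < 2 * amean by rewrite /amean mulrC divfK // ltrDl.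
have -> : Im (z - ap*i) = Im z - ap by case: (z).
have := truncnS_gt (`|Im z| / ap); rewrite ltr_pdivrMr // -natr1 mulrDl mul1r.
set k := Num.truncn _; rewrite gtr0_norm ?(lt_le_trans a0 hz)// => hk.
have kp : 0 <= k%:R * ap by rewrite mulr_ge0 // ltW.
by rewrite ltr_norml; apply/andP; split; lra.
Qed.

Lemma G_down z : 0 < ap -> 0 < am -> Im z <= - amean ->
  G z = G (z + ap*i) / (2 * ccosh (pi%:C * (z + (ap / 2)*i) / am%:C)).
Proof.
move=> ap0 am0 hz.
have a0 : 0 < amean by rewrite divr_gt0 ?addr_gt0.
have apa : ap < 2 * amean by rewrite /amean mulrC divfK // ltrDl.
rewrite {1}/G /= hz leNgt ifF; last by apply/negbTE; rewrite negbK; lra.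
congr (_ / _); apply: G_recE => //.
have -> : Im (z + ap*i) = Im z + ap by case: (z).
have := truncnS_gt (`|Im z| / ap); rewrite ltr_pdivrMr // -natr1 mulrDl mul1r.
set k := Num.truncn _; rewrite ltr0_norm ?(le_lt_trans hz) ?oppr_lt0// => hk.
have kp : 0 <= k%:R * ap by rewrite mulr_ge0 // ltW.
by rewrite ltr_norml; apply/andP; split; lra.
Qed.

Lemma sqrt_uT_sqr eta y : sqrt_uT eta y ^+ 2 = uT eta y.
Proof.
have cexpD (z w : R[i]) : cexp (z + w) = cexp z * cexp w.
  case: z w => [a b] [c d]; rewrite /cexp /= expRD cosD sinD.
  by apply/eqP; rewrite eq_complex /=; apply/andP; split; apply/eqP; ring.
rewrite /sqrt_uT /uT exprMn expr2 -cexpD expr_div_n; congr (_ * _).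
  congr cexp; rewrite -opprD -mulrDr -rmorphD /=; congr (- ('i * _%:C)).
  by field.
rewrite /sqrt_GG sqr_sqrtc.
have [->|h] := eqVneq (G (y +i* amean)) 0; first by rewrite expr0n /= invr0 !mulr0.
by field.
Qed.
End Toda.

(* Main.v *)
Require Import Defs.
From HB Require Import structures.
From mathcomp Require Import all_boot all_order all_algebra.
From mathcomp Require Import complex.
From mathcomp Require Import all_classical all_reals all_analysis.
From mathcomp Require Import measurable_realfun.
From mathcomp Require Import ring lra.

Set Implicit Arguments.
Unset Strict Implicit.
Unset Printing Implicit Defensive.
Import Order.TTheory GRing.Theory Num.Theory.
Import numFieldNormedType.Exports.
Local Open Scope classical_set_scope.
Local Open Scope ring_scope.
Local Open Scope complex_scope.

Local Notation Re := complex.Re.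
Local Notation Im := complex.Im.
(** Write a for the mean of the two periods, alpha = 2 pi / (ap am),
    E = exp (i gR), H (u) = E (u - i a / 2) and s = x - eta. Inside the strip
    |Im z| < a the function [GR] is E, so the integral in [FT] is

      I (s) = int H (t + s / 2) H (- t + s / 2) e^(i alpha t y) dt.

    H tends to 1 at +oo and to 0 at -oo, exponentially fast on both sides.

    For x -> +oo, expand the product around the values that its factors have on
    most of the line: writing step for the indicator of the positive half-line,

      H K = (H - 1) (K - 1) + (H - step) + (K - step) + indicator (|t| <= s / 2),

    where H and K are the two factors and step is evaluated at their arguments.
    The first term is O (e^(- tau s)) for some tau > 0, and the integrals of the
    others are explicit in terms of the regularized Fourier transform c (y) of H;
    this gives
    I (s) = e^(i alpha s y / 2) c (y) + e^(- i alpha s y / 2) c (- y) +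
    O (e^(- tau s)). The asymptotics therefore amounts to a closed formula,

      c (y) G (y + i a) = sqrt (ap am) e^(- i alpha y^2 / 4),

    which is [FTE_GR] in another normalization. For x -> -oo, |H (u)| is bounded
    by a multiple of min (1, e^(alpha a u / 2)), and the estimate of I (s)
    follows by using one bound on each half-line.

    The closed formula is proved as follows. E satisfies a first order
    difference equation with step i ap ([Ef_diff]). Shifting the line of
    integration ([FTE_indep]) turns it into a difference equation for the
    transform of E, which says that the product of the transform with
    E (p + i (am - ap) / 2) and elementary factors has period i ap. When ap is
    the smaller period, this product is holomorphic and grows more slowly than
    e^(2 pi |p| / ap), hence is constant ([periodic_const], [FTE_mul_E]). The
    constant is read off at p = 0 from the pole of the transform. It involves
    E (i (am - ap) / 2), which is determined by comparing the two difference
    equations at the boundary of the strip with the reflection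
    E (z) E (- z) = e^(2 i chi + i alpha z^2 / 2) ([Ef_boundary0]).

    The properties of E come from the representation ([gRd0])

      gR (z) = (1 / 4 i) int e^(2 i t z) / (t sinh (ap t) sinh (am t)) dt,

    over a line Im t = tau > 0 below the first nonzero poles. It shows that E is
    close to 1 on the right of the strip, the reflection then controls E on the
    left, and the difference equation follows from the Fourier transform of
    1 / sinh ([VintE]).

    Complex functions are handled through their real and imaginary parts along
    lines, and all contour arguments use rectangles ([cauchy_rect]). *)

(** * Complex numbers and the exponential *)

Section ComplexBasics.
Context {R : realType}.
Implicit Types (z w : R[i]) (x y : R).

Lemma ReD z w : Re (z + w) = Re z + Re w.
Proof. by case: z w => [a b] [c d]. Qed.

Lemma ImD z w : Im (z + w) = Im z + Im w.
Proof. by case: z w => [a b] [c d]. Qed.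

Lemma ReN z : Re (- z) = - Re z.
Proof. by case: z. Qed.

Lemma ImN z : Im (- z) = - Im z.
Proof. by case: z. Qed.

Lemma ReB z w : Re (z - w) = Re z - Re w.
Proof. by rewrite ReD ReN. Qed.

Lemma ImB z w : Im (z - w) = Im z - Im w.
Proof. by rewrite ImD ImN. Qed.

Lemma ReM z w : Re (z * w) = Re z * Re w - Im z * Im w.
Proof. by case: z w => [a b] [c d]. Qed.

Lemma ImM z w : Im (z * w) = Re z * Im w + Im z * Re w.
Proof. by case: z w => [a b] [c d]. Qed.

Lemma ReV z : Re z^-1 = Re z / (Re z ^+ 2 + Im z ^+ 2).
Proof. by case: z. Qed.

Lemma ImV z : Im z^-1 = - Im z / (Re z ^+ 2 + Im z ^+ 2).
Proof. by case: z => a b /=; rewrite mulNr. Qed.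

Lemma ReMr x z : Re (x%:C * z) = x * Re z.
Proof. by rewrite ReM /= mul0r subr0. Qed.

Lemma ImMr x z : Im (x%:C * z) = x * Im z.
Proof. by rewrite ImM /= mul0r addr0. Qed.

Definition ReImE := (ReD, ImD, ReN, ImN, ReMr, ImMr, ReM, ImM).

Lemma complexP z w : Re z = Re w -> Im z = Im w -> z = w.
Proof. by case: z w => [a b] [c d] /= -> ->. Qed.

Lemma normcr x : normc x%:C = `|x|.
Proof. by rewrite /= expr0n addr0 sqrtr_sqr. Qed.

Lemma normci : normc ('i : R[i]) = 1.
Proof. by rewrite /= expr0n add0r expr1n sqrtr1. Qed.

Lemma normc0' : normc (0 : R[i]) = 0.
Proof. by rewrite /= expr0n addr0 sqrtr0. Qed.

Lemma normc_ge0 z : 0 <= normc z.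
Proof. by case: z => a b; rewrite sqrtr_ge0. Qed.

Lemma normcB z w : normc (z - w) <= normc z + normc w.
Proof. by rewrite (le_trans (le_normcD _ _))// normcN. Qed.

Lemma normc_distC z w : normc (z - w) = normc (w - z).
Proof. by rewrite -normcN opprB. Qed.

Lemma normc_sqr z : normc z ^+ 2 = Re z ^+ 2 + Im z ^+ 2.
Proof. by case: z => a b /=; rewrite sqr_sqrtr// addr_ge0// sqr_ge0. Qed.

Lemma normc_Re z : `|Re z| <= normc z.
Proof.
case: z => a b /=; rewrite -sqrtr_sqr ler_wsqrtr//.
by rewrite lerDl sqr_ge0.
Qed.

Lemma normc_Im z : `|Im z| <= normc z.
Proof.
case: z => a b /=; rewrite -sqrtr_sqr ler_wsqrtr//.
by rewrite lerDr sqr_ge0.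
Qed.

Lemma normc_le_ReIm z : normc z <= `|Re z| + `|Im z|.
Proof.
rewrite -(@ler_pXn2r _ 2)// ?nnegrE ?addr_ge0 ?normc_ge0//.
rewrite normc_sqr sqrrD !real_normK ?num_real//.
by rewrite -addrA [X in _ <= _ + X]addrC addrA lerDl mulrn_wge0// mulr_ge0.
Qed.

Lemma normc_eq0 z : (normc z == 0) = (z == 0).
Proof.
by apply/eqP/eqP => [/Normc.eq0_normc//|->]; exact: normc0'.
Qed.

Lemma normc_gt0 z : (0 < normc z) = (z != 0).
Proof. by rewrite lt0r normc_ge0 andbT normc_eq0. Qed.

Lemma normcX z n : normc (z ^+ n) = normc z ^+ n.
Proof.
elim: n => [|n IH]; first by rewrite !expr0 (normcr 1) normr1.
by rewrite !exprS Normc.normcM IH.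
Qed.

Lemma normc_inv_le z (c : R) : 0 < c -> c <= normc z -> normc z^-1 <= c^-1.
Proof.
by move=> c0 cz; rewrite Normc.normcV lef_pV2// posrE// (lt_le_trans c0).
Qed.

Lemma lernormcB z w : normc z - normc w <= normc (z - w).
Proof. by rewrite lerBlDr (le_trans _ (le_normcD _ _))// subrK. Qed.

Lemma cexpD z w : cexp (z + w) = cexp z * cexp w.
Proof.
apply: complexP; rewrite /cexp !ReImE /= expRD ?cosD ?sinD; ring.
Qed.

Lemma cexp0 : cexp (0 : R[i]) = 1.
Proof. by rewrite /cexp /= expR0 cos0 sin0 mulr0 mulr1. Qed.

Lemma cexpNV z : cexp (- z) * cexp z = 1.
Proof. by rewrite -cexpD addNr cexp0. Qed.

Lemma cexp_neq0 z : cexp z != 0.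
Proof.
apply/eqP => z0; have := cexpNV z; rewrite z0 mulr0 => /esym/eqP.
by rewrite oner_eq0.
Qed.

Lemma cexpN z : cexp (- z) = (cexp z)^-1.
Proof. by apply: (mulIf (cexp_neq0 z)); rewrite cexpNV mulVf// cexp_neq0. Qed.

Lemma cexpB z w : cexp (z - w) = cexp z / cexp w.
Proof. by rewrite cexpD cexpN. Qed.

Lemma normc_cexp z : normc (cexp z) = expR (Re z).
Proof.
rewrite /cexp /= !exprMn -mulrDr cos2Dsin2 mulr1 sqrtr_sqr.
by rewrite ger0_norm// expR_ge0.
Qed.

Lemma natrC (n : nat) : n%:R = (n%:R)%:C :> R[i].
Proof. by rewrite rmorph_nat. Qed.

Lemma cexp_real x : cexp x%:C = (expR x)%:C.
Proof. by rewrite /cexp /= cos0 sin0 mulr0 mulr1. Qed.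

Lemma cexp_ipi : cexp ('i * pi%:C) = - 1 :> R[i].
Proof.
rewrite /cexp !ReImE /= !(mul0r, mulr0, mul1r, subr0, add0r, addr0) oppr0 expR0 cospi sinpi.
by apply: complexP => /=; rewrite ?mul1r ?oppr0.
Qed.

Definition csinh z := (cexp z - cexp (- z)) / 2.

Lemma csinhN z : csinh (- z) = - csinh z.
Proof. by rewrite /csinh opprK -mulNr opprB. Qed.

Lemma csinh_ri x y :
  csinh (x +i* y) = (sinh x * cos y) +i* ((expR x + expR (- x)) / 2 * sin y).
Proof.
have E2 : (2 : R[i])^-1 = (2^-1)%:C by rewrite (natrC 2) -fmorphV.
rewrite /csinh E2 /sinh.
by apply: complexP; rewrite mulrC !ReImE /cexp /= ?cosN ?sinN; field.
Qed.

Lemma csinh_real x : csinh x%:C = (sinh x)%:C.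
Proof. by rewrite csinh_ri cos0 sin0 mulr1 mulr0. Qed.

Lemma cosh_sqr x : ((expR x + expR (- x)) / 2) ^+ 2 = sinh x ^+ 2 + 1.
Proof.
rewrite /sinh; transitivity (((expR x - expR (- x)) / 2) ^+ 2 + expR x * expR (- x)).
  by field.
by rewrite expRxMexpNx_1.
Qed.

Lemma normc_csinh_sqr x y :
  normc (csinh (x +i* y)) ^+ 2 = sinh x ^+ 2 + sin y ^+ 2.
Proof.
rewrite csinh_ri normc_sqr [Re _]/= [Im _]/= exprMn [X in _ + X]exprMn cosh_sqr cos2sin2.
ring.
Qed.

(** On a line where [sin y] is positive this grows like the exponential, while
    sinh x alone would degenerate at x = 0. *)
Lemma normc_csinh_ge x y : 0 <= sin y ->
  sin y * (expR `|x| / 2) <= normc (csinh (x +i* y)).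
Proof.
move=> s0; rewrite -(@ler_pXn2r _ 2)// ?nnegrE ?normc_ge0 ?mulr_ge0 ?expR_ge0//.
rewrite normc_csinh_sqr exprMn.
have s1 : sin y ^+ 2 <= 1 by rewrite expr_le1 ?sin_le1.
have e1 : (expR `|x| / 2) ^+ 2 <= sinh x ^+ 2 + 1.
  rewrite -cosh_sqr ler_pXn2r// ?nnegrE ?mulr_ge0 ?addr_ge0 ?expR_ge0// ler_pM2r//.
  by case: (ger0P x) => _; rewrite ?lerDl ?lerDr expR_ge0.
have := ler_wpM2l (sqr_ge0 (sin y)) e1.
have := sqr_ge0 (sinh x); nra.
Qed.

Lemma normc_csinh_ge_sinh x y : `|sinh x| <= normc (csinh (x +i* y)).
Proof.
rewrite -(@ler_pXn2r _ 2)// ?nnegrE ?normc_ge0//.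
by rewrite normc_csinh_sqr real_normK ?num_real// lerDl sqr_ge0.
Qed.

End ComplexBasics.

(** * Differentiable curves in the complex plane *)

Section Curves.
Context {R : realType}.
Implicit Types (c d : R -> R[i]) (t : R).

(** Stated componentwise, so that theorems of real analysis apply directly. *)
Definition cder c t (v : R[i]) :=
  is_derive t 1 (fun u => Re (c u)) (Re v) /\
  is_derive t 1 (fun u => Im (c u)) (Im v).

Definition ccont c t := Re (c u) @[u --> t] --> Re (c t) /\
  Im (c u) @[u --> t] --> Im (c t).

Lemma cder_eq c t v w : cder c t v -> v = w -> cder c t w.
Proof. by move=> h <-. Qed.

Lemma cder_ext c d t v : (forall u, c u = d u) -> cder c t v -> cder d t v.
Proof. by move=> /funext ->. Qed.

Lemma ccont_ext c d t : (forall u, c u = d u) -> ccont c t -> ccont d t.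
Proof. by move=> /funext ->. Qed.

Lemma cder_cont c t v : cder c t v -> ccont c t.
Proof.
by move=> [[h1 _] [h2 _]]; split; apply/differentiable_continuous/derivable1_diffP.
Qed.

Lemma cder_cst (a : R[i]) t : cder (fun=> a) t 0.
Proof. by split; exact: is_derive_cst. Qed.

Lemma cder_real t : cder (fun u => u%:C) t 1.
Proof. by split => /=; [exact: is_derive_id|exact: is_derive_cst]. Qed.

Lemma cderD c d t v w : cder c t v -> cder d t w ->
  cder (fun u => c u + d u) t (v + w).
Proof.
move=> [a1 a2] [b1 b2]; split; rewrite ReImE; under eq_fun do rewrite ReImE.
- exact: is_deriveD.
- exact: is_deriveD.
Qed.

Lemma cderN c t v : cder c t v -> cder (fun u => - c u) t (- v).
Proof.
move=> [a1 a2]; split; rewrite ReImE; under eq_fun do rewrite ReImE.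
- exact: is_deriveN.
- exact: is_deriveN.
Qed.

Lemma cderB c d t v w : cder c t v -> cder d t w ->
  cder (fun u => c u - d u) t (v - w).
Proof. by move=> a b; apply: cderD => //; exact: cderN. Qed.

Lemma cderM c d t v w : cder c t v -> cder d t w ->
  cder (fun u => c u * d u) t (v * d t + c t * w).
Proof.
move=> [a1 a2] [b1 b2]; split; rewrite !ReImE; under eq_fun do rewrite ReImE.
- apply: is_derive_eq; rewrite /GRing.scale/=; ring.
- apply: is_derive_eq; rewrite /GRing.scale/=; ring.
Qed.

Lemma cderZ (a : R[i]) c t v : cder c t v -> cder (fun u => a * c u) t (a * v).
Proof.
by move=> h; apply: cder_eq (cderM (cder_cst a t) h) _; rewrite mul0r add0r.
Qed.

Lemma is_derive_exp_comp (f : R -> R) t (df : R) : is_derive t 1 f df ->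
  is_derive t 1 (fun u => expR (f u)) (expR (f t) * df).
Proof.
by move=> h; have := @is_derive1_comp _ expR f t _ _ _ h; apply; exact: is_derive_expR.
Qed.

Lemma cder_exp c t v : cder c t v -> cder (fun u => cexp (c u)) t (v * cexp (c t)).
Proof.
move=> [a1 a2]; have e := is_derive_exp_comp a1.
have s : is_derive t 1 (fun u => sin (Im (c u))) (cos (Im (c t)) * Im v).
  by have := @is_derive1_comp _ sin _ t _ _ _ a2; apply.
have k : is_derive t 1 (fun u => cos (Im (c u))) (- sin (Im (c t)) * Im v).
  by have := @is_derive1_comp _ cos _ t _ _ _ a2; apply.
split; rewrite !ReImE /cexp /=.
- apply: is_derive_eq; rewrite /GRing.scale/=; ring.
- apply: is_derive_eq; rewrite /GRing.scale/=; ring.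
Qed.

Lemma cderV c t v : c t != 0 -> cder c t v ->
  cder (fun u => (c u)^-1) t (- v / c t ^+ 2).
Proof.
move=> c0 [a1 a2].
have n0 : Re (c t) ^+ 2 + Im (c t) ^+ 2 != 0.
  by rewrite -normc_sqr expf_neq0// normc_eq0.
have q : is_derive t 1 (fun u => Re (c u) ^+ 2 + Im (c u) ^+ 2)
    (2 * Re (c t) * Re v + 2 * Im (c t) * Im v).
  by apply: is_derive_eq; rewrite /GRing.scale/=; ring.
have iq : is_derive t 1 (fun u => (Re (c u) ^+ 2 + Im (c u) ^+ 2)^-1)
    (- (Re (c t) ^+ 2 + Im (c t) ^+ 2) ^- 2 *
       (2 * Re (c t) * Re v + 2 * Im (c t) * Im v)).
  exact: (@is_deriveV _ (fun u => Re (c u) ^+ 2 + Im (c u) ^+ 2) t _ 1).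
have vE : - v / c t ^+ 2 = - v * ((c t)^-1 * (c t)^-1).
  by rewrite -exprVn expr2.
split.
- under eq_fun do rewrite /= ReV.
  apply: is_derive_eq; rewrite vE !ReImE ReV ImV /GRing.scale/=.
  by field; exact: n0.
- under eq_fun do rewrite /= ImV.
  apply: is_derive_eq; rewrite vE !ReImE ReV ImV /GRing.scale/=.
  by field; exact: n0.
Qed.

Lemma is_derive_affine (f : R -> R) (k b t df : R) : is_derive (k * t + b) 1 f df ->
  is_derive t 1 (fun u => f (k * u + b)) (k * df).
Proof.
move=> h.
have l : is_derive t 1 (fun u => k * u + b) k.
  by apply: is_derive_eq; rewrite /GRing.scale/=; ring.
by have := @is_derive1_comp _ f _ t _ _ h l; rewrite mulrC.
Qed.

Lemma cder_affine c (k b t : R) v : cder c (k * t + b) v ->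
  cder (fun u => c (k * u + b)) t (k%:C * v).
Proof.
move=> [h1 h2]; split; rewrite !ReImE.
- exact: is_derive_affine.
- exact: is_derive_affine.
Qed.

Lemma cder_shift0 c t v : cder (fun u => c (t + u)) 0 v -> cder c t v.
Proof.
move=> h; have := @cder_affine (fun u => c (t + u)) 1 (- t) t v.
rewrite mul1r subrr => /(_ h); rewrite mul1r.
by apply: cder_ext => u; rewrite mul1r addrCA subrr addr0.
Qed.

Lemma ccontD c d t : ccont c t -> ccont d t -> ccont (fun u => c u + d u) t.
Proof.
move=> [a1 a2] [b1 b2]; split; under eq_fun do rewrite ReImE; rewrite ReImE; exact: cvgD.
Qed.

Lemma ccontM c d t : ccont c t -> ccont d t -> ccont (fun u => c u * d u) t.
Proof.
move=> [a1 a2] [b1 b2]; split; under eq_fun do rewrite ReImE; rewrite ReImE.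
- by apply: cvgB; apply: cvgM.
- by apply: cvgD; apply: cvgM.
Qed.

Lemma ccont_cst (a : R[i]) t : ccont (fun=> a) t.
Proof. exact: cder_cont (cder_cst a t). Qed.

Lemma ccontN c t : ccont c t -> ccont (fun u => - c u) t.
Proof.
move=> h; apply: (@ccont_ext (fun u => -1 * c u)) => [u|]; first by rewrite mulN1r.
exact: ccontM (ccont_cst _ _) h.
Qed.

Lemma ccontV c t : c t != 0 -> ccont c t -> ccont (fun u => (c u)^-1) t.
Proof.
move=> c0 [a1 a2].
have n0 : Re (c t) ^+ 2 + Im (c t) ^+ 2 != 0.
  by rewrite -normc_sqr expf_neq0// normc_eq0.
have q : (Re (c u) ^+ 2 + Im (c u) ^+ 2)^-1 @[u --> t] -->
    (Re (c t) ^+ 2 + Im (c t) ^+ 2)^-1.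
  by apply: cvgV => //; apply: cvgD; under eq_fun do rewrite expr2; apply: cvgM.
split.
- by under eq_fun do rewrite ReV; rewrite ReV; apply: cvgM.
- by under eq_fun do rewrite ImV; rewrite ImV; apply: cvgM => //; exact: cvgN.
Qed.

Lemma ccont_exp c t : ccont c t -> ccont (fun u => cexp (c u)) t.
Proof.
move=> [a1 a2]; split; apply: cvgM.
- by apply: (cvg_comp _ _ a1); exact: continuous_expR.
- by apply: (cvg_comp _ _ a2); exact: continuous_cos.
- by apply: (cvg_comp _ _ a1); exact: continuous_expR.
- by apply: (cvg_comp _ _ a2); exact: continuous_sin.
Qed.

(** The factor 2 comes from the componentwise use of the real theorem. *)
Lemma cder_mvt c (v : R -> R[i]) (a b B : R) : a <= b ->
  (forall u, a <= u <= b -> cder c u (v u)) ->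
  (forall u, a <= u <= b -> normc (v u) <= B) ->
  normc (c b - c a) <= 2 * B * (b - a).
Proof.
move=> ab hd hB.
have H (f df : R -> R) : (forall u, a <= u <= b -> is_derive u 1 f (df u)) ->
    (forall u, a <= u <= b -> `|df u| <= B) -> `|f b - f a| <= B * (b - a).
  move=> fd fB; have [->|nab] := eqVneq a b; first by rewrite !subrr normr0 mulr0.
  have ab' : a < b by rewrite lt_neqAle nab ab.
  have [||x xab ->] := @MVT _ f df a b ab'.
  - by move=> x; rewrite in_itv/= => /andP[h1 h2]; apply: fd; rewrite !ltW.
  - apply: derivable_within_continuous => x; rewrite in_itv/= => h.
    by have [] := fd _ h.
  rewrite normrM [`|b - a|]ger0_norm ?subr_ge0// ler_wpM2r ?subr_ge0//.
  by apply: fB; move: xab; rewrite in_itv/= => /andP[h1 h2]; rewrite !ltW.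
rewrite (le_trans (normc_le_ReIm _))// !ReImE -mulrA mulr_natl mulr2n lerD//.
- apply: (H (fun u => Re (c u)) (fun u => Re (v u))) => u hu; first by have [] := hd u hu.
  by rewrite (le_trans (normc_Re _))// hB.
- apply: (H (fun u => Im (c u)) (fun u => Im (v u))) => u hu; first by have [] := hd u hu.
  by rewrite (le_trans (normc_Im _))// hB.
Qed.

Lemma cder0_cst c : (forall t, cder c t 0) -> forall a b, c a = c b.
Proof.
move=> h; suff H a b : a <= b -> c b = c a.
  by move=> a b; case: (leP a b) => [/H//|/ltW/H].
move=> ab; apply/eqP; rewrite -subr_eq0 -normc_eq0 eq_le normc_ge0 andbT.
have := @cder_mvt c (fun=> 0) a b 0 ab; rewrite mulr0 mul0r; apply => // *.
by rewrite normc0'.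
Qed.

End Curves.

(** * Integrals of complex-valued functions *)

Section ComplexIntegral.
Context {R : realType}.
Local Notation mu := (@lebesgue_measure R).
Implicit Types (D : set (measurableTypeR R)) (f : R -> R[i]) (h : R -> R).

Definition cmeas D f := measurable_fun D (fun x => Re (f x)) /\
  measurable_fun D (fun x => Im (f x)).

Definition cintble D f := mu.-integrable D (EFin \o (fun x => Re (f x))) /\
  mu.-integrable D (EFin \o (fun x => Im (f x))).

Lemma cmeas_cst D (a : R[i]) : cmeas D (fun=> a).
Proof. by split; exact: measurable_cst. Qed.

Lemma cmeasD D f g : cmeas D f -> cmeas D g -> cmeas D (fun x => f x + g x).
Proof.
move=> [f1 f2] [g1 g2]; split; under eq_fun do rewrite ReImE; exact: measurable_funD.
Qed.

Lemma cmeasM D f g : cmeas D f -> cmeas D g -> cmeas D (fun x => f x * g x).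
Proof.
move=> [f1 f2] [g1 g2]; split; under eq_fun do rewrite ReImE.
- by apply: measurable_funB; apply: measurable_funM.
- by apply: measurable_funD; apply: measurable_funM.
Qed.

Lemma cmeasN D f : cmeas D f -> cmeas D (fun x => - f x).
Proof.
move=> m; under eq_fun do rewrite -mulN1r.
exact: cmeasM (cmeas_cst _ _) m.
Qed.

Lemma cmeasB D f g : cmeas D f -> cmeas D g -> cmeas D (fun x => f x - g x).
Proof. by move=> mf mg; apply: cmeasD => //; exact: cmeasN. Qed.

Lemma cmeasX D f n : cmeas D f -> cmeas D (fun x => f x ^+ n).
Proof.
move=> mf; elim: n => [|n IH].
  by under eq_fun do rewrite expr0; exact: cmeas_cst.
by under eq_fun do rewrite exprS; exact: cmeasM.
Qed.

Lemma cmeas_exp D f : measurable D -> cmeas D f -> cmeas D (fun x => cexp (f x)).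
Proof.
move=> mD [f1 f2].
have c1 : measurable_fun D (fun x => expR (Re (f x))).
  by apply: measurableT_comp f1 => //; exact: continuous_measurable_fun (@continuous_expR R).
split; apply: measurable_funM => //.
- by apply: measurableT_comp f2 => //; exact: continuous_measurable_fun (@continuous_cos R).
- by apply: measurableT_comp f2 => //; exact: continuous_measurable_fun (@continuous_sin R).
Qed.

Lemma cmeas_if D f g (p : R -> bool) : measurable D -> measurable_fun D (p : measurableTypeR R -> bool) ->
  cmeas D f -> cmeas D g -> cmeas D (fun x => if p x then f x else g x).
Proof.
move=> mD mp [f1 f2] [g1 g2]; split.
- rewrite (_ : (fun x => Re _) = (fun x => if p x then Re (f x) else Re (g x))).
    by apply: measurable_fun_if => //; apply: measurable_funS (_ : measurable_fun D _) => //;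
      exact: subIsetl.
  by apply/funext => x; case: (p x).
- rewrite (_ : (fun x => Im _) = (fun x => if p x then Im (f x) else Im (g x))).
    by apply: measurable_fun_if => //; apply: measurable_funS (_ : measurable_fun D _) => //;
      exact: subIsetl.
  by apply/funext => x; case: (p x).
Qed.

Lemma ccont_cmeas D f : measurable D -> (forall x, ccont f x) -> cmeas D f.
Proof.
move=> mD h; split; apply: measurable_funTS; apply: continuous_measurable_fun => x;
  by case: (h x).
Qed.

Lemma cmeas_bound_integrable D f h : measurable D -> cmeas D f ->
  mu.-integrable D (EFin \o h) -> (forall x, D x -> normc (f x) <= h x) ->
  cintble D f.
Proof.
move=> mD [m1 m2] ih fh; split.
- apply: le_integrable ih => //; first exact/measurable_EFinP.
  move=> x Dx; rewrite /= lee_fin (le_trans (normc_Re _))// (le_trans (fh _ Dx))//.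
  exact: ler_norm.
- apply: le_integrable ih => //; first exact/measurable_EFinP.
  move=> x Dx; rewrite /= lee_fin (le_trans (normc_Im _))// (le_trans (fh _ Dx))//.
  exact: ler_norm.
Qed.

Lemma eq_cintegral D f g : (forall x, D x -> f x = g x) ->
  cintegral D f = cintegral D g.
Proof.
move=> fg; rewrite /cintegral; congr (_ +i* _); apply: eq_Rintegral => x /set_mem Dx;
  by rewrite fg.
Qed.

Lemma cintegralD D f g : measurable D -> cintble D f -> cintble D g ->
  cintegral D (fun x => f x + g x) = cintegral D f + cintegral D g.
Proof.
move=> mD [f1 f2] [g1 g2]; apply: complexP; rewrite !ReImE /=.
- by rewrite -RintegralD//; apply: eq_Rintegral => x _; rewrite ReImE.
- by rewrite -RintegralD//; apply: eq_Rintegral => x _; rewrite ReImE.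
Qed.

Lemma cintegralZ D (a : R[i]) f : measurable D -> cintble D f ->
  cintegral D (fun x => a * f x) = a * cintegral D f.
Proof.
move=> mD [f1 f2].
have Z (k : R) (h : R -> R) : mu.-integrable D (EFin \o h) ->
    mu.-integrable D (EFin \o (fun x => k * h x)).
  by move=> ih; have := integrableZl mD k ih.
apply: complexP; rewrite !ReImE /=.
- rewrite -!RintegralZl// -RintegralB//; [|exact: Z|exact: Z].
  by apply: eq_Rintegral => x _; rewrite ReImE.
- rewrite -!RintegralZl// -RintegralD//; [|exact: Z|exact: Z].
  by apply: eq_Rintegral => x _; rewrite ReImE.
Qed.

Lemma cintbleZ D (a : R[i]) f : measurable D -> cintble D f ->
  cintble D (fun x => a * f x).
Proof.
move=> mD [f1 f2].
have Z (k : R) (h : R -> R) : mu.-integrable D (EFin \o h) ->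
    mu.-integrable D (EFin \o (fun x => k * h x)).
  by move=> ih; have := integrableZl mD k ih.
split; under eq_fun do rewrite ReImE.
- by have := integrableB mD (Z (Re a) _ f1) (Z (Im a) _ f2).
- by have := integrableD mD (Z (Re a) _ f2) (Z (Im a) _ f1).
Qed.

Lemma cintbleD D f g : measurable D -> cintble D f -> cintble D g ->
  cintble D (fun x => f x + g x).
Proof.
move=> mD [f1 f2] [g1 g2]; split; under eq_fun do rewrite ReImE.
- by have := integrableD mD f1 g1.
- by have := integrableD mD f2 g2.
Qed.

Lemma cintegralN D f : measurable D -> cintble D f ->
  cintegral D (fun x => - f x) = - cintegral D f.
Proof.
move=> mD fi; rewrite -mulN1r -cintegralZ//.
by apply: eq_cintegral => x _; rewrite mulN1r.
Qed.

Lemma cintbleN D f : measurable D -> cintble D f -> cintble D (fun x => - f x).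
Proof. by move=> mD fi; under eq_fun do rewrite -mulN1r; exact: cintbleZ. Qed.

Lemma cintbleB D f g : measurable D -> cintble D f -> cintble D g ->
  cintble D (fun x => f x - g x).
Proof. by move=> mD fi gi; apply: cintbleD => //; exact: cintbleN. Qed.

Lemma cintegralB D f g : measurable D -> cintble D f -> cintble D g ->
  cintegral D (fun x => f x - g x) = cintegral D f - cintegral D g.
Proof. by move=> mD fi gi; rewrite cintegralD ?cintegralN//; exact: cintbleN. Qed.

Lemma normc_cintegral_le D f h : measurable D -> cintble D f ->
  mu.-integrable D (EFin \o h) -> (forall x, D x -> normc (f x) <= h x) ->
  normc (cintegral D f) <= 2 * \int[mu]_(x in D) h x.
Proof.
move=> mD [f1 f2] ih fh.
rewrite (le_trans (normc_le_ReIm _))//= mulr_natl mulr2n lerD//.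
- apply: (le_trans (le_normr_Rintegral mD f1)); apply: le_Rintegral => //.
    exact: integrable_norm.
  by move=> x Dx; rewrite (le_trans (normc_Re _))// fh.
- apply: (le_trans (le_normr_Rintegral mD f2)); apply: le_Rintegral => //.
    exact: integrable_norm.
  by move=> x Dx; rewrite (le_trans (normc_Im _))// fh.
Qed.

(** The exceptional point [x0] is where the limit function jumps or has a
    singularity. *)
Lemma cintegral_dct D (f_ : nat -> R -> R[i]) f h (x0 : R) : measurable D ->
  (forall n, cmeas D (f_ n)) -> cmeas D f -> mu.-integrable D (EFin \o h) ->
  (forall n x, D x -> normc (f_ n x) <= h x) ->
  (forall x, D x -> x != x0 -> normc (f_ n x - f x) @[n --> \oo] --> 0) ->
  normc (cintegral D (f_ n) - cintegral D f) @[n --> \oo] --> 0.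
Proof.
move=> mD mf_ mf ih fh cf.
have K (P : R[i] -> R) : (forall z, `|P z| <= normc z) ->
    (forall z w, P (z - w) = P z - P w) ->
    (forall n, measurable_fun D (fun x => P (f_ n x))) ->
    measurable_fun D (fun x => P (f x)) ->
    \int[mu]_(x in D) P (f_ n x) @[n --> \oo] --> \int[mu]_(x in D) P (f x).
  move=> Ple PB mP_ mP.
  have [|||||i1 _ i3] := @dominated_convergence _ _ _ mu D mD
     (fun n x => (P (f_ n x))%:E) (fun x => (P (f x))%:E) (EFin \o h).
  - by move=> n; exact/measurable_EFinP.
  - exact/measurable_EFinP.
  - exists [set x0]; split => //; first exact: lebesgue_measure_set1.
    move=> x /= /not_implyP[Dx nx]; apply: contrapT => /eqP xx0; apply: nx.
    apply: cvg_EFin; first exact: nearW.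
    apply/cvgrPdist_le => e e0; have /cvgrPdist_le/(_ e e0) := cf x Dx xx0.
    apply: filterS => n; rewrite sub0r normrN ger0_norm ?normc_ge0// => le.
    by rewrite /= distrC -PB (le_trans (Ple _)).
  - by [].
  - by apply: aeW => x n Dx; rewrite /= lee_fin (le_trans (Ple _))// fh.
  rewrite /Rintegral; apply: fine_cvg.
  by rewrite fineK//; exact: integrable_fin_num.
have c1 := K (fun z => Re z) (@normc_Re _) ReB.
have c2 := K (fun z => Im z) (@normc_Im _) ImB.
have {}c1 := c1 (fun n => (mf_ n).1) mf.1; have {}c2 := c2 (fun n => (mf_ n).2) mf.2.
apply: (@squeeze_cvgr _ _ _ _ (cst 0) (fun n =>
  `|\int[mu]_(x in D) Re (f_ n x) - \int[mu]_(x in D) Re (f x)| +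
  `|\int[mu]_(x in D) Im (f_ n x) - \int[mu]_(x in D) Im (f x)|)).
- apply: nearW => n; apply/andP; split; first exact: normc_ge0.
  exact: (le_trans (normc_le_ReIm _)).
- exact: cvg_cst.
- rewrite -[X in _ --> X](addr0 (0:R)); apply: cvgD.
  + by move/subr_cvg0/cvg_norm : c1; rewrite normr0.
  + by move/subr_cvg0/cvg_norm : c2; rewrite normr0.
Qed.

Lemma cder_cintegral D (f f' : R -> R -> R[i]) h (a d : R) : measurable D ->
  0 < d -> (forall x, 0 <= h x) -> mu.-integrable D (EFin \o h) ->
  (forall t, `|t - a| < d -> cintble D (f t)) ->
  (forall t x, `|t - a| < d -> D x -> cder (f ^~ x) t (f' t x)) ->
  (forall t x, `|t - a| < d -> D x -> normc (f' t x) <= h x) ->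
  cder (fun t => cintegral D (f t)) a (cintegral D (f' a)).
Proof.
move=> mD d0 h0 ih fi fd f'h.
have I t : `]a - d, a + d[%classic t -> `|t - a| < d.
  by rewrite /= in_itv/= ltr_distl.
have Ia : `]a - d, a + d[%classic a by rewrite /= in_itv/= ltrBlDr ltrDl d0.
have K (P : R[i] -> R) : (forall z, `|P z| <= normc z) ->
  (forall t, `|t - a| < d -> mu.-integrable D (EFin \o (fun x => P (f t x)))) ->
  (forall t x, `|t - a| < d -> D x -> is_derive t 1 (fun u => P (f u x)) (P (f' t x))) ->
  is_derive a 1 (fun t => \int[mu]_(x in D) P (f t x)) (\int[mu]_(x in D) P (f' a x)).
  move=> Ple Pi Pd.
  pose F t x := P (f t x).
  have dE t x : `]a - d, a + d[%classic t -> D x -> partial1of2 F t x = P (f' t x).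
    by move=> /I It Dx; rewrite partial1of2E; have [_ ->] := Pd _ _ It Dx.
  have Fi t : `]a - d, a + d[%classic t -> mu.-integrable D (EFin \o F t).
    by move=> /I /Pi.
  have Fd t x : `]a - d, a + d[%classic t -> D x -> derivable (F ^~ x) t 1.
    by move=> /I It Dx; have [] := Pd _ _ It Dx.
  have Fh t x : `]a - d, a + d[%classic t -> D x -> `|partial1of2 F t x| <= h x.
    by move=> It Dx; rewrite dE// (le_trans (Ple _))// f'h//; exact: I.
  have e1 := derivable_under_integral mD Ia Fi Fd h0 ih Fh.
  have e2 := differentiation_under_integral mD Ia Fi Fd h0 ih Fh.
  split => //; rewrite -derive1E e2.
  by apply: eq_Rintegral => x /set_mem Dx; rewrite dE.
split => /=.
- apply: (K (fun z => Re z)) => //; first exact: normc_Re.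
    by move=> t /fi[].
  by move=> t x ht Dx; have [] := fd _ _ ht Dx.
- apply: (K (fun z => Im z)) => //; first exact: normc_Im.
    by move=> t /fi[].
  by move=> t x ht Dx; have [] := fd _ _ ht Dx.
Qed.

Lemma ccont_itv_cintble f (a b : R) : (forall u, a <= u <= b -> ccont f u) ->
  cintble `[a, b] f.
Proof.
move=> cf; split; apply: continuous_compact_integrable; try exact: segment_compact.
- apply: continuous_in_subspaceT => x; rewrite inE /= in_itv/= => xab.
  by have [] := cf _ xab.
- apply: continuous_in_subspaceT => x; rewrite inE /= in_itv/= => xab.
  by have [] := cf _ xab.
Qed.

Lemma cintegral_ftc (c v : R -> R[i]) (a b : R) : a <= b ->
  (forall u, a <= u <= b -> cder c u (v u)) ->
  (forall u, a <= u <= b -> ccont v u) ->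
  cintegral `[a, b] v = c b - c a.
Proof.
rewrite le_eqVlt => /predU1P[->|ab] cd cv.
  by rewrite set_itv1 /cintegral !Rintegral_set1 subrr.
have K (f df : R -> R) : (forall u, a <= u <= b -> is_derive u 1 f (df u)) ->
    (forall u, a <= u <= b -> df x @[x --> u] --> df u) ->
    \int[mu]_(x in `[a, b]) df x = f b - f a.
  move=> fd dc; rewrite /Rintegral (@continuous_FTC2 _ df f)//.
  - apply: continuous_in_subspaceT => x; rewrite inE /= in_itv/= => xab.
    exact: dc.
  - have cf u : a <= u <= b -> f x @[x --> u] --> f u.
      by move=> /fd[h _]; exact/differentiable_continuous/derivable1_diffP.
    split.
    + by move=> x; rewrite in_itv/= => /andP[h1 h2]; have [] := fd x; rewrite ?(ltW h1) ?(ltW h2).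
    + by apply: cvg_at_right_filter; apply: cf; rewrite lexx ltW.
    + by apply: cvg_at_left_filter; apply: cf; rewrite lexx ltW.
  - move=> x; rewrite in_itv/= => /andP[h1 h2]; rewrite derive1E.
    by have [] := fd x; rewrite ?(ltW h1) ?(ltW h2).
apply: complexP; rewrite !ReImE /=.
- apply: (K (fun u => Re (c u))) => u hu; first by have [] := cd _ hu.
  by have [] := cv _ hu.
- apply: (K (fun u => Im (c u))) => u hu; first by have [] := cd _ hu.
  by have [] := cv _ hu.
Qed.

Lemma cintegral_itv_le f (a b B : R) : a <= b ->
  (forall u, a <= u <= b -> ccont f u) ->
  (forall u, a <= u <= b -> normc (f u) <= B) ->
  normc (cintegral `[a, b] f) <= 2 * (B * (b - a)).
Proof.
move=> ab cf fB.
have mi : mu `[a, b]%classic = (b - a)%:E.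
  rewrite lebesgue_measure_itv /= lte_fin; case: ifPn => //.
  by rewrite -leNgt => ba; rewrite (@le_anti _ _ a b) ?subrr// ab ba.
have := @normc_cintegral_le `[a, b] f (fun=> B); rewrite Rintegral_cst//.
rewrite (_ : fine _ = b - a); last by have := congr1 fine mi.
apply => //; first exact: ccont_itv_cintble.
- apply: measurable_bounded_integrable => //; first exact: (eq_ind_r (fun e => (e < +oo)%E) (ltry _) mi).
  exact: bounded_cst.
Qed.

End ComplexIntegral.

(** * Integrals over the real line *)

Section Line.
Context {R : realType}.
Local Notation mu := (@lebesgue_measure R).
Implicit Types (f g : R -> R[i]) (x : R).

(** One integrable function dominates everything that is integrated over the
    line; its multiples are stable under sums, translations and reflection. *)
Definition lor x : R := (oneDsqr x)^-1.

Lemma lor_gt0 x : 0 < lor x.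
Proof. by rewrite invr_gt0 (lt_le_trans ltr01)// oneDsqr_ge1. Qed.

Lemma lor_ge0 x : 0 <= lor x.
Proof. exact/ltW/lor_gt0. Qed.

Lemma lor_le1 x : lor x <= 1.
Proof. exact: oneDsqrV_le1. Qed.

Lemma lorN x : lor (- x) = lor x.
Proof. by rewrite /lor /oneDsqr sqrrN. Qed.

Lemma lor_int : (\int[mu]_x (lor x)%:E = pi%:E)%E.
Proof.
rewrite ge0_symfun_integralT.
- rewrite -set_itvcy integral0y_oneDsqr -EFinM; congr (_%:E); by rewrite mulrC divfK.
- by move=> x; exact: lor_ge0.
- exact: continuous_oneDsqrV.
- by move=> x /=; rewrite lorN.
Qed.

Lemma lor_meas : measurable_fun (setT : set (measurableTypeR R)) lor.
Proof. by apply: continuous_measurable_fun => x; exact: continuous_oneDsqrV. Qed.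

Lemma lor_integrable : mu.-integrable setT (EFin \o lor).
Proof.
apply/integrableP; split; first by apply/measurable_EFinP; exact: lor_meas.
under eq_integral do rewrite /= ger0_norm ?lor_ge0//.
by rewrite lor_int ltry.
Qed.

Lemma lorZ_integrable (K : R) : mu.-integrable setT (EFin \o (fun x => K * lor x)).
Proof. by have := integrableZl (@measurableT _ (measurableTypeR R)) K lor_integrable. Qed.

Lemma lor_Rint : \int[mu]_x lor x = pi.
Proof. by rewrite /Rintegral lor_int. Qed.

Lemma lor_shift x b : lor (x + b) <= (2 * (1 + b ^+ 2)) * lor x.
Proof.
have p : 0 < oneDsqr x by rewrite (lt_le_trans ltr01)// oneDsqr_ge1.
have q : 0 < oneDsqr (x + b) by rewrite (lt_le_trans ltr01)// oneDsqr_ge1.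
rewrite /lor ler_pdivlMr// mulrC ler_pdivrMr// /oneDsqr.
have := sqr_ge0 (x + 2 * b); have := sqr_ge0 (b * (x + b)).
have := sqr_ge0 b; nra.
Qed.

(** From 1 + u <= e^u, applied to a fraction of the exponent. *)
Lemma lor_expR (k : R) n : 0 < k ->
  exists C, 0 <= C /\ forall x, (1 + `|x|) ^+ n * expR (- (k * `|x|)) <= C * lor x.
Proof.
move=> k0; pose m : R := n.+2%:R; have m0 : 0 < m by rewrite ltr0n.
pose c := Num.min 1 (k / m).
have c0 : 0 < c by rewrite lt_min ltr01 divr_gt0.
exists (c ^- n.+2); split; first by rewrite invr_ge0 exprn_ge0// ltW.
move=> x; have x0 := normr_ge0 x.
have h : c * (1 + `|x|) <= expR (k / m * `|x|).
  rewrite (le_trans _ (expR_ge1Dx _))// mulrDr mulr1 lerD//.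
    by rewrite ge_min lexx.
  by rewrite ler_wpM2r// ge_min lexx orbT.
have h2 : c ^+ n.+2 * (1 + `|x|) ^+ n.+2 <= expR (k * `|x|).
  rewrite -exprMn (_ : k * `|x| = m * (k / m * `|x|)); last first.
    by field; rewrite gt_eqF.
  rewrite /m expRM_natl ler_pXn2r ?nnegrE ?expR_ge0//.
  by rewrite mulr_ge0 ?addr_ge0// ltW.
have lx : lor x * (1 + `|x|) ^+ 2 >= 1.
  have o0 : 0 < oneDsqr x by rewrite (lt_le_trans ltr01)// oneDsqr_ge1.
  rewrite mulrC ler_pdivlMr// mul1r /oneDsqr sqrrD expr1n mul1r -addrA lerD2l.
  by rewrite real_normK ?num_real// lerDr mulrn_wge0.
rewrite expRN ler_pdivrMr ?expR_gt0//.
have cm : 0 < c ^+ n.+2 by rewrite exprn_gt0.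
rewrite -mulrA [_ * (_ * _)]mulrC ler_pdivlMr//.
have := lor_ge0 x; set L := lor x in lx *.
have Q2 : (1 + `|x|) ^+ n.+2 = (1 + `|x|) ^+ n * (1 + `|x|) ^+ 2 by rewrite -exprD addn2.
rewrite Q2 in h2.
have P0 : 0 <= (1 + `|x|) ^+ n by rewrite exprn_ge0// addr_ge0.
move=> L0; have := ler_wpM2l L0 h2.
have := ler_wpM2l (mulr_ge0 P0 (ltW cm)) lx.
move: (expR _) ((1 + `|x|) ^+ n) ((1 + `|x|) ^+ 2) (c ^+ _) => E P Q cc.
lra.
Qed.

Lemma lor_exp (k : R) : 0 < k ->
  exists C, 0 <= C /\ forall x, expR (- (k * `|x|)) <= C * lor x.
Proof.
move=> k0; have [C [C0 h]] := lor_expR 0 k0; exists C; split => // x.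
by rewrite (le_trans _ (h x))// expr0 mul1r.
Qed.

Definition Cint f : R[i] := cintegral setT f.

Definition Cdom f := cmeas (setT : set (measurableTypeR R)) f /\
  exists K, forall x, normc (f x) <= K * lor x.

Lemma Cdom_cintble f : Cdom f -> cintble setT f.
Proof.
by move=> [mf [K fK]]; apply: (cmeas_bound_integrable _ mf (lorZ_integrable K)).
Qed.

Lemma Cdom_ge0 f : Cdom f -> exists K, 0 <= K /\ forall x, normc (f x) <= K * lor x.
Proof.
move=> [_ [K fK]]; exists `|K|; split => // x.
by rewrite (le_trans (fK x))// ler_wpM2r ?lor_ge0// ler_norm.
Qed.

Lemma Cint_le f K : cmeas (setT : set (measurableTypeR R)) f ->
  (forall x, normc (f x) <= K * lor x) -> normc (Cint f) <= 2 * pi * K.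
Proof.
move=> mf fK; have fi : cintble setT f by apply: Cdom_cintble; split => //; exists K.
have := normc_cintegral_le measurableT fi (lorZ_integrable K) (fun x _ => fK x).
rewrite RintegralZl//; last exact: lor_integrable.
by rewrite lor_Rint mulrA mulrAC.
Qed.

Lemma eq_Cint f g : (forall x, f x = g x) -> Cint f = Cint g.
Proof. by move=> fg; apply: eq_cintegral => x _. Qed.

Lemma CintD f g : Cdom f -> Cdom g -> Cint (fun x => f x + g x) = Cint f + Cint g.
Proof. by move=> ? ?; apply: cintegralD => //; exact: Cdom_cintble. Qed.

Lemma CintB f g : Cdom f -> Cdom g -> Cint (fun x => f x - g x) = Cint f - Cint g.
Proof. by move=> ? ?; apply: cintegralB => //; exact: Cdom_cintble. Qed.

Lemma CintN f : Cdom f -> Cint (fun x => - f x) = - Cint f.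
Proof. by move=> ?; apply: cintegralN => //; exact: Cdom_cintble. Qed.

Lemma CintZ (a : R[i]) f : Cdom f -> Cint (fun x => a * f x) = a * Cint f.
Proof. by move=> ?; apply: cintegralZ => //; exact: Cdom_cintble. Qed.

Lemma CdomD f g : Cdom f -> Cdom g -> Cdom (fun x => f x + g x).
Proof.
move=> [mf [K fK]] [mg [L gL]]; split; first exact: cmeasD.
exists (K + L) => x; rewrite mulrDl (le_trans (le_normcD _ _))// lerD//.
Qed.

Lemma CdomZ (a : R[i]) f : Cdom f -> Cdom (fun x => a * f x).
Proof.
move=> [mf [K fK]]; split; first exact: cmeasM (cmeas_cst _ _) mf.
by exists (normc a * K) => x; rewrite Normc.normcM -mulrA ler_wpM2l ?normc_ge0.
Qed.

Lemma CdomN f : Cdom f -> Cdom (fun x => - f x).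
Proof.
move=> [mf [K fK]]; split; first exact: cmeasN.
by exists K => x; rewrite normcN.
Qed.

Lemma CdomB f g : Cdom f -> Cdom g -> Cdom (fun x => f x - g x).
Proof. by move=> ? ?; apply: CdomD => //; exact: CdomN. Qed.

Let transfer (phi : measurableTypeR R -> measurableTypeR R) f :
  measurable_fun setT phi ->
  (forall A, measurable A -> pushforward mu phi A = mu A) ->
  cintble setT f -> cintble setT (fun x => f (phi x)) ->
  cmeas (setT : set (measurableTypeR R)) f -> Cint (fun x => f (phi x)) = Cint f.
Proof.
move=> mphi pA [i1 i2] [j1 j2] [m1 m2].
pose phi' : {mfun measurableTypeR R >-> measurableTypeR R} :=
  MeasurableFun.Pack (MeasurableFun.Class (isMeasurableFun.Build _ _ _ _ _ mphi)).
have K (h : R -> R) : measurable_fun (setT : set (measurableTypeR R)) h ->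
   mu.-integrable setT (EFin \o (fun x => h (phi x))) ->
   \int[mu]_x h (phi x) = \int[mu]_x h x.
  move=> mh ih; rewrite /Rintegral; congr fine.
  have := @integral_pushforward _ _ (measurableTypeR R) (measurableTypeR R) R phi mphi mu setT
     (EFin \o h).
  rewrite preimage_setT => /(_ _ _ measurableT) <-//; last first.
    exact/measurable_EFinP.
  apply: (@eq_measure_integral _ _ _ setT mu (pushforward mu phi')) => A mA _.
  exact: pA.
by apply: complexP; rewrite /=; apply: K.
Qed.

Lemma Cdom_shift f b : Cdom f -> Cdom (fun x => f (x + b)).
Proof.
move=> fd; have [K [K0 fK]] := Cdom_ge0 fd; move: fd => [[m1 m2] _].
have mb : measurable_fun (setT : set (measurableTypeR R)) (fun x : measurableTypeR R => x + b).
  by apply: measurable_funD.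
split.
  by split; [apply: (measurableT_comp m1)|apply: (measurableT_comp m2)].
exists (K * (2 * (1 + b ^+ 2))) => x; rewrite (le_trans (fK _))// -mulrA.
by rewrite ler_wpM2l// lor_shift.
Qed.

Lemma Cdom_opp f : Cdom f -> Cdom (fun x => f (- x)).
Proof.
move=> [[m1 m2] [K fK]]; split.
  by split; [apply: (measurableT_comp m1)|apply: (measurableT_comp m2)].
by exists K => x; rewrite (le_trans (fK _))// lorN.
Qed.

Lemma Cint_shift f b : Cdom f -> Cint (fun x => f (x + b)) = Cint f.
Proof.
move=> fd; have fi := Cdom_cintble fd; have gi := Cdom_cintble (Cdom_shift b fd).
pose phi : measurableTypeR R -> measurableTypeR R := fun x => x + b.
have mb : measurable_fun setT phi.
  by apply: measurable_funD.
apply: (transfer mb) => //; last by case: fd.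
pose phi' : {mfun measurableTypeR R >-> measurableTypeR R} :=
  MeasurableFun.Pack (MeasurableFun.Class (isMeasurableFun.Build _ _ _ _ _ mb)).
move=> A mA; apply/esym.
apply: (@lebesgue_measure_unique R (pushforward mu phi')) => //= _ [[c d]] _ <-.
rewrite /pushforward /= /phi.
rewrite (_ : _ @^-1` _ = `](c - b), (d - b)]%classic); last first.
  by apply/seteqP; split => x /=; rewrite !in_itv/= ltrBlDr lerBrDr.
rewrite !lebesgue_measure_itv/= !lte_fin ltrD2r.
by case: ifP => // _; rewrite -!EFinB opprB addrA subrK.
Qed.

Lemma Cint_opp f : Cdom f -> Cint (fun x => f (- x)) = Cint f.
Proof.
move=> fd; have fi := Cdom_cintble fd; have gi := Cdom_cintble (Cdom_opp fd).
apply: (@transfer -%R) => //; last by case: fd.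
exact: lebesgue_measureN.
Qed.

Lemma Cint_odd f : Cdom f -> (forall x, f (- x) = - f x) -> Cint f = 0.
Proof.
move=> fd fN; have := Cint_opp fd.
rewrite (eq_Cint fN) CintN// => /esym/eqP.
by rewrite -addr_eq0 -mulr2n mulrn_eq0 => /eqP.
Qed.

Lemma Cint_lim f : Cdom f ->
  normc (cintegral `[(- n%:R), n%:R] f - Cint f) @[n --> \oo] --> 0.
Proof.
move=> fd; have [K [K0 fK]] := Cdom_ge0 fd; move: fd => [mf _].
pose p (n : nat) (x : R) := (- n%:R <= x <= n%:R).
have E n : cintegral `[(- n%:R), n%:R] f = Cint (fun x => if p n x then f x else 0).
  apply: complexP => /=; rewrite Rintegral_mkcond; apply: eq_Rintegral => x _;
  by rewrite patchE mem_setE in_itv/= /p; case: ifP.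
under eq_fun do rewrite E.
apply: (@cintegral_dct _ _ _ _ (fun x => K * lor x) 0) => //.
- move=> n; apply: (@cmeas_if _ setT f (fun=> 0) (p n)) => //.
  by apply: measurable_and; apply: measurable_fun_ler.
- exact: lorZ_integrable.
- move=> n x _; case: ifP => _; first exact: fK.
  by rewrite normc0' mulr_ge0 ?lor_ge0.
- move=> x _ _; apply: cvg_near_cst.
  near=> n; rewrite /p -ler_norml.
  have -> : `|x| <= n%:R by near: n; exact: nbhs_infty_ger.
  by rewrite subrr normc0'.
Unshelve. all: end_near. Qed.

End Line.

(** * Holomorphic functions and contour shifts *)

Section Holomorphic.
Context {R : realType}.
Local Notation mu := (@lebesgue_measure R).
Implicit Types (U V : R[i] -> Prop) (f g : R[i] -> R[i]) (z v : R[i]).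

(** Complex differentiability, tested along straight lines. *)
Definition hol U f f' := forall z v, U z ->
  cder (fun t : R => f (z + t%:C * v)) 0 (v * f' z).

Definition bnd U f := exists B : R, forall z, U z -> normc (f z) <= B.

Definition lcont U f := forall z v, U z -> ccont (fun t : R => f (z + t%:C * v)) 0.

(** The working notion of a holomorphic function: the derivative is bounded and
    continuous along lines, which is what differentiating under the integral
    and integrating back requires in [cauchy_rect]. *)
Definition regd U f f' := [/\ hol U f f', bnd U f, bnd U f' & lcont U f'].

Definition reg U f := exists f', regd U f f'.

Lemma reg_sub U V f : (forall z, U z -> V z) -> reg V f -> reg U f.
Proof.
move=> UV [f' [h [B hB] [B' hB'] hc]]; exists f'; split.
- by move=> z v /UV; exact: h.
- by exists B => z /UV; exact: hB.
- by exists B' => z /UV; exact: hB'.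
- by move=> z v /UV; exact: hc.
Qed.

Lemma reg_ext U f g : (forall z, f z = g z) -> reg U f -> reg U g.
Proof. by move=> /funext ->. Qed.

Lemma bnd_ge0 U f : bnd U f -> exists B : R, 0 <= B /\ forall z, U z -> normc (f z) <= B.
Proof.
move=> [B h]; exists `|B|; split => // z Uz.
by rewrite (le_trans (h _ Uz))// ler_norm.
Qed.

Lemma bndD U f g : bnd U f -> bnd U g -> bnd U (fun z => f z + g z).
Proof.
move=> [B hB] [C hC]; exists (B + C) => z Uz.
by rewrite (le_trans (le_normcD _ _))// lerD ?hB ?hC.
Qed.

Lemma bndM U f g : bnd U f -> bnd U g -> bnd U (fun z => f z * g z).
Proof.
move=> [B hB] /bnd_ge0[C [C0 hC]]; exists (B * C) => z Uz.
by rewrite Normc.normcM ler_pM ?normc_ge0 ?hB ?hC.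
Qed.

Lemma bnd_cst U (a : R[i]) : bnd U (fun=> a).
Proof. by exists (normc a). Qed.

Lemma bnd_exp U f : bnd U f -> bnd U (fun z => cexp (f z)).
Proof.
move=> [B hB]; exists (expR B) => z Uz; rewrite normc_cexp ler_expR.
by rewrite (le_trans (ler_norm _))// (le_trans (normc_Re _))// hB.
Qed.

Lemma hol_lcont U f f' : hol U f f' -> lcont U f.
Proof. by move=> h z v Uz; exact: cder_cont (h z v Uz). Qed.

Lemma lcontD U f g : lcont U f -> lcont U g -> lcont U (fun z => f z + g z).
Proof. by move=> hf hg z v Uz; apply: ccontD; [exact: hf|exact: hg]. Qed.

Lemma lcontM U f g : lcont U f -> lcont U g -> lcont U (fun z => f z * g z).
Proof. by move=> hf hg z v Uz; apply: ccontM; [exact: hf|exact: hg]. Qed.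

Lemma lcont_cst U (a : R[i]) : lcont U (fun=> a).
Proof. by move=> z v Uz; exact: ccont_cst. Qed.

Lemma reg_cst U (a : R[i]) : reg U (fun=> a).
Proof.
exists (fun=> 0); split; [|exact: bnd_cst|exact: bnd_cst|exact: lcont_cst].
by move=> z v _; rewrite mulr0; exact: cder_cst.
Qed.

Lemma reg_id U : bnd U id -> reg U id.
Proof.
move=> h; exists (fun=> 1); split; [|exact: h|exact: bnd_cst|exact: lcont_cst].
move=> z v _; apply: cder_eq (cderD (cder_cst z 0) (cderM (cder_real 0) (cder_cst v 0))) _.
by rewrite mulr0 addr0 mul1r mulr1 add0r.
Qed.

Lemma regD U f g : reg U f -> reg U g -> reg U (fun z => f z + g z).
Proof.
move=> [f' [f1 f2 f3 f4]] [g' [g1 g2 g3 g4]].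
exists (fun z => f' z + g' z); split; [|exact: bndD|exact: bndD|exact: lcontD].
by move=> z v Uz; rewrite mulrDr; apply: cderD; [exact: f1|exact: g1].
Qed.

Lemma regM U f g : reg U f -> reg U g -> reg U (fun z => f z * g z).
Proof.
move=> [f' [f1 f2 f3 f4]] [g' [g1 g2 g3 g4]].
exists (fun z => f' z * g z + f z * g' z); split.
- move=> z v Uz; apply: cder_eq (cderM (f1 z v Uz) (g1 z v Uz)) _.
  by rewrite mul0r addr0; ring.
- exact: bndM.
- by apply: bndD; apply: bndM.
- by apply: lcontD; apply: lcontM => //; [exact: hol_lcont g1|exact: hol_lcont f1].
Qed.

Lemma regZ U (a : R[i]) f : reg U f -> reg U (fun z => a * f z).
Proof. by move=> h; apply: regM => //; exact: reg_cst. Qed.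

Lemma regN U f : reg U f -> reg U (fun z => - f z).
Proof. by move=> h; under eq_fun do rewrite -mulN1r; exact: regZ. Qed.

Lemma regB U f g : reg U f -> reg U g -> reg U (fun z => f z - g z).
Proof. by move=> hf hg; apply: regD => //; exact: regN. Qed.

Lemma regX U f n : reg U f -> reg U (fun z => f z ^+ n).
Proof.
move=> h; elim: n => [|n IH].
  by under eq_fun do rewrite expr0; exact: reg_cst.
by under eq_fun do rewrite exprS; exact: regM.
Qed.

Lemma reg_exp U f : reg U f -> reg U (fun z => cexp (f z)).
Proof.
move=> [f' [f1 f2 f3 f4]]; exists (fun z => f' z * cexp (f z)); split.
- move=> z v Uz; apply: cder_eq (cder_exp (f1 z v Uz)) _.
  by rewrite mul0r addr0; ring.
- exact: bnd_exp.
- by apply: bndM => //; exact: bnd_exp.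
- apply: lcontM => // z v Uz; apply: ccont_exp; exact: (hol_lcont f1).
Qed.

Lemma regV U f (c : R) : 0 < c -> (forall z, U z -> c <= normc (f z)) ->
  reg U f -> reg U (fun z => (f z)^-1).
Proof.
move=> c0 cf [f' [f1 f2 f3 f4]].
have n0 z : U z -> f z != 0.
  by move=> Uz; rewrite -normc_gt0 (lt_le_trans c0)// cf.
have bV : bnd U (fun z => (f z)^-1).
  by exists c^-1 => z Uz; apply: normc_inv_le => //; exact: cf.
have cV : lcont U (fun z => (f z)^-1).
  move=> z v Uz; apply: ccontV; first by rewrite mul0r addr0 n0.
  exact: (hol_lcont f1).
exists (fun z => - f' z * ((f z)^-1 * (f z)^-1)); split.
- move=> z v Uz; have := cderV _ (f1 z v Uz); rewrite mul0r addr0 => /(_ (n0 _ Uz)) h.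
  apply: cder_eq h _; rewrite -exprVn expr2; ring.
- by [].
- apply: bndM; last exact: bndM.
  by under eq_fun do rewrite -mulN1r; apply: bndM => //; exact: bnd_cst.
- apply: lcontM; last exact: lcontM.
  by move=> z v Uz; apply: ccontN; exact: f4.
Qed.

Lemma reg_affine U V f (a b : R[i]) : reg V f -> (forall z, U z -> V (a * z + b)) ->
  reg U (fun z => f (a * z + b)).
Proof.
move=> [f' [f1 f2 f3 f4]] UV; exists (fun z => a * f' (a * z + b)).
have E (h : R[i] -> R[i]) z v (t : R) :
   h (a * z + b + t%:C * (a * v)) = h (a * (z + t%:C * v) + b).
  by congr h; ring.
split.
- move=> z v Uz; have := f1 (a * z + b) (a * v) (UV _ Uz).
  move=> h; apply: cder_eq; first by apply: cder_ext h => t; rewrite E.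
  ring.
- by have [B hB] := f2; exists B => z /UV; exact: hB.
- have [B hB] := f3; exists (normc a * B) => z /UV /hB.
  by rewrite Normc.normcM; apply: ler_wpM2l; exact: normc_ge0.
- move=> z v Uz; apply: ccontM; first exact: ccont_cst.
  by have := f4 (a * z + b) (a * v) (UV _ Uz); apply: ccont_ext => t; rewrite E.
Qed.

Lemma hol_line U f f' z v (t : R) : hol U f f' -> U (z + t%:C * v) ->
  cder (fun u : R => f (z + u%:C * v)) t (v * f' (z + t%:C * v)).
Proof.
move=> h Uz; apply: cder_shift0; apply: cder_ext (h _ v Uz) => u.
by rewrite rmorphD /=; congr f; ring.
Qed.

Lemma lcont_line U f z v (t : R) : lcont U f -> U (z + t%:C * v) ->
  ccont (fun u : R => f (z + u%:C * v)) t.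
Proof.
move=> h Uz; have := h _ v Uz => -[h1 h2].
have E (P : R[i] -> R) : P (f (z + t%:C * v + x%:C * v)) @[x --> (0:R)] --> P (f (z + t%:C * v + 0%:C * v)) ->
    P (f (z + u%:C * v)) @[u --> t] --> P (f (z + t%:C * v)).
  rewrite mul0r addr0 => hh.
  have -> : (fun u : R => P (f (z + u%:C * v))) =
      (fun x : R => P (f (z + t%:C * v + x%:C * v))) \o (fun u => u - t).
    apply/funext => u /=; congr (P (f _)); rewrite rmorphB /=; ring.
  have c0 : u - t @[u --> t] --> (0 : R).
    by rewrite -[X in _ --> X](subrr t); apply: cvgB; [exact: cvg_id|exact: cvg_cst].
  exact: (cvg_comp _ _ c0 hh).
by split; [exact: E h1|exact: E h2].
Qed.

Definition box (x1 x2 y1 y2 : R) z := (x1 < Re z < x2) && (y1 < Im z < y2).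

Lemma bnd_box x1 x2 y1 y2 : bnd (box x1 x2 y1 y2) id.
Proof.
exists (`|x1| + `|x2| + (`|y1| + `|y2|)) => z /andP[/andP[h1 h2] /andP[h3 h4]].
rewrite (le_trans (normc_le_ReIm _))// lerD// ler_norml; apply/andP; split.
- by rewrite (le_trans _ (ltW h1))// lerNl (le_trans (ler_norm _))// normrN lerDl.
- by rewrite (le_trans (ltW h2))// (le_trans (ler_norm _))// lerDr.
- by rewrite (le_trans _ (ltW h3))// lerNl (le_trans (ler_norm _))// normrN lerDl.
- by rewrite (le_trans (ltW h4))// (le_trans (ler_norm _))// lerDr.
Qed.

Lemma box_open x1 x2 y1 y2 z v : box x1 x2 y1 y2 z -> exists2 d : R, 0 < d &
  forall t : R, `|t| < d -> box x1 x2 y1 y2 (z + t%:C * v).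
Proof.
move=> /andP[/andP[h1 h2] /andP[h3 h4]].
pose m := Num.min (Num.min (Re z - x1) (x2 - Re z)) (Num.min (Im z - y1) (y2 - Im z)).
have m0 : 0 < m by rewrite !lt_min !subr_gt0 h1 h2 h3 h4.
have n0 : 0 < normc v + 1 by rewrite ltr_wpDl// normc_ge0.
exists (m / (normc v + 1)); first by rewrite divr_gt0.
move=> t; rewrite ltr_pdivlMr// => tm.
have a1 : `|t * Re v| < m.
  rewrite normrM (le_lt_trans _ tm)// ler_wpM2l// (le_trans (normc_Re _))//.
  by rewrite lerDl.
have a2 : `|t * Im v| < m.
  rewrite normrM (le_lt_trans _ tm)// ler_wpM2l// (le_trans (normc_Im _))//.
  by rewrite lerDl.
move: a1 a2; rewrite /box !ReImE !lt_min !ltr_norml => /andP[a1 a2] /andP[b1 b2].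
move: a1 a2 b1 b2; rewrite /m.
have e1 : m <= Re z - x1 by rewrite !ge_min lexx.
have e2 : m <= x2 - Re z by rewrite !ge_min lexx ?orbT.
have e3 : m <= Im z - y1 by rewrite !ge_min lexx ?orbT.
have e4 : m <= y2 - Im z by rewrite !ge_min lexx ?orbT.
rewrite -/m => a1 a2 b1 b2.
by apply/andP; split; apply/andP; split; lra.
Qed.

(** The derivative in y of the horizontal integral of f is i times the integral
    of f', that is, i times the difference of f at the two ends; integrating in
    y gives Cauchy's theorem. *)
Lemma cauchy_rect f (X1 X2 Y1 Y2 x1 x2 y1 y2 : R) : reg (box X1 X2 Y1 Y2) f ->
  X1 < x1 -> x1 <= x2 -> x2 < X2 -> Y1 < y1 -> y1 <= y2 -> y2 < Y2 ->
  cintegral `[x1, x2] (fun x => f (x +i* y2)) - cintegral `[x1, x2] (fun x => f (x +i* y1)) =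
  'i * (cintegral `[y1, y2] (fun y => f (x2 +i* y)) - cintegral `[y1, y2] (fun y => f (x1 +i* y))).
Proof.
move=> [f' [f1 f2 f3 f4]] h1 h2 h3 h4 h5 h6.
have vE (x y : R) : x +i* y = x%:C + y%:C * 'i.
  by apply: complexP; rewrite !ReImE /=; ring.
have hE (x y : R) : x +i* y = 0 +i* y + x%:C * 1.
  by apply: complexP; rewrite !ReImE /=; ring.
have B x y : X1 < x < X2 -> Y1 < y < Y2 -> box X1 X2 Y1 Y2 (x +i* y).
  by move=> a b; apply/andP.
have dv x y : X1 < x < X2 -> Y1 < y < Y2 ->
    cder (fun y => f (x +i* y)) y ('i * f' (x +i* y)).
  move=> hx hy; have := B _ _ hx hy; rewrite vE => Uz.
  by apply: cder_ext (hol_line f1 Uz) => u; rewrite vE.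
have dh x y : X1 < x < X2 -> Y1 < y < Y2 ->
    cder (fun x => f (x +i* y)) x (f' (x +i* y)).
  move=> hx hy; have := B _ _ hx hy; rewrite hE => Uz.
  apply: cder_eq; first by apply: cder_ext (hol_line f1 Uz) => u; rewrite hE.
  by rewrite mul1r.
have ch x y : X1 < x < X2 -> Y1 < y < Y2 -> ccont (fun x => f' (x +i* y)) x.
  move=> hx hy; have := B _ _ hx hy; rewrite hE => Uz.
  by apply: ccont_ext (lcont_line f4 Uz) => u; rewrite -hE.
have x12 u : x1 <= u <= x2 -> X1 < u < X2.
  by move=> /andP[a b]; rewrite (lt_le_trans h1 a) (le_lt_trans b h3).
have ih K : mu.-integrable `[x1, x2] (EFin \o (fun=> K)).
  apply: measurable_bounded_integrable => //; last exact: bounded_cst.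
  have mi : (mu `[x1, x2]%classic < +oo)%E.
    by rewrite lebesgue_measure_itv /=; case: ifP => // _; rewrite -EFinB ltry.
  exact: mi.
have [K [K0 hK]] := bnd_ge0 f3.
have cd y : Y1 < y < Y2 -> cder (fun y => cintegral `[x1, x2] (fun x => f (x +i* y))) y
    ('i * (f (x2 +i* y) - f (x1 +i* y))).
  move=> hy; pose d := Num.min (y - Y1) (Y2 - y).
  have d0 : 0 < d by case/andP: hy => a b; rewrite lt_min !subr_gt0 a b.
  have hd t : `|t - y| < d -> Y1 < t < Y2.
    by rewrite lt_min !ltr_norml => /andP[/andP[a b] /andP[a' b']]; apply/andP; split; lra.
  have := @cder_cintegral R `[x1, x2] (fun y x => f (x +i* y))
    (fun y x => 'i * f' (x +i* y)) (fun=> K) y d.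
  move=> /(_ _ d0 _ (ih K) _ _ _) H; apply: cder_eq; first apply: H.
  - exact: measurable_itv.
  - by [].
  - move=> t /hd ht; apply: ccont_itv_cintble => u /x12 hu.
    exact: cder_cont (dh _ _ hu ht).
  - by move=> t x /hd ht; rewrite /= in_itv/= => /x12 hx; exact: dv.
  - move=> t x /hd ht; rewrite /= in_itv/= => /x12 hx.
    by rewrite Normc.normcM normci mul1r; apply/hK/B.
  rewrite cintegralZ//; last first.
    by apply: ccont_itv_cintble => u /x12 hu; exact: ch.
  congr (_ * _); apply: (@cintegral_ftc _ (fun x => f (x +i* y))) => // u /x12 hu.
  - exact: dh.
  - exact: ch.
have y12 u : y1 <= u <= y2 -> Y1 < u < Y2.
  by move=> /andP[a b]; rewrite (lt_le_trans h4 a) (le_lt_trans b h6).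
have hx1 : X1 < x1 < X2 by apply: x12; rewrite lexx.
have hx2 : X1 < x2 < X2 by apply: x12; rewrite lexx h2.
have cc x : X1 < x < X2 -> forall u, y1 <= u <= y2 -> ccont (fun y => f (x +i* y)) u.
  by move=> hx u /y12 hu; exact: cder_cont (dv _ _ hx hu).
transitivity (cintegral `[y1, y2] (fun y => 'i * (f (x2 +i* y) - f (x1 +i* y)))); last first.
  rewrite cintegralZ//; last first.
    by apply: cintbleB => //; apply: ccont_itv_cintble; exact: cc.
  by rewrite cintegralB//; apply: ccont_itv_cintble; exact: cc.
apply/esym/(@cintegral_ftc _ (fun y => cintegral `[x1, x2] (fun x => f (x +i* y)))) => //.
- by move=> u /y12; exact: cd.
- move=> u hu; apply: ccontM; first exact: ccont_cst.
  by apply: ccontD; last apply: ccontN; exact: cc.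
Qed.

Lemma le0_of_cvg0 (a : R) (u : nat -> R) : (forall n, a <= u n) ->
  u n @[n --> \oo] --> 0 -> a <= 0.
Proof.
move=> h c; rewrite -(cvg_lim (@Rhausdorff R) c).
by apply: limr_ge; [apply/cvg_ex; exists 0|exact: nearW].
Qed.

Lemma lor_nat0 : lor (n%:R : R) @[n --> \oo] --> 0.
Proof.
apply: (@squeeze_cvgr _ _ _ _ (cst 0) (fun n => harmonic n)).
- apply: nearW => n; rewrite /= lor_ge0/= /lor lef_pV2 ?posrE//.
  rewrite /oneDsqr -natrX -natr1 addrC lerD2l ler_nat.
  by case: n => // n; rewrite leq_pmulr.
- exact: cvg_cst.
- exact: cvg_harmonic.
Qed.

(** The vertical sides at Re = n and Re = - n tend to 0 with [lor]. *)
Lemma contour_shift f (Y1 Y2 y1 y2 K : R) : Y1 < y1 -> y1 <= y2 -> y2 < Y2 ->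
  (forall X, reg (box (- X) X Y1 Y2) f) ->
  (forall x y, y1 <= y <= y2 -> normc (f (x +i* y)) <= K * lor x) ->
  Cint (fun x => f (x +i* y1)) = Cint (fun x => f (x +i* y2)).
Proof.
move=> h1 h2 h3 fr fK.
have hE (x y : R) : x +i* y = 0 +i* y + x%:C * 1.
  by apply: complexP; rewrite !ReImE /=; ring.
have vE (x y : R) : x +i* y = x%:C + y%:C * 'i.
  by apply: complexP; rewrite !ReImE /=; ring.
have B X x y : `|x| < X -> Y1 < y < Y2 -> box (- X) X Y1 Y2 (x +i* y).
  by rewrite ltr_norml => a b; apply/andP.
have fc x y : Y1 < y < Y2 -> ccont (fun x => f (x +i* y)) x.
  move=> hy; have [f' [f1 _ _ _]] := fr (`|x| + 1).
  have := B (`|x| + 1) x y; rewrite ltrDl ltr01 => /(_ isT hy); rewrite hE => Uz.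
  by apply: ccont_ext (cder_cont (hol_line f1 Uz)) => u; rewrite -hE.
have fv x y : Y1 < y < Y2 -> ccont (fun y => f (x +i* y)) y.
  move=> hy; have [f' [f1 _ _ _]] := fr (`|x| + 1).
  have := B (`|x| + 1) x y; rewrite ltrDl ltr01 => /(_ isT hy); rewrite vE => Uz.
  by apply: ccont_ext (cder_cont (hol_line f1 Uz)) => u; rewrite -vE.
have hy1 : Y1 < y1 < Y2 by rewrite h1 (le_lt_trans h2).
have hy2 : Y1 < y2 < Y2 by rewrite h3 (lt_le_trans h1).
have d1 : Cdom (fun x => f (x +i* y1)).
  split; first by apply: ccont_cmeas => // x; exact: fc.
  by exists K => x; apply: fK; rewrite lexx.
have d2 : Cdom (fun x => f (x +i* y2)).
  split; first by apply: ccont_cmeas => // x; exact: fc.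
  by exists K => x; apply: fK; rewrite lexx h2.
apply/eqP; rewrite -subr_eq0 -normc_eq0 eq_le normc_ge0 andbT.
pose I (y : R) n := cintegral `[(- n%:R), n%:R] (fun x => f (x +i* y)).
pose u (n : nat) := normc (I y1 n - Cint (fun x => f (x +i* y1))) +
   normc (I y2 n - Cint (fun x => f (x +i* y2))) + 4 * (K * (y2 - y1)) * lor (n%:R : R).
apply: (@le0_of_cvg0 _ u) => [n|]; last first.
  rewrite -[X in _ --> X](addr0 (0:R)); apply: cvgD.
    rewrite -[X in _ --> X](addr0 (0:R)); apply: cvgD; exact: Cint_lim.
  rewrite -[X in _ --> X](mulr0 (4 * (K * (y2 - y1)))); apply: cvgM; first exact: cvg_cst.
  exact: lor_nat0.
have n0 : 0 <= n%:R :> R by [].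
have side (x : R) : `|x| = n%:R ->
    normc (cintegral `[y1, y2] (fun y => f (x +i* y))) <= 2 * (K * lor n%:R * (y2 - y1)).
  move=> xn; apply: cintegral_itv_le => // y /andP[a b].
    by apply: fv; rewrite (lt_le_trans h1 a) (le_lt_trans b h3).
  rewrite (le_trans (fK x y _)) ?a ?b// le_eqVlt; apply/orP; left; apply/eqP; congr (_ * _).
  by move: xn; case: (ger0P x) => _; [move=> ->|move=> <-; rewrite lorN].
have := @cauchy_rect f (- (n%:R + 1)) (n%:R + 1) Y1 Y2 (- n%:R) n%:R y1 y2 (fr _).
rewrite ltrN2 ltrDl ltr01 => /(_ isT _ isT h1 h2 h3).
rewrite (le_trans _ n0) ?oppr_le0// => /(_ isT) E.
have EI : normc (I y2 n - I y1 n) <= 4 * (K * (y2 - y1)) * lor (n%:R : R).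
  rewrite E Normc.normcM normci mul1r (le_trans (normcB _ _))//.
  have s1 := side n%:R (ger0_norm n0).
  have s2 := side (- n%:R); rewrite normrN ger0_norm// in s2.
  by have {}s2 := s2 erefl; lra.
rewrite /u; move: EI; set A := Cint _; set A' := Cint _ => EI.
have -> : A - A' = - (I y1 n - A) + (I y2 n - A') - (I y2 n - I y1 n) by ring.
rewrite (le_trans (normcB _ _))// lerD//.
by rewrite (le_trans (le_normcD _ _))// normcN.
Qed.

(** The line may be pushed onto the real axis, where f is allowed a singularity
    at 0 as long as the domination persists. *)
Lemma contour_limit f (f0 : R -> R[i]) (T Tm K : R) : 0 < T -> T < Tm ->
  (forall e X, 0 < e -> reg (box (- X) X e Tm) f) ->
  (forall x y, 0 < y <= T -> normc (f (x +i* y)) <= K * lor x) ->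
  cmeas (setT : set (measurableTypeR R)) f0 ->
  (forall x, x != 0 -> normc (f (x +i* (T / n.+1%:R)) - f0 x) @[n --> \oo] --> 0) ->
  Cint (fun x => f (x +i* T)) = Cint f0.
Proof.
move=> T0 Tm0 fr fK mf0 fc.
have y0 n : 0 < T / n.+1%:R by rewrite divr_gt0.
have yT n : T / n.+1%:R <= T.
  by rewrite ler_pdivrMr// ler_peMr ?(ltW T0)// ler1n.
have E n : Cint (fun x => f (x +i* (T / n.+1%:R))) = Cint (fun x => f (x +i* T)).
  apply: (@contour_shift _ (T / n.+1%:R / 2) Tm _ _ K) => //.
  - by rewrite ltr_pdivrMr// ltr_pMr// ltr1n.
  - by move=> X; apply: fr; rewrite divr_gt0.
  - by move=> x y /andP[a b]; apply: fK; rewrite (lt_le_trans (y0 n) a).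
have mf n : cmeas (setT : set (measurableTypeR R)) (fun x => f (x +i* (T / n.+1%:R))).
  apply: ccont_cmeas => // x; set y := T / _.
  have [f' [f1 _ _ _]] := fr (y / 2) (`|x| + 1) (divr_gt0 (y0 n) (ltr0n _ 2)).
  have hE (u : R) : u +i* y = 0 +i* y + u%:C * 1.
    by apply: complexP; rewrite !ReImE /=; ring.
  have Uz : box (- (`|x| + 1)) (`|x| + 1) (y / 2) Tm (0 +i* y + x%:C * 1).
    rewrite -hE /box /= -ltr_norml ltrDl ltr01/= (le_lt_trans (yT n))// andbT.
    by rewrite ltr_pdivrMr// ltr_pMr ?y0// ltr1n.
  by apply: ccont_ext (cder_cont (hol_line f1 Uz)) => u; rewrite -hE.
have := @cintegral_dct R setT (fun n x => f (x +i* (T / n.+1%:R))) f0 (fun x => K * lor x) 0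
   measurableT mf mf0 (lorZ_integrable K).
move=> /(_ _ _)h.
have {}h : normc (Cint (fun x => f (x +i* T)) - Cint f0) @[n --> \oo] --> 0.
  rewrite (_ : (fun _ : nat => _) =
    (fun n => normc (Cint (fun x => f (x +i* (T / n.+1%:R))) - Cint f0))); last first.
    by apply/funext => n; rewrite E.
  apply: h.
  - by move=> n x _; apply: fK; rewrite y0 yT.
  - by move=> x _; exact: fc.
apply/eqP; rewrite -subr_eq0 -normc_eq0 eq_le normc_ge0 andbT.
by apply: (le0_of_cvg0 _ h).
Qed.

Definition Lap (w m : R -> R[i]) n z := Cint (fun x => m x ^+ n * w x * cexp (m x * z)).

(** Differentiating in z inserts a factor [m x], so the integrals are the
    successive derivatives of one another. *)
Lemma Lap_regd U w m : (forall z v, U z -> exists2 d : R, 0 < d &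
    forall t : R, `|t| < d -> U (z + t%:C * v)) ->
  cmeas (setT : set (measurableTypeR R)) w -> cmeas (setT : set (measurableTypeR R)) m ->
  (forall n, exists K, forall z x, U z ->
     normc (m x ^+ n * w x * cexp (m x * z)) <= K * lor x) ->
  forall n, regd U (Lap w m n) (Lap w m n.+1).
Proof.
move=> Uo mw mm hb.
have ms n z : cmeas (setT : set (measurableTypeR R)) (fun x => m x ^+ n * w x * cexp (m x * z)).
  apply: cmeasM; last by apply: cmeas_exp => //; apply: cmeasM => //; exact: cmeas_cst.
  by apply: cmeasM => //; exact: cmeasX.
have H n : hol U (Lap w m n) (Lap w m n.+1).
  move=> z v Uz; have [d d0 hd] := Uo z v Uz.
  have [K1 h1] := hb n; have [K2 h2] := hb n.+1.
  have := @cder_cintegral R setT (fun t x => m x ^+ n * w x * cexp (m x * (z + t%:C * v)))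
    (fun t x => v * (m x ^+ n.+1 * w x * cexp (m x * (z + t%:C * v))))
    (fun x => normc v * `|K2| * lor x) 0 d measurableT d0.
  move=> /(_ _ (lorZ_integrable _) _ _ _) H; apply: cder_eq; first apply: H.
  - by move=> x; rewrite mulr_ge0 ?lor_ge0// mulr_ge0 ?normc_ge0.
  - move=> t; rewrite subr0 => /hd Ut; apply: Cdom_cintble; split; first exact: ms.
    by exists K1 => x; exact: h1.
  - move=> t x; rewrite subr0 => /hd Ut _.
    have c1 : cder (fun t : R => m x * (z + t%:C * v)) t (m x * v).
      apply: cderZ; apply: cder_eq (cderD (cder_cst z t) (cderM (cder_real t) (cder_cst v t))) _.
      by rewrite mulr0 addr0 mul1r add0r.
    apply: cder_eq (cderZ _ (cder_exp c1)) _; rewrite exprS; ring.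
  - move=> t x; rewrite subr0 => /hd Ut _.
    rewrite Normc.normcM -[leRHS]mulrA ler_wpM2l ?normc_ge0// (le_trans (h2 _ _ Ut))//.
    by rewrite ler_wpM2r ?lor_ge0// ler_norm.
  rewrite mul0r addr0; apply: CintZ; split; first exact: ms.
  by exists K2 => x; exact: h2.
have Bn n : bnd U (Lap w m n).
  have [K h] := hb n; exists (2 * pi * K) => z Uz; apply: Cint_le; first exact: ms.
  by move=> x; exact: h.
by move=> n; split => //; exact: hol_lcont (H n.+1).
Qed.

End Holomorphic.

(** * Estimates for the exponential and sinh *)

Section Estimates.
Context {R : realType}.
Implicit Types (x y : R) (z w t : R[i]).

Let cexp_scal_der w (s : R) : cder (fun u : R => cexp (u%:C * w)) s (w * cexp (s%:C * w)).
Proof.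
apply: cder_eq (cder_exp (cderM (cder_real s) (cder_cst w s))) _.
by rewrite mul1r mulr0 addr0.
Qed.

Let scal_der w (s : R) : cder (fun u : R => u%:C * w) s w.
Proof.
by apply: cder_eq (cderM (cder_real s) (cder_cst w s)) _; rewrite mul1r mulr0 addr0.
Qed.

Let cexp_scal_le w (s : R) : 0 <= s <= 1 -> normc (cexp (s%:C * w)) <= expR (normc w).
Proof.
move=> /andP[s0 s1]; rewrite normc_cexp ler_expR ReMr (le_trans (ler_norm _))//.
by rewrite normrM ger0_norm// (le_trans (ler_piMl _ _))// normc_Re.
Qed.

Let scal_le w (s : R) : 0 <= s <= 1 -> normc (s%:C * w) <= normc w.
Proof.
by move=> /andP[s0 s1]; rewrite Normc.normcM normcr ger0_norm// ler_piMl// normc_ge0.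
Qed.

(* integrating along the segment from 0 to w gains one order of vanishing *)
Let taylor_step (F G : R[i] -> R[i]) (B : R) n : F 0 = 0 ->
  (forall w (s : R), cder (fun u : R => F (u%:C * w)) s (w * G (s%:C * w))) ->
  0 <= B -> (forall w, normc (G w) <= B * normc w ^+ n * expR (normc w)) ->
  forall w, normc (F w) <= 2 * B * normc w ^+ n.+1 * expR (normc w).
Proof.
move=> F0 FG B0 GB w.
have := @cder_mvt R (fun u => F (u%:C * w)) (fun s => w * G (s%:C * w)) 0 1
  (B * normc w ^+ n.+1 * expR (normc w)) ler01 (fun u _ => FG w u).
rewrite mul1r mul0r F0 !subr0 mulr1 !mulrA; apply => u hu.
rewrite Normc.normcM (le_trans (ler_wpM2l (normc_ge0 w) (GB _)))//.
rewrite exprS !mulrA [normc w * B]mulrC -!mulrA ler_wpM2l// ler_wpM2l ?normc_ge0//.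
rewrite ler_pM ?exprn_ge0 ?normc_ge0 ?expR_ge0// ?ler_expR ?scal_le//.
by rewrite lerXn2r ?nnegrE ?normc_ge0 ?scal_le.
Qed.

Lemma cexp_taylor1 w : normc (cexp w - 1) <= 2 * normc w * expR (normc w).
Proof.
rewrite -[in leRHS](expr1 (normc w)) -[X in X * _ * _](mulr1 2).
apply: (@taylor_step (fun w => cexp w - 1) cexp) => //.
- by rewrite cexp0 subrr.
- move=> v s; apply: cder_eq (cderB (cexp_scal_der v s) (cder_cst 1 s)) _.
  by rewrite subr0.
- move=> v; rewrite expr0 !mul1r; have := @cexp_scal_le v 1.
  by rewrite mul1r ler01 lexx; apply.
Qed.

Lemma cexp_taylor2 w : normc (cexp w - 1 - w) <= 4 * normc w ^+ 2 * expR (normc w).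
Proof.
rewrite (_ : 4 = 2 * 2 :> R); last by rewrite -natrM.
apply: (@taylor_step (fun w => cexp w - 1 - w) (fun w => cexp w - 1)) => //.
- by rewrite cexp0 !subrr.
- move=> v s; apply: cder_eq (cderB (cderB (cexp_scal_der v s) (cder_cst 1 s)) (scal_der v s)) _.
  by rewrite subr0; ring.
- by move=> v; rewrite expr1; exact: cexp_taylor1.
Qed.

Let sqr_der w (s : R) : cder (fun u : R => (u%:C * w) ^+ 2 / 2) s (w * (s%:C * w)).
Proof.
have h := scal_der w s.
have E (u : R) : u%:C * w * (u%:C * w) / 2 = (u%:C * w) ^+ 2 / 2 by rewrite expr2.
apply: cder_eq; first by apply: cder_ext (cderM (cderM h h) (cder_cst (2^-1) s)) => u.
by cbv beta; field.
Qed.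

Let cube_der w (s : R) : cder (fun u : R => (u%:C * w) ^+ 3 / 6) s (w * ((s%:C * w) ^+ 2 / 2)).
Proof.
have h := scal_der w s.
have E (u : R) : (u%:C * w) * (u%:C * w) * (u%:C * w) / 6 = (u%:C * w) ^+ 3 / 6.
  by congr (_ / _); ring.
apply: cder_eq.
  by apply: cder_ext (cderM (cderM (cderM h h) h) (cder_cst (6^-1) s)) => u; exact: E.
by cbv beta; field.
Qed.

Lemma cexp_taylor3 w :
  normc (cexp w - 1 - w - w ^+ 2 / 2) <= 8 * normc w ^+ 3 * expR (normc w).
Proof.
rewrite (_ : 8 = 2 * 4 :> R); last by rewrite -natrM.
apply: (@taylor_step (fun w => cexp w - 1 - w - w ^+ 2 / 2) (fun w => cexp w - 1 - w)) => //.
- by rewrite cexp0 !subrr expr0n mul0r subrr.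
- move=> v s; apply: cder_eq (cderB (cderB (cderB (cexp_scal_der v s) (cder_cst 1 s))
     (scal_der v s)) (sqr_der v s)) _.
  by rewrite subr0; ring.
- exact: cexp_taylor2.
Qed.

Lemma cexp_taylor4 w :
  normc (cexp w - 1 - w - w ^+ 2 / 2 - w ^+ 3 / 6) <= 16 * normc w ^+ 4 * expR (normc w).
Proof.
rewrite (_ : 16 = 2 * 8 :> R); last by rewrite -natrM.
apply: (@taylor_step (fun w => cexp w - 1 - w - w ^+ 2 / 2 - w ^+ 3 / 6)
   (fun w => cexp w - 1 - w - w ^+ 2 / 2)) => //.
- by rewrite cexp0 !subrr !expr0n !mul0r !subrr.
- move=> v s; apply: cder_eq (cderB (cderB (cderB (cderB (cexp_scal_der v s) (cder_cst 1 s))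
     (scal_der v s)) (sqr_der v s)) (cube_der v s)) _.
  by rewrite subr0; ring.
- exact: cexp_taylor3.
Qed.

Lemma sin_lin : exists2 c : R, 0 < c & forall y, 0 <= y <= pi / 2 -> c * y <= sin y.
Proof.
have p1 : (1 : R) <= pi / 2 by exact: pihalf_ge1.
have s1 : 0 < sin (1 : R) by apply: sin2_gt0; rewrite ltr01 ltr1n.
have c1 := @cos1_gt0 R.
exists (Num.min (cos 1) (sin 1 / 2)); first by rewrite lt_min c1 divr_gt0.
move=> y /andP[y0 yp]; have [y1|y1] := leP y 1.
  have -> : sin y = sin y - sin 0 by rewrite sin0 subr0.
  have [->|yn0] := eqVneq y 0; first by rewrite mulr0 subrr.
  have y0' : 0 < y by rewrite lt0r yn0.
  have sd x : x \in `]0, y[ -> is_derive x (1 : R) sin (cos x) by move=> _; exact: is_derive_sin.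
  have sc : {within `[0, y], continuous (@sin R)}.
    by apply: continuous_subspaceT => x; exact: continuous_sin.
  have [x] := MVT y0' sd sc.
  rewrite in_itv/= => /andP[x0 xy] ->; rewrite subr0 ler_wpM2r//.
  rewrite (le_trans (y := cos 1)) ?ge_min ?lexx// ltW// ltr_cos ?(lt_le_trans xy)//.
  - rewrite in_itv/= ltW//= (le_trans (ltW xy))// (le_trans yp)//.
    by rewrite ler_pdivrMr// ler_peMr ?pi_ge0// ler1n.
  - by rewrite in_itv/= ?ler01/= (le_trans p1)// ler_pdivrMr// ler_peMr ?pi_ge0// ler1n.
rewrite (le_trans (y := sin 1)); last 2 first.
- rewrite (le_trans (y := sin 1 / 2 * y)) ?ler_wpM2r// ?ge_min ?lexx ?orbT//.
  rewrite -[leRHS]mulr1 -mulrA ler_pM2l// mulrC ler_pdivrMr// mul1r (le_trans yp)//.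
  exact/ltW/pihalf_lt2.
- rewrite ltW// ltr_sin// in_itv/= ?yp ?p1 ?andbT.
  + by rewrite (le_trans _ ler01)// oppr_le0 divr_ge0// pi_ge0.
  + by rewrite (le_trans _ y0)// oppr_le0 divr_ge0// pi_ge0.
- by [].
Qed.

Lemma sin_ge_min (u1 u u2 : R) : 0 < u1 -> u1 <= u -> u <= u2 -> u2 < pi ->
  Num.min (sin u1) (sin u2) <= sin u.
Proof.
move=> h1 h2 h3 h4; have sm (v w : R) : 0 < v -> v <= w -> w <= pi / 2 -> sin v <= sin w.
  move=> v0; rewrite le_eqVlt => /predU1P[->//|vw] wp; rewrite ltW// ltr_sin// in_itv/=.
  - by rewrite (le_trans _ (ltW v0)) ?oppr_le0 ?divr_ge0 ?pi_ge0//= (le_trans (ltW vw)).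
  - by rewrite (le_trans _ (ltW (lt_trans v0 vw))) ?oppr_le0 ?divr_ge0 ?pi_ge0//=.
have [up|up] := leP u (pi / 2); first by rewrite ge_min sm.
rewrite ge_min; apply/orP; right.
have S (v : R) : sin (pi - v) = sin v by rewrite sinB sinpi cospi mul0r sub0r mulN1r opprK.
rewrite -S -(S u); apply: sm; lra.
Qed.

Lemma sinh_abs x : `|sinh x| = sinh `|x|.
Proof.
have s0 v : 0 <= v -> 0 <= sinh v :> R.
  by move=> v0; rewrite divr_ge0// subr_ge0 ler_expR (le_trans _ v0)// oppr_le0.
case: (ger0P x) => hx; first by rewrite ger0_norm// s0.
rewrite -normrN (_ : - sinh x = sinh (- x)); last by rewrite /sinh opprK -mulNr opprB.
by rewrite ger0_norm// s0// oppr_ge0 ltW.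
Qed.

Lemma sinh_lin x : `|x| / 2 <= `|sinh x|.
Proof.
rewrite sinh_abs; set v := `|x|; have v0 : 0 <= v by exact: normr_ge0.
have e := expR_ge1Dx v; have p := expR_gt0 v.
rewrite /sinh ler_pM2r// expRN lerBrDr -lerBrDl -div1r ler_pdivrMr//.
have := expR_gt0 v; nra.
Qed.

Lemma sinh_exp x : 1 <= `|x| -> expR `|x| / 4 <= `|sinh x|.
Proof.
rewrite sinh_abs; set v := `|x| => v1.
have e := expR_ge1Dx v; have p := expR_gt0 v; have q := expRxMexpNx_1 v.
have qn := expR_gt0 (- v).
by rewrite /sinh; nra.
Qed.

(** 0 is the only zero of sinh with imaginary part in [0, pi / 2], and it is
    simple. *)
Lemma csinh_lin : exists2 c : R, 0 < c & forall x y, 0 <= y <= pi / 2 ->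
  c * normc (x +i* y) <= normc (csinh (x +i* y)).
Proof.
have [c c0 hc] := sin_lin.
pose d := Num.min c (2^-1); have d0 : 0 < d by rewrite lt_min c0 invr_gt0 ltr0n.
exists (d / 2); first by rewrite divr_gt0.
move=> x y hy; have y0 : 0 <= y by case/andP: hy.
have h1 := le_trans (sinh_lin x) (normc_csinh_ge_sinh x y).
have sy : 0 <= sin y by rewrite (le_trans _ (hc _ hy))// mulr_ge0// ltW.
have h2 : c * y <= normc (csinh (x +i* y)).
  rewrite (le_trans (hc _ hy))// -(@ler_pXn2r _ 2)// ?nnegrE ?normc_ge0//.
  by rewrite normc_csinh_sqr lerDr sqr_ge0.
have h3 : normc (x +i* y) <= `|x| + y.
  by rewrite (le_trans (normc_le_ReIm _))//= (ger0_norm y0).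
have d1 : d <= c by rewrite ge_min lexx.
have d2 : d <= 2^-1 by rewrite ge_min lexx orbT.
have x0 := normr_ge0 x.
have a1 := ler_wpM2r y0 d1; have a2 := ler_wpM2r x0 d2.
have a3 := ler_wpM2l (ltW d0) h3.
move: (normc (csinh _)) (normc (x +i* y)) h1 h2 h3 a1 a2 a3 => S N; lra.
Qed.

Lemma Re_2itz x y z : Re (2 * 'i * (x +i* y) * z) = - (2 * (x * Im z + y * Re z)).
Proof. by rewrite (natrC 2) !ReImE /=; ring. Qed.

Lemma scale_ri (a x y : R) : a%:C * (x +i* y) = (a * x) +i* (a * y).
Proof. by apply: complexP; rewrite !ReImE /=; ring. Qed.

Lemma reg_csinh U f : reg U f -> reg U (fun z => csinh (f z)).
Proof.
move=> h; apply: regM; last exact: reg_cst.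
by apply: regB; apply: reg_exp => //; exact: regN.
Qed.

Lemma reg_line (x1 x2 y1 y2 : R) (a b : R[i]) : reg (box x1 x2 y1 y2) (fun t => a * t + b).
Proof. by apply: regD; [apply: regZ; apply: reg_id; exact: bnd_box|exact: reg_cst]. Qed.

End Estimates.

(** * Measurability and continuity on horizontal and vertical lines *)

Section MoreTools.
Context {R : realType}.

(** The inverse is the pointwise limit of the continuous functions
    x / (x^2 + 1 / n), including at 0. *)
Lemma measurable_inv : measurable_fun (setT : set (measurableTypeR R)) (fun x : R => x^-1).
Proof.
pose h (n : nat) (x : R) := x * (x ^+ 2 + n.+1%:R^-1)^-1.
have p (n : nat) (x : R) : 0 < x ^+ 2 + n.+1%:R^-1.
  by rewrite ltr_wpDl ?sqr_ge0// invr_gt0.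
apply: (@measurable_fun_cvg _ _ _ _ h) => // [n|x _].
  apply: continuous_measurable_fun => x; apply: cvgM; first exact: cvg_id.
  apply: cvgV; first by rewrite gt_eqF// p.
  apply: cvgD; last exact: cvg_cst.
  by under eq_fun do rewrite expr2; apply: cvgM; exact: cvg_id.
have [->|x0] := eqVneq x 0.
  by rewrite invr0; under eq_fun do rewrite /h mul0r; exact: cvg_cst.
rewrite -[X in _ --> X](_ : x * (x ^+ 2 + 0)^-1 = _); last by rewrite addr0; field.
apply: cvgM; first exact: cvg_cst.
apply: cvgV; first by rewrite addr0 expf_neq0.
by apply: cvgD; [exact: cvg_cst|exact: cvg_harmonic].
Qed.

Lemma cmeasV (f : R -> R[i]) : cmeas (setT : set (measurableTypeR R)) f ->
  cmeas (setT : set (measurableTypeR R)) (fun x => (f x)^-1).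
Proof.
move=> [f1 f2].
have q : measurable_fun (setT : set (measurableTypeR R)) (fun x => (Re (f x) ^+ 2 + Im (f x) ^+ 2)^-1).
  apply: (measurableT_comp measurable_inv).
  by apply: measurable_funD; under eq_fun do rewrite expr2; apply: measurable_funM.
split; under eq_fun do rewrite ?ReV ?ImV; apply: measurable_funM => //.
exact: measurable_funN.
Qed.

Lemma near_far (S : R -> R -> Prop) (F : R -> R -> R) (r K1 K2 : R) : 0 <= K1 -> 0 <= K2 ->
  (forall x y, S x y -> `|x| <= r -> F x y <= K1) ->
  (forall x y, S x y -> r <= `|x| -> F x y <= K2 * lor x) ->
  exists K, forall x y, S x y -> F x y <= K * lor x.
Proof.
move=> k1 k2 h1 h2; exists (K1 * (1 + r ^+ 2) + K2) => x y Sxy; rewrite mulrDl.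
have l0 := lor_ge0 x; have [xr|xr] := leP `|x| r.
  have a : 1 <= (1 + r ^+ 2) * lor x.
    rewrite ler_pdivlMr ?(lt_le_trans ltr01) ?oneDsqr_ge1// mul1r /oneDsqr lerD2l.
    by rewrite -real_normK ?num_real// lerXn2r ?nnegrE// (le_trans _ xr).
  rewrite (le_trans (h1 _ _ Sxy xr))// (le_trans (y := K1 * (1 + r ^+ 2) * lor x)) ?lerDl ?mulr_ge0//.
  by rewrite -mulrA ler_peMr.
rewrite (le_trans (h2 _ _ Sxy (ltW xr)))// lerDr mulr_ge0// mulr_ge0//.
by rewrite addr_ge0// sqr_ge0.
Qed.

Lemma cder_hor (x y : R) : cder (fun x => x +i* y) x 1.
Proof.
by split => /=; [exact: is_derive_id|exact: is_derive_cst].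
Qed.

Lemma cder_vert (x y : R) : cder (fun y => x +i* y) y 'i.
Proof.
by split => /=; [exact: is_derive_cst|exact: is_derive_id].
Qed.

Lemma ccont_hor (x y : R) : ccont (fun x => x +i* y) x.
Proof. exact: cder_cont (cder_hor x y). Qed.

Lemma ccont_vert (x y : R) : ccont (fun y => x +i* y) y.
Proof. exact: cder_cont (cder_vert x y). Qed.

Lemma ccontZ (a : R[i]) (c : R -> R[i]) t : ccont c t -> ccont (fun u => a * c u) t.
Proof. by move=> h; apply: ccontM => //; exact: ccont_cst. Qed.

Lemma ccontB (c d : R -> R[i]) t : ccont c t -> ccont d t -> ccont (fun u => c u - d u) t.
Proof. by move=> h k; apply: ccontD => //; exact: ccontN. Qed.

Lemma ccontX (c : R -> R[i]) n t : ccont c t -> ccont (fun u => c u ^+ n) t.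
Proof.
move=> h; elim: n => [|n IH].
  by under eq_fun do rewrite expr0; exact: ccont_cst.
by under eq_fun do rewrite exprS; exact: ccontM.
Qed.

Lemma ccont_csinh (c : R -> R[i]) t : ccont c t -> ccont (fun u => csinh (c u)) t.
Proof.
move=> h; apply: ccontM; last exact: ccont_cst.
by apply: ccontB; apply: ccont_exp => //; exact: ccontN.
Qed.

Lemma ccont_seq (c : R -> R[i]) (T : R) : ccont c 0 ->
  normc (c (T / n.+1%:R) - c 0) @[n --> \oo] --> 0.
Proof.
move=> [c1 c2].
have u0 : T / n.+1%:R @[n --> \oo] --> (0 : R).
  by rewrite -[X in _ --> X](mulr0 T); apply: cvgM; [exact: cvg_cst|exact: cvg_harmonic].
have d1 := cvg_comp _ _ u0 c1; have d2 := cvg_comp _ _ u0 c2.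
apply: (@squeeze_cvgr _ _ _ _ (cst 0) (fun n =>
  `|Re (c (T / n.+1%:R)) - Re (c 0)| + `|Im (c (T / n.+1%:R)) - Im (c 0)|)).
- apply: nearW => n; apply/andP; split; first exact: normc_ge0.
  by rewrite (le_trans (normc_le_ReIm _))// !ReImE.
- exact: cvg_cst.
- rewrite -[X in _ --> X](addr0 (0:R)); apply: cvgD.
  + by move/subr_cvg0/cvg_norm : d1; rewrite normr0.
  + by move/subr_cvg0/cvg_norm : d2; rewrite normr0.
Qed.

(** The primitive is (2 / a) atan (e^(a x)). *)
Lemma Cint_sech (a : R) : 0 < a ->
  Cdom (fun x => (2 / (expR (a * x) + expR (- (a * x))))%:C) /\
  Cint (fun x => (2 / (expR (a * x) + expR (- (a * x))))%:C) = (pi / a)%:C.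
Proof.
move=> a0; set f := (fun x => _).
have p x : 0 < expR (a * x) + expR (- (a * x)) by rewrite addr_gt0// expR_gt0.
have fc x : ccont f x.
  split => /=; last exact: cvg_cst.
  apply: cvgM; first exact: cvg_cst.
  apply: cvgV; first by rewrite gt_eqF.
  have ca : (a * u) @[u --> x] --> a * x by apply: cvgM; [exact: cvg_cst|exact: cvg_id].
  apply: cvgD; first by apply: (cvg_comp _ _ ca); exact: continuous_expR.
  by apply: (cvg_comp _ _ (cvgN ca)); exact: continuous_expR.
have fd : Cdom f.
  split; first exact: ccont_cmeas.
  have [C [C0 hC]] := lor_exp a0; exists (2 * C) => x.
  rewrite /f normcr ger0_norm ?divr_ge0 ?(ltW (p x))// -mulrA ler_wpM2l//.
  rewrite (le_trans _ (hC x))// [expR (- (a * `|x|))]expRN lef_pV2 ?posrE ?expR_gt0//.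
  rewrite -[X in expR (X * _)](gtr0_norm a0) -normrM.
  by case: (ger0P (a * x)) => _; rewrite ?lerDl ?lerDr expR_ge0.
split => //; pose F x : R[i] := (2 / a * atan (expR (a * x)))%:C.
have Fd x : cder F x (f x).
  split => /=; last exact: is_derive_cst.
  have d1 : is_derive x 1 (fun x => a * x) a.
    by apply: is_derive_eq; rewrite /GRing.scale/=; ring.
  have d2 := is_derive_exp_comp d1.
  have d3 : is_derive x 1 (fun x => atan (expR (a * x)))
     ((1 + expR (a * x) ^+ 2)^-1 * (expR (a * x) * a)).
    by have := @is_derive1_comp _ atan _ x _ _ _ d2; apply.
  apply: is_derive_eq; rewrite /GRing.scale/= expRN.
  by field; rewrite !gt_eqF ?expR_gt0// addr_gt0 ?exprn_gt0 ?expR_gt0.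
apply/eqP; rewrite -subr_eq0 -normc_eq0 eq_le normc_ge0 andbT.
pose u (n : nat) := normc (cintegral `[(- n%:R), n%:R] f - Cint f) +
   `|2 / a * (atan (expR (a * n%:R)) - atan (expR (- (a * n%:R)))) - pi / a|.
apply: (@le0_of_cvg0 _ _ u) => [n|].
  have n0 : 0 <= n%:R :> R by [].
  have E : cintegral `[(- n%:R), n%:R] f =
      (2 / a * (atan (expR (a * n%:R)) - atan (expR (- (a * n%:R)))))%:C.
    rewrite (@cintegral_ftc _ F); last 3 first.
    - by rewrite (le_trans _ n0)// oppr_le0.
    - by move=> x _; exact: Fd.
    - by move=> x _; exact: fc.
    by rewrite /F -rmorphB /= mulrN -mulrBr.
  rewrite /u E; set A := Cint f; set b := 2 / a * _.
  have -> : `|b - pi / a| = normc (b%:C - (pi / a)%:C) by rewrite -rmorphB normcr.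
  have -> : A - (pi / a)%:C = - (b%:C - A) + (b%:C - (pi / a)%:C) by ring.
  by rewrite (le_trans (le_normcD _ _))// normcN.
rewrite -[X in _ --> X](addr0 (0:R)); apply: cvgD; first exact: Cint_lim.
have ay : a * n%:R @[n --> \oo] --> +oo.
  apply/cvgryPge => A; have := @nbhs_infty_ger R (A / a); apply: filterS => n.
  by rewrite ler_pdivrMr// mulrC.
have ey : expR (a * n%:R) @[n --> \oo] --> +oo.
  apply/cvgryPge => A; move/cvgryPge : ay => /(_ A); apply: filterS => n An.
  by rewrite (le_trans An)// (le_trans _ (expR_ge1Dx _))// lerDr.
have e0 : expR (- (a * n%:R)) @[n --> \oo] --> (0 : R).
  exact: (cvg_comp _ _ ay (@cvgr_expR R)).
rewrite -(normr0 R); apply: cvg_norm.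
rewrite -[X in _ --> X](_ : 2 / a * (pi / 2 - atan 0) - pi / a = 0); last first.
  by rewrite atan0; field; rewrite gt_eqF.
apply: cvgB; last exact: cvg_cst.
apply: cvgM; first exact: cvg_cst.
apply: cvgB; first by apply: (cvg_comp _ _ ey); exact: cvgy_atan.
by apply: (cvg_comp _ _ e0); exact: continuous_atan.
Qed.

End MoreTools.

(** * The Fourier transform of 1 / sinh *)

Section InverseSinh.
Context {R : realType}.
Variable a : R.
Hypothesis a0 : 0 < a.
Implicit Types (x y s : R) (z t : R[i]).

Lemma csinh_strip_ge (Y1 Y2 : R) : 0 < Y1 -> Y1 <= Y2 -> a * Y2 < pi ->
  exists2 c : R, 0 < c & forall x y, Y1 <= y <= Y2 ->
    c * expR (a * `|x|) <= normc (csinh (a%:C * (x +i* y))).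
Proof.
move=> h1 h12 h2.
have aY1 : 0 < a * Y1 by rewrite mulr_gt0.
have aY12 : a * Y1 <= a * Y2 by rewrite ler_pM2l.
pose m := Num.min (sin (a * Y1)) (sin (a * Y2)).
have m0 : 0 < m.
  by rewrite lt_min !sin_gt0_pi//= ?aY1 ?h2 ?(lt_le_trans aY1)// (le_lt_trans aY12).
exists (m / 2) => [|x y /andP[y1 y2]]; first by rewrite divr_gt0.
have sy : m <= sin (a * y) by apply: sin_ge_min => //; rewrite ler_pM2l.
have sy0 : 0 <= sin (a * y) by rewrite (le_trans (ltW m0)).
rewrite scale_ri; apply: le_trans (normc_csinh_ge (a * x) sy0).
by rewrite normrM (gtr0_norm a0) mulrAC -mulrA ler_wpM2r ?mulr_ge0 ?expR_ge0 ?invr_ge0.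
Qed.

Lemma box_im_le (X1 X2 Y1 Y2 : R) z : box X1 X2 Y1 Y2 z ->
  z = Re z +i* Im z /\ Y1 <= Im z <= Y2.
Proof.
by case: z => u v /andP[_ /= /andP[h1 h2]]; split => //; rewrite !ltW.
Qed.

Lemma reg_inv_csinh (X1 X2 Y1 Y2 : R) : 0 < Y1 -> a * Y2 < pi ->
  reg (box X1 X2 Y1 Y2) (fun t => (csinh (a%:C * t))^-1).
Proof.
move=> h1 h2; have [h12|h12] := leP Y1 Y2; last first.
  apply: (@reg_sub _ _ (fun=> False)).
    by move=> z /andP[_ /andP[k1 k2]]; have := lt_trans k1 k2; rewrite ltNge (ltW h12).
  exists (fun=> 0); split => //; try by exists 0.
have [c c0 hc] := csinh_strip_ge h1 h12 h2.
apply: (@regV _ _ _ c) => //.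
  move=> z /box_im_le[-> hz]; rewrite (le_trans _ (hc _ _ hz))// ler_peMr ?(ltW c0)//.
  by rewrite -expR0 ler_expR mulr_ge0// ltW.
apply: reg_csinh; apply: (@reg_ext _ _ (fun t => a%:C * t + 0)) => [t|]; first by rewrite addr0.
exact: reg_line.
Qed.

Definition fV z t := cexp (2 * 'i * t * z) / csinh (a%:C * t).

Lemma reg_expitz (X1 X2 Y1 Y2 : R) z : reg (box X1 X2 Y1 Y2) (fun t => cexp (2 * 'i * t * z)).
Proof.
apply: reg_exp; apply: (@reg_ext _ _ (fun t => 2 * 'i * z * t + 0)) => [t|]; first by ring.
exact: reg_line.
Qed.

Lemma fV_reg z (X1 X2 Y1 Y2 : R) : 0 < Y1 -> a * Y2 < pi -> reg (box X1 X2 Y1 Y2) (fV z).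
Proof. by move=> h1 h2; apply: regM; [exact: reg_expitz|exact: reg_inv_csinh]. Qed.

Lemma normc_expitz x y z (Y : R) : 0 <= y <= Y ->
  normc (cexp (2 * 'i * (x +i* y) * z)) <=
  expR (2 * `|Im z| * `|x| + 2 * Y * `|Re z|).
Proof.
move=> /andP[y0 yY]; rewrite normc_cexp ler_expR Re_2itz.
rewrite (le_trans (ler_norm _))// normrN mulrDr (le_trans (ler_normD _ _))// lerD//.
  by rewrite !normrM ger0_norm// mulrAC mulrA.
rewrite !normrM ger0_norm// -mulrA ler_pM2l// ler_wpM2r//.
by rewrite ger0_norm.
Qed.

Lemma fV_bound z (Y1 Y2 : R) : 0 < Y1 -> Y1 <= Y2 -> a * Y2 < pi -> 2 * `|Im z| < a ->
  exists K, forall x y, Y1 <= y <= Y2 -> normc (fV z (x +i* y)) <= K * lor x.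
Proof.
move=> h1 h12 h2 hz; have [c c0 hc] := csinh_strip_ge h1 h12 h2.
have k0 : 0 < a - 2 * `|Im z| by rewrite subr_gt0.
have [C [C0 hC]] := lor_exp k0.
exists (expR (2 * Y2 * `|Re z|) / c * C) => x y hy.
have y0 : 0 <= y <= Y2.
  by case/andP: hy => k1 k2; rewrite k2 (le_trans (ltW h1)).
rewrite /fV Normc.normcM Normc.normcV.
rewrite (le_trans (ler_wpM2r _ (normc_expitz x z y0))) ?invr_ge0 ?normc_ge0//.
have ic : (normc (csinh (a%:C * (x +i* y))))^-1 <= (c * expR (a * `|x|))^-1.
  rewrite lef_pV2 ?posrE ?hc//; first by rewrite (lt_le_trans _ (hc _ _ hy))// mulr_gt0 ?expR_gt0.
  by rewrite mulr_gt0 ?expR_gt0.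
rewrite (le_trans (ler_wpM2l _ ic)) ?expR_ge0// invfM -expRN expRD.
rewrite (_ : expR _ * expR _ * _ = expR (2 * Y2 * `|Re z|) / c *
   (expR (2 * `|Im z| * `|x|) * expR (- (a * `|x|)))); last by ring.
rewrite -expRD -[leRHS]mulrA ler_wpM2l ?divr_ge0 ?expR_ge0 ?(ltW c0)//.
by rewrite (le_trans _ (hC x))// ler_expR; lra.
Qed.

Definition Vint s z := Cint (fun x => fV z (x +i* s)).

Let s0 : R := pi / (2 * a).
Let as0 : a * s0 = pi / 2. Proof. by rewrite /s0; field; rewrite gt_eqF. Qed.
Let s0_gt0 : 0 < s0. Proof. by rewrite divr_gt0 ?pi_gt0// mulr_gt0. Qed.

Let pi2pi : pi / 2 < pi :> R.
Proof. by have := pi_gt0 R; lra. Qed.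

Lemma Vint_indep s z : 0 < s -> a * s < pi -> 2 * `|Im z| < a -> Vint s z = Vint s0 z.
Proof.
move=> hs hs2 hz.
have K (s1 s2 : R) : 0 < s1 -> s1 <= s2 -> a * s2 < pi -> Vint s1 z = Vint s2 z.
  move=> k1 k2 k3; have [K hK] := fV_bound k1 k2 k3 hz.
  apply: (@contour_shift _ (fV z) (s1 / 2) ((s2 + pi / a) / 2) s1 s2 K) => //.
  - by rewrite ltr_pdivrMr// ltr_pMr// ltr1n.
  - have : s2 < pi / a by rewrite ltr_pdivlMr// mulrC.
    by lra.
  - move=> X; apply: fV_reg; first by rewrite divr_gt0.
    rewrite (_ : a * _ = (a * s2 + pi) / 2); first lra.
    by field; rewrite gt_eqF.
have [h|h] := leP s s0; first by apply: K => //; rewrite as0.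
by apply/esym; apply: K => //; exact: ltW.
Qed.

Lemma Cdom_fV s z : 0 < s -> a * s < pi -> 2 * `|Im z| < a -> Cdom (fun x => fV z (x +i* s)).
Proof.
move=> hs hs2 hz; have [K hK] := fV_bound hs (lexx s) hs2 hz.
split; last by exists K => x; apply: hK; rewrite lexx.
apply: ccont_cmeas => // x; apply: ccontM.
  by apply: ccont_exp; apply: ccontM; [apply: ccontZ; exact: ccont_hor|exact: ccont_cst].
apply: ccontV.
  rewrite -normc_gt0; have [c c0 hc] := csinh_strip_ge hs (lexx s) hs2.
  by rewrite (lt_le_trans _ (hc x s _)) ?lexx// mulr_gt0 ?expR_gt0.
by apply: ccont_csinh; apply: ccontZ; exact: ccont_hor.
Qed.

(* on the line Im t = s0 = pi / (2 a), sinh (a t) is even in Re t *)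
Let Vopp z : 2 * `|Im z| < a ->
  Vint s0 (- z) = cexp ((2 * pi / a)%:C * z) * Vint s0 z.
Proof.
move=> hz; have hNz : 2 * `|Im (- z)| < a by rewrite ImN normrN.
have hs : a * s0 < pi by rewrite as0.
have d1 := Cdom_fV s0_gt0 hs hz; have d2 := Cdom_fV s0_gt0 hs hNz.
rewrite /Vint -CintZ// -(Cint_opp d2); apply: eq_Cint => x.
rewrite /fV mulrA -cexpD; congr (_ / _).
  congr cexp; have -> : (2 * pi / a)%:C = 4 * s0%:C :> R[i].
    rewrite (natrC 4) -rmorphM /=; congr (_%:C); rewrite /s0; field.
    by rewrite gt_eqF.
  have -> : (- x) +i* s0 = - x%:C + s0%:C * 'i by apply: complexP; rewrite !ReImE /=; ring.
  have -> : x +i* s0 = x%:C + s0%:C * 'i by apply: complexP; rewrite !ReImE /=; ring.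
  have i2 : 'i * 'i = - 1 :> R[i] by rewrite -expr2 sqr_i.
  transitivity (2 * 'i * x%:C * z - 2 * ('i * 'i) * s0%:C * z); first ring.
  transitivity (4 * s0%:C * z + 2 * 'i * x%:C * z + 2 * ('i * 'i) * s0%:C * z); last ring.
  by rewrite i2; ring.
rewrite !scale_ri as0 !csinh_ri cos_pihalf !mulr0 mulrN opprK.
by rewrite [expR (- _) + _]addrC.
Qed.

(* the numerator of fV z + fV (- z), minus its value at t = 0: this removes the
   pole, and the integrand becomes odd on the real axis *)
Let nV z t := (cexp (2 * 'i * t * z) + cexp (- (2 * 'i * t * z)) - 2) / csinh (a%:C * t).

Let nV_bound z : 2 * `|Im z| < a -> exists K, forall x y, 0 < y <= s0 ->
  normc (nV z (x +i* y)) <= K * lor x.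
Proof.
move=> hz; have [c c0 hc] := @csinh_lin R.
have k0 : 0 < a - 2 * `|Im z| by rewrite subr_gt0.
have [C [C0 hC]] := lor_exp k0; have [C' [C'0 hC']] := lor_exp a0.
pose r := a^-1; have r0 : 0 < r by rewrite invr_gt0.
pose W := 2 * (r + s0) * normc z.
have W0 : 0 <= W by rewrite !mulr_ge0 ?normc_ge0// addr_ge0// ltW.
pose K1 := 8 * (2 * normc z) ^+ 2 * (r + s0) * expR W / (c * a).
pose E := expR (2 * s0 * `|Re z|).
have rs : 0 <= r + s0 by rewrite addr_ge0// ltW.
have K10 : 0 <= K1.
  apply: divr_ge0; last by rewrite ltW// mulr_gt0.
  by rewrite !mulr_ge0 ?expR_ge0 ?exprn_ge0 ?mulr_ge0 ?normc_ge0.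
pose K2 := 4 * (2 * E * C + 2 * C').
have nitz t : normc (2 * 'i * t * z) = 2 * normc t * normc z.
  by rewrite !Normc.normcM normci mulr1 (natrC 2) normcr ger0_norm.
apply: (@near_far R (fun x y => 0 < y <= s0) (fun x y => normc (nV z (x +i* y))) r K1 K2).
- exact: K10.
- by rewrite mulr_ge0// addr_ge0// !mulr_ge0// expR_ge0.
- move=> x y /andP[y0 ys] xr; set t := x +i* y; set w := 2 * 'i * t * z.
  have tr : normc t <= r + s0.
    by rewrite (le_trans (normc_le_ReIm _))//= lerD// ger0_norm// ltW.
  have tn : 0 < normc t.
    by rewrite normc_gt0; apply/eqP => /(congr1 (@complex.Im R)) /= y00; rewrite y00 ltxx in y0.
  have wW : normc w <= W by rewrite nitz /W ler_wpM2r ?normc_ge0// ler_pM2l.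
  have num : normc (cexp w + cexp (- w) - 2) <= 8 * normc w ^+ 2 * expR W.
    have -> : cexp w + cexp (- w) - 2 = (cexp w - 1 - w) + (cexp (- w) - 1 - (- w)) by ring.
    have e1 := cexp_taylor2 w; have e2 := cexp_taylor2 (- w); rewrite normcN in e2.
    have ee : expR (normc w) <= expR W by rewrite ler_expR.
    have := ler_wpM2l (mulr_ge0 (ler0n R 4) (exprn_ge0 2 (normc_ge0 w))) ee.
    by move=> e3; rewrite (le_trans (le_normcD _ _))//; lra.
  have den : c * (a * normc t) <= normc (csinh (a%:C * t)).
    rewrite -[X in X * normc t](gtr0_norm a0) -normcr -Normc.normcM scale_ri; apply: hc.
    by rewrite mulr_ge0 ?(ltW a0) ?(ltW y0)//= -as0 ler_pM2l.
  have den0 : 0 < c * (a * normc t) by rewrite !mulr_gt0.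
  rewrite /nV -/w Normc.normcM Normc.normcV ler_pdivrMr ?(lt_le_trans den0)//.
  rewrite (le_trans num)// (le_trans (y := K1 * (c * (a * normc t))))//; last first.
    by rewrite ler_wpM2l.
  rewrite (_ : K1 * _ = 8 * (2 * normc z) ^+ 2 * (r + s0) * expR W * normc t); last first.
    by rewrite /K1; field; rewrite !gt_eqF.
  rewrite nitz (_ : 8 * _ * _ = 8 * (2 * normc z) ^+ 2 * normc t * expR W * normc t); last by ring.
  rewrite ler_wpM2r ?(ltW tn)// ler_wpM2r ?expR_ge0// ler_wpM2l// mulr_ge0//.
  by rewrite exprn_ge0// mulr_ge0 ?normc_ge0.
- move=> x y /andP[y0 ys] xr; set t := x +i* y; set w := 2 * 'i * t * z.
  have y0' : 0 <= y <= s0 by rewrite (ltW y0).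
  have num : normc (cexp w + cexp (- w) - 2) <= 2 * E * expR (2 * `|Im z| * `|x|) + 2.
    have e1 := normc_expitz x z y0'; have e2 := normc_expitz x (- z) y0'.
    rewrite ImN ReN !normrN mulrN in e2.
    rewrite expRD in e1 e2.
    rewrite (le_trans (normcB _ _))// (natrC 2) normcr ger0_norm// lerD2r.
    rewrite (le_trans (le_normcD _ _))//.
    by rewrite -/E -/t -/w in e1 e2; lra.
  have den : expR (a * `|x|) / 4 <= normc (csinh (a%:C * t)).
    rewrite scale_ri (le_trans _ (normc_csinh_ge_sinh _ _))//.
    rewrite -[X in expR (X * _)](gtr0_norm a0) -normrM sinh_exp// normrM gtr0_norm//.
    by rewrite mulrC -ler_pdivrMr// div1r.
  have e0 := expR_gt0 (a * `|x|).
  have den0 : 0 < expR (a * `|x|) / 4 by rewrite divr_gt0.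
  rewrite /nV -/w Normc.normcM Normc.normcV ler_pdivrMr ?(lt_le_trans den0)//.
  have l0 := lor_ge0 x.
  have K2l : 0 <= K2 * lor x by rewrite mulr_ge0// mulr_ge0// addr_ge0// !mulr_ge0// expR_ge0.
  rewrite (le_trans num)// (le_trans (y := K2 * lor x * (expR (a * `|x|) / 4)))//; last first.
    exact: ler_wpM2l.
  have h1 : expR (2 * `|Im z| * `|x|) <= C * lor x * expR (a * `|x|).
    rewrite -ler_pdivrMr// -expRN -expRD (le_trans _ (hC x))// ler_expR; lra.
  have h2 : 1 <= C' * lor x * expR (a * `|x|).
    by rewrite -ler_pdivrMr// div1r -expRN.
  have E0 : 0 <= E by exact: expR_ge0.
  have := ler_wpM2l E0 h1.
  rewrite /K2; move: (expR (2 * _ * _)) (expR (a * _)) (lor x) h1 h2 => p q l h1 h2 h3; lra.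
Qed.

(* the constant subtracted in nV contributes the integral of 1 / cosh *)
Let Vadd z : 2 * `|Im z| < a -> Vint s0 z + Vint s0 (- z) = - (2 * 'i * (pi / a)%:C).
Proof.
move=> hz; have hNz : 2 * `|Im (- z)| < a by rewrite ImN normrN.
have hs : a * s0 < pi by rewrite as0.
have d1 := Cdom_fV s0_gt0 hs hz; have d2 := Cdom_fV s0_gt0 hs hNz.
have [sd sI] := Cint_sech a0.
have [K hK] := nV_bound hz.
have mf0 : cmeas (setT : set (measurableTypeR R)) (fun x => nV z (x +i* 0)).
  have mt : cmeas (setT : set (measurableTypeR R)) (fun x : R => x +i* 0).
    by apply: ccont_cmeas => // x; exact: ccont_hor.
  have mw : cmeas (setT : set (measurableTypeR R)) (fun x : R => 2 * 'i * (x +i* 0) * z).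
    by apply: cmeasM; [apply: cmeasM => //; exact: cmeas_cst|exact: cmeas_cst].
  apply: cmeasM.
    apply: cmeasB; last exact: cmeas_cst.
    by apply: cmeasD; apply: cmeas_exp => //; exact: cmeasN.
  apply: cmeasV; apply: cmeasM; last exact: cmeas_cst.
  by apply: cmeasB; apply: cmeas_exp => //; try apply: cmeasN; apply: cmeasM => //; exact: cmeas_cst.
have csx x : x != 0 -> csinh (a%:C * (x +i* 0)) != 0.
  move=> x0; rewrite -normc_gt0 scale_ri mulr0 (lt_le_trans _ (normc_csinh_ge_sinh _ _))//.
  by rewrite (lt_le_trans _ (sinh_lin _))// divr_gt0// normr_gt0 mulf_neq0// gt_eqF.
have lim x : x != 0 -> normc (nV z (x +i* (s0 / n.+1%:R)) - nV z (x +i* 0)) @[n --> \oo] --> 0.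
  move=> x0; apply: (@ccont_seq _ (fun y => nV z (x +i* y))).
  have cw : ccont (fun y : R => 2 * 'i * (x +i* y) * z) 0.
    by apply: ccontM; [apply: ccontZ; exact: ccont_vert|exact: ccont_cst].
  apply: ccontM.
    apply: ccontB; last exact: ccont_cst.
    by apply: ccontD; apply: ccont_exp => //; exact: ccontN.
  by apply: ccontV; [exact: csx|apply: ccont_csinh; apply: ccontZ; exact: ccont_vert].
have H : Cint (fun x => nV z (x +i* s0)) = Cint (fun x => nV z (x +i* 0)).
  apply: (@contour_limit R (nV z) _ s0 (3 / 2 * s0) K) => //.
  - by have := s0_gt0; lra.
  - move=> e X e0; have asb : a * (3 / 2 * s0) < pi.
      by rewrite mulrCA as0; have := pi_gt0 R; lra.
    apply: regM; last exact: reg_inv_csinh.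
    apply: regB; last exact: reg_cst.
    apply: regD; first exact: reg_expitz.
    apply: (@reg_ext _ _ (fun t => cexp (2 * 'i * t * (- z)))) => [t|]; first by rewrite mulrN.
    exact: reg_expitz.
have dn : Cdom (fun x => nV z (x +i* 0)).
  split => //; exists K => x; have [->|x0] := eqVneq x 0.
    rewrite /nV (_ : a%:C * (0 +i* 0) = 0); last by apply: complexP; rewrite !ReImE /=; ring.
    rewrite /csinh oppr0 subrr mul0r invr0 mulr0 normc0'.
    by rewrite (le_trans (normc_ge0 _) (hK 0 s0 _))// s0_gt0 lexx.
  rewrite -subr_le0; apply: (@le0_of_cvg0 _ _ _ _ (lim x x0)) => n.
  have hn : 0 < s0 / n.+1%:R <= s0.
    by rewrite divr_gt0//= ler_pdivrMr// ler_peMr ?(ltW s0_gt0)// ler1n.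
  have := hK x _ hn; have := lernormcB (nV z (x +i* 0)) (nV z (x +i* (s0 / n.+1%:R))).
  rewrite normc_distC; lra.
have H0 : Cint (fun x => nV z (x +i* s0)) = 0.
  rewrite H; apply: Cint_odd => // x; rewrite /nV.
  have -> : (- x) +i* 0 = - (x +i* 0) by apply: complexP => /=; rewrite ?oppr0.
  rewrite !mulrN csinhN invrN mulrN mulNr opprK; congr (- (_ / _)).
  by rewrite [cexp (- _) + _]addrC.
have E x : fV z (x +i* s0) + fV (- z) (x +i* s0) =
    nV z (x +i* s0) + (- (2 * 'i)) * (2 / (expR (a * x) + expR (- (a * x))))%:C.
  have cE : csinh (a%:C * (x +i* s0)) = 'i * ((expR (a * x) + expR (- (a * x))) / 2)%:C.
    rewrite scale_ri as0 csinh_ri cos_pihalf sin_pihalf mulr0 mulr1.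
    by apply: complexP; rewrite !ReImE /=; ring.
  have p : expR (a * x) + expR (- (a * x)) != 0 :> R by rewrite gt_eqF// addr_gt0// expR_gt0.
  rewrite /fV /nV mulrN cE.
  have -> : (2 / (expR (a * x) + expR (- (a * x))))%:C =
     (((expR (a * x) + expR (- (a * x))) / 2)%:C)^-1 :> R[i].
    by rewrite -fmorphV /=; congr (_%:C); rewrite invf_div.
  have : ((expR (a * x) + expR (- (a * x))) / 2)%:C != 0 :> R[i].
    by rewrite fmorph_eq0 mulf_neq0// invr_neq0// pnatr_eq0.
  set c := _%:C => c0.
  have i0 : 'i != 0 :> R[i] by rewrite -normc_gt0 normci.
  rewrite invfM (_ : 'i^-1 = - 'i :> R[i]); last first.
    by apply: (mulfI i0); rewrite mulfV// mulrN -expr2 sqr_i opprK.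
  ring.
have dnv : Cdom (fun x => nV z (x +i* s0)).
  have -> : (fun x => nV z (x +i* s0)) = (fun x => fV z (x +i* s0) + fV (- z) (x +i* s0) -
     (- (2 * 'i)) * (2 / (expR (a * x) + expR (- (a * x))))%:C).
    by apply/funext => x; rewrite E addrK.
  by apply: CdomB; [exact: CdomD|exact: CdomZ].
rewrite /Vint -CintD// (eq_Cint E) CintD//; last exact: CdomZ.
by rewrite H0 add0r CintZ// sI mulNr.
Qed.

(** Two linear relations between the values at z and - z: the symmetry of the
    midline of the strip, and the vanishing of an odd integral on the real axis. *)
Lemma VintE s z : 0 < s -> a * s < pi -> 2 * `|Im z| < a ->
  (cexp ((2 * pi / a)%:C * z) + 1) * Vint s z = - (2 * 'i * (pi / a)%:C).
Proof.
move=> hs hs2 hz; rewrite Vint_indep// mulrDl mul1r -Vopp// addrC.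
exact: Vadd.
Qed.

End InverseSinh.

(** * A contour integral for gR *)

Section Kernel.
Context {R : realType}.
Implicit Types (x y s : R) (z t w : R[i]).

Lemma normc_nat (n : nat) : normc (n%:R : R[i]) = n%:R.
Proof. by rewrite natrC normcr ger0_norm. Qed.

(** The Laurent expansion of 1 / sinh at 0, in the form needed to cancel a
    triple pole. *)
Lemma inv_csinh_taylor w : w != 0 -> normc w <= 10^-1 ->
  normc ((csinh w)^-1 - w^-1 + w / 6) <= 66 * normc w ^+ 2.
Proof.
move=> w0 wn; set n := normc w in wn *.
have n0 : 0 < n by rewrite normc_gt0.
have en : expR n <= 2.
  have := expR_ge1Dx (- n); have := expRxMexpNx_1 n; have := expR_gt0 n; nra.
pose s3 := csinh w - w - w ^+ 3 / 6.
have s3n : normc s3 <= 32 * n ^+ 4.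
  have -> : s3 = 2^-1 * ((cexp w - 1 - w - w ^+ 2 / 2 - w ^+ 3 / 6) -
    (cexp (- w) - 1 - (- w) - (- w) ^+ 2 / 2 - (- w) ^+ 3 / 6)).
    by rewrite /s3 /csinh; field.
  have e1 := cexp_taylor4 w; have e2 := cexp_taylor4 (- w).
  rewrite -/n in e1; rewrite normcN -/n in e2.
  rewrite Normc.normcM Normc.normcV normc_nat.
  have n4 : 0 <= n ^+ 4 by rewrite exprn_ge0// ltW.
  have := normcB (cexp w - 1 - w - w ^+ 2 / 2 - w ^+ 3 / 6)
    (cexp (- w) - 1 - (- w) - (- w) ^+ 2 / 2 - (- w) ^+ 3 / 6).
  have := ler_wpM2l n4 en. lra.
have n2 : n ^+ 2 <= 10^-1 * n by rewrite expr2 ler_wpM2r// ltW.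
have n3 : n ^+ 3 <= 100^-1 * n.
  rewrite exprS (_ : 100^-1 * n = n * 100^-1); last by rewrite mulrC.
  by rewrite ler_wpM2l ?(ltW n0)//; nra.
have n4 : n ^+ 4 <= 1000^-1 * n.
  rewrite exprS (_ : 1000^-1 * n = n * 1000^-1); last by rewrite mulrC.
  by rewrite ler_wpM2l ?(ltW n0)//; nra.
have n30 : 0 <= n ^+ 3 by rewrite exprn_ge0// ltW.
have n40 : 0 <= n ^+ 4 by rewrite exprn_ge0// ltW.
have w3 : normc (w ^+ 3 / 6) = n ^+ 3 / 6.
  by rewrite Normc.normcM Normc.normcV normc_nat normcX.
have shE : csinh w = w + (w ^+ 3 / 6 + s3) by rewrite /s3; ring.
have sh2 : n / 2 <= normc (csinh w).
  have := lernormcB (csinh w + - (w ^+ 3 / 6 + s3)) (- (w ^+ 3 / 6 + s3)).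
  rewrite opprK subrK {1}shE addrK normcN -/n.
  by have := le_normcD (w ^+ 3 / 6) s3; rewrite w3; lra.
have sh0 : csinh w != 0 by rewrite -normc_gt0 (lt_le_trans _ sh2)// divr_gt0.
have -> : (csinh w)^-1 - w^-1 + w / 6 =
    (- s3 + w ^+ 2 / 6 * (w ^+ 3 / 6 + s3)) / (w * csinh w).
  rewrite [in X in _ = X / _](_ : s3 = csinh w - w - w ^+ 3 / 6)//.
  by field; rewrite sh0 w0.
have w2 : normc (w ^+ 2 / 6) = n ^+ 2 / 6.
  by rewrite Normc.normcM Normc.normcV normc_nat normcX.
have num : normc (- s3 + w ^+ 2 / 6 * (w ^+ 3 / 6 + s3)) <= 33 * n ^+ 4.
  rewrite (le_trans (le_normcD _ _))// normcN Normc.normcM w2.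
  have h : normc (w ^+ 3 / 6 + s3) <= n ^+ 3 / 6 + 32 * n ^+ 4.
    by rewrite (le_trans (le_normcD _ _))// w3 lerD2l.
  have n20 : 0 <= n ^+ 2 / 6 by rewrite divr_ge0// exprn_ge0// ltW.
  have := ler_wpM2l n20 h.
  have : n ^+ 2 / 6 * (n ^+ 3 / 6 + 32 * n ^+ 4) <= n ^+ 4.
    have -> : n ^+ 2 / 6 * (n ^+ 3 / 6 + 32 * n ^+ 4) = n ^+ 4 * (n / 36 + 32 * n ^+ 2 / 6).
      by field.
    by rewrite ler_piMr//; nra.
  lra.
rewrite Normc.normcM Normc.normcV Normc.normcM -/n ler_pdivrMr; last first.
  by rewrite mulr_gt0// (lt_le_trans _ sh2)// divr_gt0.
rewrite (le_trans num)// (_ : 33 * n ^+ 4 = 66 * n ^+ 2 * (n * (n / 2))); last by field.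
by rewrite ler_wpM2l ?mulr_ge0 ?exprn_ge0 ?(ltW n0)// ler_wpM2l// ltW.
Qed.

Lemma sinh_exp_far (v : R) : 0 < v -> exists2 c : R, 0 < c &
  forall x, v <= `|x| -> c * expR `|x| <= `|sinh x|.
Proof.
move=> v0; exists ((1 - expR (- (2 * v))) / 2).
  by rewrite divr_gt0// subr_gt0 expR_lt1 oppr_lt0 mulr_gt0.
move=> x; rewrite sinh_abs; set u := `|x| => vu.
rewrite /sinh mulrAC ler_pM2r// mulrBl mul1r lerB// -expRD ler_expR; lra.
Qed.

Variables ap am tau : R.
Hypotheses (hap : 0 < ap) (ham : 0 < am) (htau : 0 < tau)
  (haptau : ap * tau < pi) (hamtau : am * tau < pi).

Local Notation a := (amean ap am).

Lemma a_gt0 : 0 < a.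
Proof. by rewrite divr_gt0// addr_gt0. Qed.

Definition gker t := (t * csinh (ap%:C * t) * csinh (am%:C * t))^-1.

Definition gwt x := gker (x +i* tau) / (4 * 'i).

Definition gexp x := 2 * 'i * (x +i* tau).

(** [gRd 0] is [gR] in the strip, see [gRd0], and [gRd n] its n-th derivative. *)
Definition gRd n z := Lap gwt gexp n z.

Let normc_xy x y : 0 <= y -> normc (x +i* y) <= `|x| + y.
Proof. by move=> y0; rewrite (le_trans (normc_le_ReIm _))//= (ger0_norm y0). Qed.

Let normc_y x y : 0 <= y -> y <= normc (x +i* y).
Proof. by move=> y0; rewrite (le_trans _ (normc_Im _))//= ger0_norm. Qed.

Lemma gwt_bound : exists2 C : R, 0 <= C &
  forall x, normc (gwt x) <= C * expR (- (2 * a * `|x|)).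
Proof.
have [c1 c10 h1] := csinh_strip_ge hap htau (lexx tau) haptau.
have [c2 c20 h2] := csinh_strip_ge ham htau (lexx tau) hamtau.
exists ((tau * c1 * c2)^-1 / 4).
  by rewrite divr_ge0// invr_ge0 !mulr_ge0// ltW.
move=> x; have hx : tau <= tau <= tau by rewrite lexx.
rewrite /gwt /gker Normc.normcM !Normc.normcV [normc (4 * _)]Normc.normcM normci mulr1 normc_nat.
rewrite 2![normc (_ * csinh _)]Normc.normcM.
rewrite [leRHS]mulrAC ler_pM2r// expRN -invfM.
have -> : 2 * a * `|x| = ap * `|x| + am * `|x| by rewrite /amean; field.
have n1 := normc_y x (ltW htau); have n2 := h1 x tau hx; have n3 := h2 x tau hx.
rewrite lef_pV2 ?posrE ?mulr_gt0 ?expR_gt0//.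
- rewrite expRD (_ : _ * _ * _ * _ = tau * (c1 * expR (ap * `|x|)) * (c2 * expR (am * `|x|))); last by ring.
  apply: ler_pM => //; first by rewrite !mulr_ge0 ?expR_ge0 ?(ltW c10) ?(ltW htau).
    by rewrite mulr_ge0 ?expR_ge0 ?(ltW c20).
  by apply: ler_pM => //; rewrite ?mulr_ge0 ?expR_ge0 ?(ltW c10) ?(ltW htau).
- by rewrite (lt_le_trans htau).
- by rewrite (lt_le_trans _ n2)// mulr_gt0// expR_gt0.
- by rewrite (lt_le_trans _ n3)// mulr_gt0// expR_gt0.
Qed.

(** The kernel decays like e^(- 2 a |Re t|), which beats e^(2 i t z) inside the
    strip |Im z| < a. The height tau of the line gives the decay in Re z. *)
Lemma gker_bound n b : b < a -> exists2 K : R, 0 <= K & forall z x, `|Im z| <= b ->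
  normc (gexp x ^+ n * gwt x * cexp (gexp x * z)) <= K * expR (- (2 * tau * Re z)) * lor x.
Proof.
move=> ba; have [C C0 hC] := gwt_bound.
have k0 : 0 < 2 * (a - b) by rewrite mulr_gt0// subr_gt0.
have [D [D0 hD]] := lor_expR n k0.
exists ((2 * (1 + tau)) ^+ n * C * D).
  by rewrite !mulr_ge0// exprn_ge0// mulr_ge0// addr_ge0// ltW.
move=> z x hz.
have m1 : normc (gexp x) <= 2 * (1 + tau) * (1 + `|x|).
  rewrite /gexp !Normc.normcM normci mulr1 normc_nat -mulrA ler_pM2l//.
  have := normc_xy x (ltW htau); have := mulr_ge0 (ltW htau) (normr_ge0 x); lra.
have m2 : normc (gexp x) ^+ n <= (2 * (1 + tau)) ^+ n * (1 + `|x|) ^+ n.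
  rewrite -exprMn lerXn2r// nnegrE ?normc_ge0//.
  by rewrite !mulr_ge0// addr_ge0// ltW.
have e1 : normc (cexp (gexp x * z)) <= expR (2 * b * `|x|) * expR (- (2 * tau * Re z)).
  rewrite normc_cexp -expRD ler_expR Re_2itz.
  have -> : - (2 * (x * Im z + tau * Re z)) = - (2 * (x * Im z)) - 2 * tau * Re z by ring.
  rewrite lerD2r.
  rewrite (le_trans (ler_norm _))// normrN !normrM ger0_norm//.
  by rewrite -!mulrA ler_pM2l// mulrC ler_wpM2r.
rewrite Normc.normcM [normc (_ ^+ n * _)]Normc.normcM normcX.
have x0 := normr_ge0 x.
have p1 : 0 <= (2 * (1 + tau)) ^+ n by rewrite exprn_ge0// mulr_ge0// addr_ge0// ltW.
have p2 : 0 <= (1 + `|x|) ^+ n by rewrite exprn_ge0// addr_ge0.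
apply: (@le_trans _ _ ((2 * (1 + tau)) ^+ n * (1 + `|x|) ^+ n * (C * expR (- (2 * a * `|x|))) *
    (expR (2 * b * `|x|) * expR (- (2 * tau * Re z))))).
  apply: ler_pM => //; rewrite ?mulr_ge0 ?normc_ge0 ?exprn_ge0 ?normc_ge0//.
  apply: ler_pM => //; rewrite ?exprn_ge0 ?normc_ge0 //.
rewrite (_ : _ * _ * _ * _ = (2 * (1 + tau)) ^+ n * C * expR (- (2 * tau * Re z)) *
  ((1 + `|x|) ^+ n * (expR (- (2 * a * `|x|)) * expR (2 * b * `|x|)))); last by ring.
rewrite -expRD (_ : - _ + _ = - (2 * (a - b) * `|x|)); last by ring.
rewrite (_ : _ * D * _ * _ = (2 * (1 + tau)) ^+ n * C * expR (- (2 * tau * Re z)) * (D * lor x)); last by ring.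
by rewrite ler_wpM2l// !mulr_ge0// expR_ge0.
Qed.

Lemma ccont_gexp x : ccont gexp x.
Proof. by apply: ccontZ; exact: ccont_hor. Qed.

Lemma csinh_line_neq0 (k x y : R) : 0 < k -> 0 < y -> k * y < pi -> csinh (k%:C * (x +i* y)) != 0.
Proof.
move=> k0 y0 ky; have [c c0 hc] := csinh_strip_ge k0 y0 (lexx y) ky.
by rewrite -normc_gt0 (lt_le_trans _ (hc x y _)) ?lexx// mulr_gt0// expR_gt0.
Qed.

Lemma xy_neq0 x y : 0 < y -> x +i* y != 0.
Proof.
by move=> y0; rewrite -normc_gt0 (lt_le_trans y0)// normc_y// ltW.
Qed.

Lemma ccont_gwt x : ccont gwt x.
Proof.
apply: ccontM; last exact: ccont_cst.
apply: ccontV.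
  by apply: mulf_neq0; [apply: mulf_neq0; [exact: xy_neq0|exact: csinh_line_neq0]|exact: csinh_line_neq0].
by do 2 (apply: ccontM; last by (apply: ccont_csinh; apply: ccontZ; exact: ccont_hor)); exact: ccont_hor.
Qed.

Lemma gRd_regd (X1 X2 b : R) n : b < a ->
  regd (box X1 X2 (- b) b) (gRd n) (gRd n.+1).
Proof.
move=> ba; apply: Lap_regd.
- by move=> z v; exact: box_open.
- by apply: ccont_cmeas => // x; exact: ccont_gwt.
- by apply: ccont_cmeas => // x; exact: ccont_gexp.
- move=> k; have [K K0 hK] := gker_bound k ba.
  exists (K * expR (2 * tau * `|X1|)) => z x /andP[/andP[z1 z2] /andP[z3 z4]].
  have hz : `|Im z| <= b by rewrite ler_norml !ltW.
  rewrite (le_trans (hK z x hz))// ler_wpM2r ?lor_ge0// ler_wpM2l// ler_expR.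
  rewrite -mulrN ler_pM2l; last by rewrite mulr_gt0.
  by rewrite (le_trans (y := - X1)) ?lerN2 ?(ltW z1)// -normrN ler_norm.
Qed.

Lemma gRd_Cdom n z : `|Im z| < a -> Cdom (fun x => gexp x ^+ n * gwt x * cexp (gexp x * z)).
Proof.
move=> hz; have [K K0 hK] := gker_bound n hz; split; last first.
  by exists (K * expR (- (2 * tau * Re z))) => x; exact: hK.
apply: ccont_cmeas => // x; apply: ccontM; first apply: ccontM.
- by apply: ccontX; exact: ccont_gexp.
- exact: ccont_gwt.
- by apply: ccont_exp; apply: ccontM; [exact: ccont_gexp|exact: ccont_cst].
Qed.

Lemma gRd_decay n b : b < a -> exists2 K : R, 0 <= K & forall z, `|Im z| <= b ->
  normc (gRd n z) <= K * expR (- (2 * tau * Re z)).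
Proof.
move=> ba; have [K K0 hK] := gker_bound n ba.
exists (2 * pi * K); first by rewrite !mulr_ge0// pi_ge0.
move=> z hz; rewrite -mulrA; apply: Cint_le; last by move=> x; exact: hK.
by have [] := gRd_Cdom n (le_lt_trans hz ba).
Qed.

End Kernel.

(** * The contour integral equals gR *)

Section LineIntegrals.
Context {R : realType}.
Implicit Types (x y s : R) (z t w : R[i]).

(** The primitive F vanishes at both ends, at the rate 1 / n. *)
Lemma Cint_derivative (F f : R -> R[i]) (C : R) : (forall x, cder F x (f x)) ->
  (forall x, ccont f x) -> Cdom f ->
  (forall n : nat, normc (F n%:R) + normc (F (- n%:R)) <= C * n.+1%:R^-1) -> Cint f = 0.
Proof.
move=> Fd fc fd FC; apply/eqP; rewrite -normc_eq0 eq_le normc_ge0 andbT.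
apply: (@le0_of_cvg0 _ _ (fun n => normc (cintegral `[(- n%:R), n%:R] f - Cint f) +
  C * n.+1%:R^-1)) => [n|].
  have n0 : - n%:R <= n%:R :> R by rewrite (le_trans (y := 0)) ?oppr_le0.
  have := FC n; rewrite (@cintegral_ftc _ F f _ _ n0)//.
  set A := Cint f; set B := F n%:R; set B' := F (- n%:R) => h.
  rewrite {1}(_ : A = - (B - B' - A) + (B - B')); last by ring.
  rewrite (le_trans (le_normcD _ _))// normcN lerD2l.
  exact: le_trans (normcB _ _) h.
rewrite -[X in _ --> X](addr0 (0:R)); apply: cvgD; first exact: Cint_lim.
rewrite -[X in _ --> X](mulr0 C); apply: cvgM; first exact: cvg_cst.
exact: cvg_harmonic.
Qed.

Lemma normc_line_ge (T x y : R) : 0 < T -> T <= y ->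
  Num.min 1 T / 2 * (1 + `|x|) <= normc (x +i* y).
Proof.
move=> T0 Ty; have h1 := normc_Re (x +i* y); have h2 := normc_Im (x +i* y).
rewrite [Re _]/= in h1; rewrite [Im _]/= in h2.
rewrite (ger0_norm (le_trans (ltW T0) Ty)) in h2.
have m1 : Num.min 1 T <= 1 by rewrite ge_min lexx.
have m2 : Num.min 1 T <= T by rewrite ge_min lexx orbT.
have x0 := normr_ge0 x; have := ler_wpM2r x0 m1.
rewrite mul1r; lra.
Qed.

Lemma lor_inv_sqr x : ((1 + `|x|) ^+ 2)^-1 <= lor x.
Proof.
rewrite lef_pV2 ?posrE ?exprn_gt0 ?(lt_le_trans ltr01) ?oneDsqr_ge1 ?lerDl//.
rewrite /oneDsqr sqrrD expr1n mul1r -addrA lerD2l real_normK ?num_real//.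
by rewrite lerDr mulrn_wge0.
Qed.

Section Powers.
Variable T : R.
Hypothesis T0 : 0 < T.

Let t x : R[i] := x +i* T.
Let c := Num.min 1 T / 2.
Let c0 : 0 < c. Proof. by rewrite divr_gt0// lt_min ltr01. Qed.
Let tc x : c * (1 + `|x|) <= normc (t x). Proof. exact: normc_line_ge. Qed.
Let cx0 x : 0 < c * (1 + `|x|). Proof. by rewrite mulr_gt0// ltr_pwDl. Qed.
Let t0 x : t x != 0.
Proof. by rewrite -normc_gt0 (lt_le_trans _ (tc x)). Qed.
Let td x : cder t x 1. Proof. exact: cder_hor. Qed.
Let tiV x : normc (t x)^-1 <= (c * (1 + `|x|))^-1.
Proof. exact: normc_inv_le. Qed.

Let tVcont x : ccont (fun x => (t x)^-1) x.
Proof. by apply: ccontV => //; exact: cder_cont (td x). Qed.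

Lemma Cdom_line_inv (n : nat) : Cdom (fun x => t x ^- n.+2).
Proof.
split.
  apply: ccont_cmeas => // x; under eq_fun do rewrite -exprVn.
  by apply: ccontX.
exists (c ^- n.+2) => x; rewrite -exprVn normcX.
rewrite (le_trans (y := (c * (1 + `|x|))^-1 ^+ n.+2))//.
  by rewrite lerXn2r ?nnegrE ?normc_ge0 ?invr_ge0 ?(ltW (cx0 x)).
rewrite exprVn exprMn invfM ler_wpM2l ?invr_ge0 ?exprn_ge0 ?(ltW c0)//.
rewrite (le_trans _ (lor_inv_sqr x))// lef_pV2 ?posrE ?exprn_gt0 ?ltr_pwDl//.
by rewrite ler_weXn2l// lerDl.
Qed.

Lemma Cint_line_inv2 : Cint (fun x => t x ^- 2) = 0.
Proof.
apply: (@Cint_derivative (fun x => - (t x)^-1) _ (2 / c)).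
- move=> x; apply: cder_eq (cderN (cderV (t0 x) (td x))) _.
  by rewrite mulNr opprK mul1r.
- by move=> x; under eq_fun do rewrite -exprVn; exact: ccontX.
- exact: Cdom_line_inv.
- move=> n; rewrite !normcN.
  have h1 := tiV n%:R; have h2 := tiV (- n%:R).
  rewrite normrN ger0_norm// in h2; rewrite ger0_norm// in h1.
  have -> : 2 / c * n.+1%:R^-1 = (c * (1 + n%:R))^-1 + (c * (1 + n%:R))^-1.
    rewrite -[n.+1%:R]natr1 [n%:R + 1]addrC; field.
    by rewrite gt_eqF//= gt_eqF// ltr_pwDl.
  exact: lerD.
Qed.

Lemma Cint_line_inv3 : Cint (fun x => t x ^- 3) = 0.
Proof.
apply: (@Cint_derivative (fun x => - 2^-1 * ((t x)^-1 * (t x)^-1)) _ (c ^- 2)).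
- move=> x; apply: cder_eq (cderZ _ (cderM (cderV (t0 x) (td x)) (cderV (t0 x) (td x)))) _.
  by field.
- by move=> x; under eq_fun do rewrite -exprVn; exact: ccontX.
- exact: Cdom_line_inv.
- move=> n; rewrite !Normc.normcM !normcN !Normc.normcV normc_nat -!Normc.normcV.
  have h1 := tiV n%:R; have h2 := tiV (- n%:R).
  rewrite normrN ger0_norm// in h2; rewrite ger0_norm// in h1.
  set b := (c * _)^-1 in h1 h2.
  have b1 : normc (t n%:R)^-1 * normc (t n%:R)^-1 <= b * b by rewrite ler_pM ?normc_ge0.
  have b2 : normc (t (- n%:R))^-1 * normc (t (- n%:R))^-1 <= b * b by rewrite ler_pM ?normc_ge0.
  have -> : c ^- 2 * n.+1%:R^-1 = b * b * n.+1%:R.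
    rewrite /b -[n.+1%:R]natr1 [n%:R + 1]addrC; field.
    by rewrite gt_eqF//= gt_eqF// ltr_pwDl.
  have : b * b <= b * b * n.+1%:R.
    by rewrite ler_peMr ?ler1n// mulr_ge0// invr_ge0 ltW//; have := cx0 n%:R; rewrite ger0_norm.
  by move: b1 b2; set u := _ * _; set v := _ * _; lra.
Qed.

End Powers.

End LineIntegrals.

Section KernelIsG.
Context {R : realType}.
Implicit Types (x y s : R) (z t w : R[i]).

Variables ap am tau : R.
Hypotheses (hap : 0 < ap) (ham : 0 < am) (htau : 0 < tau)
  (haptau : ap * tau < pi) (hamtau : am * tau < pi).
Variable z : R[i].
Hypothesis hz : `|Im z| < amean ap am.

Local Notation a := (amean ap am).
Local Notation ker := (gker ap am).

Let kerE t : ker t = t^-1 * (csinh (ap%:C * t))^-1 * (csinh (am%:C * t))^-1.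
Proof. by rewrite /gker /gker invfM [X in X * _]invfM. Qed.

Let c1 : R[i] := - 2 * z ^+ 2 - ((ap ^+ 2 + am ^+ 2) / 6)%:C.

Let K4 : R[i] := (4 * 'i * (ap * am)%:C)^-1.

(* the kernel minus its principal part at the origin; the simple pole is
   removed by 1/sinh instead of 1/t for the sake of integrability *)
Let mf t := cexp (2 * 'i * t * z) * ker t / (4 * 'i) -
  K4 * (t ^- 3 + 2 * 'i * z * t ^- 2 + c1 * am%:C * (csinh (am%:C * t))^-1).

Let near (r T : R) t := [/\ `|Re t| <= r, 0 < Im t & Im t <= T].

(* near the origin all poles cancel, by the Taylor expansions of the exponential
   and of 1 / sinh *)
Let near_bnd (r T : R) : Num.max ap am * (r + T) <= 10^-1 -> 0 <= r -> bnd (near r T) mf.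
Proof.
move=> hrT r0; set S := near r T.
have Sn t : S t -> [/\ t != 0, normc t <= r + T, normc (ap%:C * t) <= 10^-1 & normc (am%:C * t) <= 10^-1].
  move=> [t1 t2 t3].
  have tn : normc t <= r + T.
    by rewrite (le_trans (normc_le_ReIm _))// lerD// gtr0_norm.
  have rT : 0 <= r + T by rewrite (le_trans (normc_ge0 _) tn).
  have A (k : R) : 0 < k -> k <= Num.max ap am -> normc (k%:C * t) <= 10^-1.
    move=> k0 km; rewrite Normc.normcM normcr gtr0_norm//.
    rewrite (le_trans _ hrT)// ler_pM ?normc_ge0 ?(ltW k0)//.
  split=> //.
  - by apply/eqP => t0; rewrite t0 ltxx in t2.
  - by apply: A => //; rewrite le_max lexx.
  - by apply: A => //; rewrite le_max lexx orbT.
have ap0 : ap%:C != 0 :> R[i] by rewrite fmorph_eq0 gt_eqF.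
have am0 : am%:C != 0 :> R[i] by rewrite fmorph_eq0 gt_eqF.
have i0 : 'i != 0 :> R[i] by rewrite -normc_gt0 normci.
pose f2 t := ((csinh (ap%:C * t))^-1 - (ap%:C * t)^-1 + (ap%:C * t) / 6) / t ^+ 2.
pose f3 t := ((csinh (am%:C * t))^-1 - (am%:C * t)^-1 + (am%:C * t) / 6) / t ^+ 2.
pose w0 t := 2 * 'i * t * z.
pose f4 t := (cexp (w0 t) - 1 - w0 t - w0 t ^+ 2 / 2) / t ^+ 3.
have bt : bnd S id by exists (r + T) => t /Sn[].
have btX n : bnd S (fun t => t ^+ n).
  elim: n => [|n IH]; first by exists 1 => t _; rewrite expr0 (normcr 1) normr1.
  by under eq_fun do rewrite exprS; exact: bndM bt IH.
have bf (k : R) : 0 < k -> (forall t, S t -> normc (k%:C * t) <= 10^-1) ->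
    bnd S (fun t => ((csinh (k%:C * t))^-1 - (k%:C * t)^-1 + (k%:C * t) / 6) / t ^+ 2).
  move=> k0 hk; exists (66 * k ^+ 2) => t St; have [t0 _ _ _] := Sn t St.
  have tn : 0 < normc t ^+ 2 by rewrite exprn_gt0// normc_gt0.
  rewrite Normc.normcM Normc.normcV normcX ler_pdivrMr//.
  have kt0 : k%:C * t != 0 by rewrite mulf_neq0// fmorph_eq0 gt_eqF.
  rewrite (le_trans (inv_csinh_taylor kt0 (hk t St)))//.
  by rewrite Normc.normcM normcr (gtr0_norm k0) exprMn mulrA.
have b2 : bnd S f2 by apply: bf => // t /Sn[].
have b3 : bnd S f3 by apply: bf => // t /Sn[].
have bw : bnd S w0.
  by apply: bndM; [apply: bndM => //; exact: bnd_cst|exact: bnd_cst].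
have b4 : bnd S f4.
  have [B [B0 hB]] := bnd_ge0 bw.
  exists (8 * (2 * normc z) ^+ 3 * expR B) => t St; have [t0 _ _ _] := Sn t St.
  have tn : 0 < normc t ^+ 3 by rewrite exprn_gt0// normc_gt0.
  rewrite /f4 Normc.normcM Normc.normcV normcX ler_pdivrMr//.
  rewrite (le_trans (cexp_taylor3 _))//.
  have -> : normc (w0 t) ^+ 3 = (2 * normc z) ^+ 3 * normc t ^+ 3.
    by rewrite /w0 -exprMn !Normc.normcM normci mulr1 normc_nat; congr (_ ^+ _); ring.
  rewrite mulrA mulrAC ler_wpM2r ?(ltW tn)// ler_wpM2l ?ler_expR ?hB//.
  by rewrite mulr_ge0// exprn_ge0// mulr_ge0// normc_ge0.
have be : bnd S (fun t => cexp (w0 t)) by exact: bnd_exp.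
pose q : R[i] := (ap%:C / am%:C + am%:C / ap%:C) / 6.
pose D t := ap%:C * am%:C * t / 36 + f2 t * (am%:C^-1 - am%:C * t ^+ 2 / 6) +
  f3 t * (ap%:C^-1 - ap%:C * t ^+ 2 / 6) + f2 t * f3 t * t ^+ 3.
have bD : bnd S D.
  have bp k : bnd S (fun t => k^-1 - k * t ^+ 2 / 6).
    apply: bndD; first exact: bnd_cst.
    under eq_fun do rewrite -mulrN.
    by apply: bndM; last exact: bnd_cst; apply: bndM => //; exact: bnd_cst.
  apply: bndD; last by apply: bndM => //; apply: bndM.
  apply: bndD; last exact: bndM.
  apply: bndD; last exact: bndM.
  by apply: bndM; last exact: bnd_cst; apply: bndM => //; exact: bnd_cst.
have [B hB] : bnd S (fun t => (4 * 'i)^-1 * (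
    - q * (2 * 'i * z + (2 * 'i * z) ^+ 2 * t / 2) + f4 t / (ap%:C * am%:C)
    + (- q) * f4 t * t ^+ 2 + cexp (w0 t) * D t
    + (- c1 / (ap%:C * am%:C)) * (- am%:C ^+ 2 * t / 6 + am%:C * f3 t * t ^+ 2))).
  apply: bndM; first exact: bnd_cst.
  apply: bndD; last first.
    apply: bndM; first exact: bnd_cst.
    apply: bndD; last by apply: bndM => //; apply: bndM => //; exact: bnd_cst.
    by apply: bndM; last exact: bnd_cst; apply: bndM => //; exact: bnd_cst.
  apply: bndD; last exact: bndM.
  apply: bndD; last by apply: bndM => //; apply: bndM => //; exact: bnd_cst.
  apply: bndD; last by apply: bndM => //; exact: bnd_cst.
  apply: bndM; first exact: bnd_cst.
  apply: bndD; first exact: bnd_cst.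
  by apply: bndM; last exact: bnd_cst; apply: bndM => //; exact: bnd_cst.
exists B => t St; have [t0 _ _ _] := Sn t St.
have := hB t St; cbv beta; set V := (X in normc X <= _); suff -> : mf t = V by [].
rewrite /V {V}.
have SA : (csinh (ap%:C * t))^-1 = (ap%:C * t)^-1 - ap%:C * t / 6 + f2 t * t ^+ 2.
  by rewrite /f2; move: (csinh _)^-1 => s; field; rewrite t0 ap0.
have SB : (csinh (am%:C * t))^-1 = (am%:C * t)^-1 - am%:C * t / 6 + f3 t * t ^+ 2.
  by rewrite /f3; move: (csinh _)^-1 => s; field; rewrite t0 am0.
have eE : cexp (w0 t) = 1 + w0 t + w0 t ^+ 2 / 2 + f4 t * t ^+ 3.
  by rewrite /f4; field; rewrite t0.
have i2 : 'i ^+ 2 = - 1 :> R[i] by exact: sqr_i.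
have c1E : c1 = 2 * 'i ^+ 2 * z ^+ 2 - q * (ap%:C * am%:C).
  rewrite /c1 i2 mulrN1 /q; congr (_ - _).
  rewrite rmorphM rmorphD !rmorphXn fmorphV rmorph_nat /=.
  by field; rewrite ap0 am0.
have kE : ker t = t^-1 * (csinh (ap%:C * t))^-1 * (csinh (am%:C * t))^-1.
  by rewrite /gker invfM [X in X * _]invfM.
rewrite /mf /K4 -/(w0 t) kE SA SB c1E rmorphM /= eE /D /w0.
move: (f2 t) (f3 t) (f4 t) => F2 F3 F4; rewrite /q.
by field; rewrite t0 ap0 am0 i0.
Qed.

Let far (r T : R) x y := [/\ 0 < y, y <= tau & (r <= `|x|) || (T <= y)].

Let far_csinh (k r T : R) : 0 < k -> k * tau < pi -> 0 < r -> 0 < T ->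
  exists2 c : R, 0 < c & forall x y, far r T x y ->
    c * expR (k * `|x|) <= normc (csinh (k%:C * (x +i* y))).
Proof.
move=> k0 ktau r0 T0.
have [d1 d10 h1] := @sinh_exp_far R (k * r) (mulr_gt0 k0 r0).
have [T1|T1] := leP T tau; last first.
  exists d1 => // x y [y0 ytau]; have -> : (T <= y) = false by apply/negbTE; rewrite -ltNge; lra.
  rewrite orbF => rx; rewrite scale_ri (le_trans _ (normc_csinh_ge_sinh _ _))//.
  have -> : k * `|x| = `|k * x| by rewrite normrM (gtr0_norm k0).
  by apply: h1; rewrite normrM (gtr0_norm k0) ler_pM2l.
have [d2 d20 h2] := csinh_strip_ge k0 T0 T1 ktau.
exists (Num.min d1 d2); first by rewrite lt_min d10.
move=> x y [y0 ytau] /orP[rx|Ty].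
  rewrite scale_ri (le_trans _ (normc_csinh_ge_sinh _ _))//.
  have -> : k * `|x| = `|k * x| by rewrite normrM (gtr0_norm k0).
  apply: (@le_trans _ _ (d1 * expR `|k * x|)).
    by rewrite ler_wpM2r ?expR_ge0// ge_min lexx.
  by apply: h1; rewrite normrM (gtr0_norm k0) ler_pM2l.
apply: (@le_trans _ _ (d2 * expR (k * `|x|))).
  by rewrite ler_wpM2r ?expR_ge0// ge_min lexx orbT.
by apply: h2; rewrite Ty.
Qed.

Let far_t (r T : R) : 0 < r -> 0 < T -> exists2 c : R, 0 < c & forall x y, far r T x y ->
  c * (1 + `|x|) <= normc (x +i* y).
Proof.
move=> r0 T0; pose c1' := r / (1 + r); pose c2' := Num.min 1 T / 2.
have r1 : 0 < 1 + r by rewrite addr_gt0.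
have c10 : 0 < c1' by rewrite divr_gt0.
have c20 : 0 < c2' by rewrite divr_gt0// lt_min ltr01.
exists (Num.min c1' c2'); first by rewrite lt_min c10.
move=> x y [y0 _]; have x0 : 0 <= 1 + `|x| by rewrite addr_ge0.
case/orP => [rx|Ty].
  apply: (@le_trans _ _ (c1' * (1 + `|x|))); first by rewrite ler_wpM2r// ge_min lexx.
  rewrite (le_trans _ (normc_Re _))//= /c1' mulrAC ler_pdivrMr// !mulrDr !mulr1.
  by rewrite lerD// mulrC.
apply: (@le_trans _ _ (c2' * (1 + `|x|))); first by rewrite ler_wpM2r// ge_min lexx orbT.
exact: normc_line_ge.
Qed.

(* away from the origin each term is bounded separately *)
Let far_bound (r T : R) : 0 < r -> 0 < T ->
  exists K, forall x y, far r T x y -> normc (mf (x +i* y)) <= K * lor x.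
Proof.
move=> r0 T0.
have [d1 d10 h1] := far_csinh hap haptau r0 T0.
have [d2 d20 h2] := far_csinh ham hamtau r0 T0.
have [d3 d30 h3] := far_t r0 T0.
pose L F := exists K, forall x y, far r T x y -> normc (F (x +i* y)) <= K * lor x.
have LD (F G : R[i] -> R[i]) : L F -> L G -> L (fun t => F t + G t).
  move=> [K hK] [K' hK']; exists (K + K') => x y S.
  by rewrite (le_trans (le_normcD _ _))// mulrDl lerD ?hK ?hK'.
have LZ (k : R[i]) (F : R[i] -> R[i]) : L F -> L (fun t => k * F t).
  move=> [K hK]; exists (normc k * K) => x y S.
  by rewrite Normc.normcM -mulrA ler_wpM2l ?normc_ge0 ?hK.
have ti x y : far r T x y -> normc (x +i* y)^-1 <= (d3 * (1 + `|x|))^-1.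
  by move=> S; apply: normc_inv_le; [rewrite mulr_gt0// ltr_pwDl|exact: h3].
have tp n : L (fun t => t ^- n.+2).
  exists (d3 ^- n.+2) => x y S; rewrite -exprVn normcX.
  rewrite (le_trans (y := (d3 * (1 + `|x|))^-1 ^+ n.+2))//.
    by rewrite lerXn2r ?nnegrE ?normc_ge0 ?invr_ge0 ?mulr_ge0 ?addr_ge0 ?(ltW d30) ?ti.
  rewrite exprVn exprMn invfM ler_wpM2l ?invr_ge0 ?exprn_ge0 ?(ltW d30)//.
  rewrite (le_trans _ (lor_inv_sqr x))// lef_pV2 ?posrE ?exprn_gt0 ?ltr_pwDl//.
  by rewrite ler_weXn2l// lerDl.
have Ls : L (fun t => (csinh (am%:C * t))^-1).
  have [C [C0 hC]] := lor_exp ham; exists (d2^-1 * C) => x y S.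
  apply: (@le_trans _ _ (d2 * expR (am * `|x|))^-1).
    by apply: normc_inv_le; [rewrite mulr_gt0 ?expR_gt0|exact: h2].
  by rewrite invfM -expRN -mulrA ler_wpM2l ?invr_ge0 ?(ltW d20).
have Lk : L (fun t => cexp (2 * 'i * t * z) * ker t).
  have k0 : 0 < 2 * (a - `|Im z|) by rewrite mulr_gt0// subr_gt0.
  have [C [C0 hC]] := lor_exp k0.
  exists (expR (2 * tau * `|Re z|) * (d3 * d1 * d2)^-1 * C) => x y S.
  have [y0 ytau _] := S; have y0' : 0 <= y <= tau by rewrite ltW.
  have e1 := normc_expitz x z y0'.
  have e2 : normc (ker (x +i* y)) <= (d3 * (d1 * expR (ap * `|x|)) * (d2 * expR (am * `|x|)))^-1.
    apply: normc_inv_le; first by rewrite !mulr_gt0 ?expR_gt0.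
    rewrite 2![normc (_ * csinh _)]Normc.normcM.
    apply: ler_pM; rewrite ?mulr_ge0 ?expR_ge0 ?(ltW d10) ?(ltW d20) ?(ltW d30) ?h2//.
    apply: ler_pM; rewrite ?mulr_ge0 ?expR_ge0 ?(ltW d10) ?(ltW d20) ?(ltW d30) ?h1//.
    by rewrite (le_trans _ (h3 _ _ S))// ler_peMr ?(ltW d30)// lerDl.
  rewrite Normc.normcM (le_trans (ler_pM (normc_ge0 _) (normc_ge0 _) e1 e2))//.
  have -> : (d3 * (d1 * expR (ap * `|x|)) * (d2 * expR (am * `|x|)))^-1 =
     (d3 * d1 * d2)^-1 * expR (- (2 * a * `|x|)).
    rewrite expRN -invfM; congr (_^-1).
    have -> : 2 * a * `|x| = ap * `|x| + am * `|x| by rewrite /amean; field.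
    by rewrite expRD; ring.
  rewrite expRD (_ : _ * _ * (_ * _) = expR (2 * tau * `|Re z|) * (d3 * d1 * d2)^-1 *
     (expR (2 * `|Im z| * `|x|) * expR (- (2 * a * `|x|)))); last by ring.
  rewrite -expRD -[leRHS]mulrA ler_wpM2l//.
    by rewrite mulr_ge0 ?expR_ge0// invr_ge0 !mulr_ge0// ltW.
  by rewrite (le_trans _ (hC x))// ler_expR; lra.
rewrite -/(L mf); rewrite /mf.
have -> : (fun t => cexp (2 * 'i * t * z) * ker t / (4 * 'i) -
  K4 * (t ^- 3 + 2 * 'i * z * t ^- 2 + c1 * am%:C * (csinh (am%:C * t))^-1)) =
  (fun t => (4 * 'i)^-1 * (cexp (2 * 'i * t * z) * ker t) +
   (- K4) * (t ^- 3 + 2 * 'i * z * t ^- 2 + c1 * am%:C * (csinh (am%:C * t))^-1)).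
  by apply/funext => t; rewrite mulNr [_ / (4 * _)]mulrC.
by apply: (LD); apply: (LZ) => //; apply: (LD); [apply: (LD) => //; exact: (LZ)|exact: (LZ)].
Qed.

Let mf_bound : exists K, forall x y, 0 < y <= tau -> normc (mf (x +i* y)) <= K * lor x.
Proof.
pose mx := Num.max ap am; have mx0 : 0 < mx by rewrite lt_max hap.
pose r := (20 * mx)^-1; have r0 : 0 < r by rewrite invr_gt0 mulr_gt0.
have hr : mx * (r + r) <= 10^-1.
  rewrite (_ : mx * (r + r) = 10^-1)//.
  by rewrite /r; field; rewrite gt_eqF.
have [B [B0 hB]] := bnd_ge0 (near_bnd hr (ltW r0)).
have [K hK] := far_bound r0 r0.
apply: (@near_far R (fun x y => 0 < y <= tau) (fun x y => normc (mf (x +i* y))) r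
   (B + `|K|) `|K|) => //.
- by rewrite addr_ge0.
- move=> x y /andP[y0 yt] xr; have [yr|yr] := leP y r.
    by rewrite (le_trans (hB _ _)) ?lerDl//.
  rewrite (le_trans (hK x y _))//; first by split => //; rewrite (ltW yr) orbT.
  rewrite (le_trans (ler_wpM2r (lor_ge0 x) (ler_norm K)))//.
  rewrite (le_trans (ler_wpM2l (normr_ge0 K) (lor_le1 x)))// mulr1.
  by rewrite lerDr.
- move=> x y /andP[y0 yt] xr; rewrite (le_trans (hK x y _))//.
    by split => //; rewrite xr.
  by rewrite ler_wpM2r ?lor_ge0// ler_norm.
Qed.

Let mf_reg (X e Tm : R) : 0 < e -> ap * Tm < pi -> am * Tm < pi ->
  reg (box (- X) X e Tm) mf.
Proof.
move=> e0 hT1 hT2; have tb := bnd_box (- X) X e Tm.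
have ti : reg (box (- X) X e Tm) (fun t => t^-1).
  apply: (@regV _ _ _ e) => //; last exact: reg_id.
  move=> w /andP[_ /andP[w1 w2]]; rewrite (le_trans _ (normc_Im _))//.
  by rewrite (le_trans (ltW w1))// ler_norm.
have tiX n : reg (box (- X) X e Tm) (fun t => t ^- n).
  apply: (@reg_ext _ _ (fun t => t^-1 ^+ n)) => [t|]; first by rewrite exprVn.
  exact: regX.
apply: regB.
  apply: regM; last exact: reg_cst.
  apply: regM; first exact: reg_expitz.
  apply: (@reg_ext _ _ (fun t => t^-1 * (csinh (ap%:C * t))^-1 * (csinh (am%:C * t))^-1)) => [t|].
    by rewrite kerE.
  by apply: regM; [apply: regM => //|]; exact: reg_inv_csinh.
apply: regZ; apply: regD; last by apply: regZ; exact: reg_inv_csinh.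
by apply: regD => //; exact: regZ.
Qed.

Let Tm := Num.min ((tau + pi / ap) / 2) ((tau + pi / am) / 2).

Let tauTm : [/\ tau < Tm, ap * Tm < pi & am * Tm < pi].
Proof.
have h1 : tau < pi / ap by rewrite ltr_pdivlMr// mulrC.
have h2 : tau < pi / am by rewrite ltr_pdivlMr// mulrC.
split; first by rewrite lt_min; apply/andP; split; lra.
  rewrite (le_lt_trans (y := ap * ((tau + pi / ap) / 2)))//.
    by rewrite ler_pM2l// ge_min lexx.
  rewrite (_ : _ * _ = (ap * tau + pi) / 2); last by field; rewrite gt_eqF.
  by rewrite ltr_pdivrMr// mulr_natr mulr2n ltrD2r.
rewrite (le_lt_trans (y := am * ((tau + pi / am) / 2)))//.
  by rewrite ler_pM2l// ge_min lexx orbT.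
rewrite (_ : _ * _ = (am * tau + pi) / 2); last by field; rewrite gt_eqF.
by rewrite ltr_pdivrMr// mulr_natr mulr2n ltrD2r.
Qed.

Let csinh_real_neq0 (k x : R) : 0 < k -> x != 0 -> csinh (k%:C * (x +i* 0)) != 0.
Proof.
move=> k0 x0; rewrite -normc_gt0 scale_ri mulr0 (lt_le_trans _ (normc_csinh_ge_sinh _ _))//.
by rewrite (lt_le_trans _ (sinh_lin _))// divr_gt0// normr_gt0 mulf_neq0// gt_eqF.
Qed.

Let real_neq0 x : x != 0 -> x +i* 0 != 0 :> R[i].
Proof. by move=> x0; rewrite (fmorph_eq0 (real_complex R)). Qed.

Let mf_vert x : x != 0 -> ccont (fun y => mf (x +i* y)) 0.
Proof.
move=> x0; have tV : ccont (fun y : R => (x +i* y)^-1) 0.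
  by apply: ccontV; [exact: real_neq0|exact: ccont_vert].
have sV k : 0 < k -> ccont (fun y : R => (csinh (k%:C * (x +i* y)))^-1) 0.
  move=> k0; apply: ccontV; first exact: csinh_real_neq0.
  by apply: ccont_csinh; apply: ccontZ; exact: ccont_vert.
have tX n : ccont (fun y : R => (x +i* y) ^- n) 0.
  by under eq_fun do rewrite -exprVn; exact: ccontX.
apply: ccontB.
  apply: ccontM; last exact: ccont_cst.
  apply: ccontM.
    by apply: ccont_exp; apply: ccontM; [apply: ccontZ; exact: ccont_vert|exact: ccont_cst].
  apply: (@ccont_ext _ (fun y : R => (x +i* y)^-1 * (csinh (ap%:C * (x +i* y)))^-1 *
     (csinh (am%:C * (x +i* y)))^-1)) => [t|].
    by rewrite kerE.
  by apply: ccontM; [apply: ccontM => //|]; exact: sV.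
apply: ccontZ; apply: ccontD; last by apply: ccontZ; exact: sV.
by apply: ccontD => //; exact: ccontZ.
Qed.

Let mf0 x := mf (x +i* 0).

Let mf0_meas : cmeas (setT : set (measurableTypeR R)) mf0.
Proof.
have mt : cmeas (setT : set (measurableTypeR R)) (fun x : R => x +i* 0).
  by apply: ccont_cmeas => // x; exact: ccont_hor.
have mZ (k : R[i]) f : cmeas (setT : set (measurableTypeR R)) f ->
    cmeas (setT : set (measurableTypeR R)) (fun x => k * f x).
  by move=> hf; apply: cmeasM => //; exact: cmeas_cst.
have mS (k : R) : cmeas (setT : set (measurableTypeR R)) (fun x : R => csinh (k%:C * (x +i* 0))).
  apply: cmeasM; last exact: cmeas_cst.
  by apply: cmeasB; apply: cmeas_exp => //; try apply: cmeasN; apply: (mZ).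
apply: cmeasB.
  apply: cmeasM; last exact: cmeas_cst.
  apply: cmeasM.
    apply: cmeas_exp => //; apply: cmeasM; last exact: cmeas_cst.
    exact: mZ.
  by apply: cmeasV; apply: cmeasM => //; exact: cmeasM.
apply: (mZ); apply: cmeasD; last by apply: (mZ); exact: cmeasV.
apply: cmeasD; last apply: (mZ); apply: cmeasV; exact: cmeasX.
Qed.

Let mf00 : mf0 0 = 0.
Proof.
rewrite /mf0 /mf; have -> : (0 +i* 0 : R[i]) = 0 by [].
rewrite /gker !mulr0 !mul0r /csinh oppr0 subrr mul0r !invr0 !expr0n !invr0 !mulr0 mul0r.
by rewrite !addr0 mulr0 subrr.
Qed.

Let mf_lim x : x != 0 -> normc (mf (x +i* (tau / n.+1%:R)) - mf0 x) @[n --> \oo] --> 0.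
Proof. by move=> x0; exact: (ccont_seq tau (mf_vert x0)). Qed.

Let mf0_Cdom : Cdom mf0.
Proof.
split => //; have [K hK] := mf_bound; apply: (ex_intro _ K) => x; have [->|x0] := eqVneq x 0.
  by rewrite mf00 normc0' (le_trans (normc_ge0 _) (hK 0 tau _))// htau lexx.
rewrite -subr_le0; apply: (@le0_of_cvg0 _ _ _ _ (mf_lim x0)) => n.
have hn : 0 < tau / n.+1%:R <= tau.
  by rewrite divr_gt0//= ler_pdivrMr// ler_peMr ?(ltW htau)// ler1n.
have := hK x _ hn; have := lernormcB (mf0 x) (mf (x +i* (tau / n.+1%:R))).
rewrite normc_distC; lra.
Qed.

Let mf_shift : Cint (fun x => mf (x +i* tau)) = Cint mf0.
Proof.
have [K hK] := mf_bound; have [h1 h2 h3] := tauTm.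
apply: (@contour_limit R mf mf0 tau Tm K) => //.
by move=> e X e0; exact: mf_reg.
Qed.

Let gint x : R[i] := (csin ((2 * x)%:C * z) / (2 * sinh (ap * x) * sinh (am * x))%:C
     - z / (ap * am * x)%:C) / x%:C.

Let mf0_even x : 0 < x -> mf0 x + mf0 (- x) = gint x.
Proof.
move=> x0; have xn0 : x != 0 by rewrite gt_eqF.
have E (u : R) : u +i* 0 = u%:C by [].
have S (k : R) : csinh (k%:C * x%:C) = (sinh (k * x))%:C by rewrite -rmorphM /= csinh_real.
have s0 (k : R) : 0 < k -> (sinh (k * x))%:C != 0 :> R[i].
  by move=> k0; rewrite -S -E csinh_real_neq0.
have i0 : 'i != 0 :> R[i] by rewrite -normc_gt0 normci.
have x0' : x%:C != 0 :> R[i] by rewrite fmorph_eq0.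
have ap0 : ap%:C != 0 :> R[i] by rewrite fmorph_eq0 gt_eqF.
have am0 : am%:C != 0 :> R[i] by rewrite fmorph_eq0 gt_eqF.
have SN (k : R) : csinh (k%:C * - x%:C) = - (sinh (k * x))%:C by rewrite mulrN csinhN S.
have D1 : (2 * x)%:C = 2 * x%:C by rewrite rmorphM /= rmorph_nat.
have D2 (u v : R) : (2 * u * v)%:C = 2 * u%:C * v%:C by rewrite !rmorphM /= rmorph_nat.
have D3 : (ap * am * x)%:C = ap%:C * am%:C * x%:C by rewrite !rmorphM.
have D4 : (ap * am)%:C = ap%:C * am%:C by rewrite rmorphM.
rewrite /mf0 !E rmorphN /mf !kerE !SN !S /gint /csin D1 D2 D3 /K4 D4.
have := s0 _ hap; have := s0 _ ham.
have -> : 'i * (2 * x%:C * z) = 2 * 'i * x%:C * z by ring.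
have -> : 2 * 'i * - x%:C * z = - (2 * 'i * x%:C * z) by ring.
move: (sinh (am * x))%:C (sinh (ap * x))%:C (cexp _) (cexp _) => s1 s2 e1 e2 s10 s20.
by field; rewrite x0' ap0 am0 s10 s20 i0.
Qed.

Let Cint_mf0 : Cint mf0 = g ap am z.
Proof.
pose F1 x := if 0 < x then mf0 x else 0.
pose F2 x := if 0 < x then 0 else mf0 x.
have mp : measurable_fun (setT : set (measurableTypeR R)) (fun x : R => 0 < x).
  exact: measurable_fun_ltr.
have [K [K0 hK]] := Cdom_ge0 mf0_Cdom.
have c0 := cmeas_cst (setT : set (measurableTypeR R)) (0 : R[i]).
have b0 x : normc (0 : R[i]) <= K * lor x by rewrite normc0'; exact: mulr_ge0 K0 (lor_ge0 x).
have d1 : Cdom F1.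
  split; first exact: (@cmeas_if _ setT mf0 (fun=> 0) _ measurableT mp mf0_meas c0).
  by exists K => x; rewrite /F1; case: (0 < x); [exact: hK|exact: b0].
have d2 : Cdom F2.
  split; first exact: (@cmeas_if _ setT (fun=> 0) mf0 _ measurableT mp c0 mf0_meas).
  by exists K => x; rewrite /F2; case: (0 < x); [exact: b0|exact: hK].
have -> : Cint mf0 = Cint F1 + Cint F2.
  rewrite -(CintD d1 d2); apply: eq_Cint => x.
  by rewrite /F1 /F2; case: (0 < x); rewrite ?addr0 ?add0r.
rewrite -(Cint_opp d2) -(CintD d1 (Cdom_opp d2)).
transitivity (Cint (fun x => if 0 < x then gint x else 0)).
  apply: eq_Cint => x; rewrite /F1 /F2 oppr_gt0; have [x0|x0|x0] := ltrgtP 0 x.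
  - by rewrite mf0_even.
  - by rewrite addr0.
  - by rewrite -x0 oppr0 mf00 addr0.
rewrite /Cint /g /cintegral; congr (_ +i* _).
- rewrite [RHS]Rintegral_mkcond; apply: eq_Rintegral => x _.
  by rewrite patchE mem_setE in_itv/= andbT; case: ifP.
- rewrite [RHS]Rintegral_mkcond; apply: eq_Rintegral => x _.
  by rewrite patchE mem_setE in_itv/= andbT; case: ifP.
Qed.

(** The contour representation of [gR]. The integrand of [g] is even, so [g] is
    an integral over the whole line of the kernel minus its principal part at
    the origin; on a shifted line the principal part contributes only its
    simple pole, which is the quadratic polynomial [gR - g]. *)
Lemma gRd0 : gRd ap am tau 0 z = gR ap am z.
Proof.
have i0 : 'i != 0 :> R[i] by rewrite -normc_gt0 normci.
have ap0 : ap%:C != 0 :> R[i] by rewrite fmorph_eq0 gt_eqF.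
have am0 : am%:C != 0 :> R[i] by rewrite fmorph_eq0 gt_eqF.
have z0 : 2 * `|Im (0 : R[i])| < am by rewrite normr0 mulr0.
have dV := Cdom_fV ham htau hamtau z0.
have V := VintE ham htau hamtau z0.
have V0 : Vint am tau 0 = - 'i * (pi / am)%:C.
  move: V; rewrite mulr0 cexp0 => V; apply: (@mulfI _ (1 + 1)).
    by rewrite -[1 + 1]/(2%:R) pnatr_eq0.
  by rewrite V; ring.
have dr := gRd_Cdom hap ham htau haptau hamtau 0 hz.
have d2 := Cdom_line_inv htau 0; have d3 := Cdom_line_inv htau 1.
pose f2 x : R[i] := (x +i* tau) ^- 2; pose f3 x : R[i] := (x +i* tau) ^- 3.
have E x : mf (x +i* tau) = gexp tau x ^+ 0 * gwt ap am tau x * cexp (gexp tau x * z) -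
    K4 * (f3 x + 2 * 'i * z * f2 x + c1 * am%:C * fV am 0 (x +i* tau)).
  by rewrite /mf /gwt /gexp /fV expr0 mul1r mulr0 cexp0 mul1r; congr (_ - _); ring.
have d32 : Cdom (fun x => f3 x + 2 * 'i * z * f2 x) := CdomD d3 (CdomZ _ d2).
have dc : Cdom (fun x => c1 * am%:C * fV am 0 (x +i* tau)) := CdomZ _ dV.
have := mf_shift; rewrite Cint_mf0 (eq_Cint E) (CintB dr (CdomZ _ (CdomD d32 dc))).
rewrite (CintZ _ (CdomD d32 dc)) (CintD d32 dc) (CintD d3 (CdomZ _ d2)) (CintZ _ d2).
have I2 : Cint f2 = 0 := Cint_line_inv2 htau.
have I3 : Cint f3 = 0 := Cint_line_inv3 htau.
rewrite I3 I2 mulr0 addr0 add0r (CintZ _ dV).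
rewrite -/(Vint am tau 0) V0 -/(Lap _ _ 0 z) => H.
have -> : gRd ap am tau 0 z = g ap am z + K4 * (c1 * am%:C * (- 'i * (pi / am)%:C)).
  by rewrite -H subrK.
rewrite /gR -addrA; congr (_ + _).
rewrite /chi /alpha /K4 /c1 !(rmorphM, rmorphD, fmorphV, rmorphXn, rmorph_nat) /=.
by move: (pi : R)%:C => p; field; rewrite ap0 am0 i0.
Qed.

End KernelIsG.

(** * Growth and difference equation of exp (i gR) *)

Section GOdd.
Context {R : realType}.
Implicit Types (z w : R[i]).

Lemma cintegral_opp (D : set R) (f : R -> R[i]) :
  cintegral D (fun t => - f t) = - cintegral D f.
Proof.
have H (h : R -> R) : Rintegral lebesgue_measure D (fun t => - h t) =
    - Rintegral lebesgue_measure D h.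
  rewrite /Rintegral integralE [in RHS]integralE.
  have -> : (fun x => (- h x)%:E) = (\- (EFin \o h))%E by [].
  rewrite funeposN funenegN; move: (integral _ _ _) (integral _ _ _).
  by case=> [u||] [v||] //=; rewrite ?opprB ?oppr0.
by rewrite /cintegral; under eq_fun do rewrite ReN; under [X in _ +i* Rintegral _ _ X]eq_fun do rewrite ImN; rewrite !H.
Qed.

Lemma csinN z : csin (- z) = - csin z.
Proof. by rewrite /csin mulrN opprK -[RHS]mulNr opprB. Qed.

Lemma gN (ap am : R) z : g ap am (- z) = - g ap am z.
Proof.
rewrite /g -cintegral_opp; congr cintegral; apply/funext => t.
rewrite mulrN csinN -[RHS]mulNr opprB; congr (_ / _).
by rewrite !mulNr opprK addrC.
Qed.

Lemma gR_reflect (ap am : R) z :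
  gR ap am z + gR ap am (- z) = 2 * (chi ap am)%:C + (alpha ap am)%:C * z ^+ 2 / 2.
Proof. by rewrite /gR gN sqrrN; field. Qed.

Lemma amean_swap (ap am : R) : amean am ap = amean ap am.
Proof. by rewrite /amean addrC. Qed.

Lemma alpha_swap (ap am : R) : alpha am ap = alpha ap am.
Proof. by rewrite /alpha mulrC [am * ap]mulrC mulrC. Qed.

Lemma gRd_swap (ap am tau : R) n z : gRd am ap tau n z = gRd ap am tau n z.
Proof.
have E : gwt am ap tau = gwt ap am tau.
  by apply/funext => x; rewrite /gwt /gker [_ * csinh (am%:C * _) * _]mulrAC.
by rewrite /gRd E.
Qed.

Lemma le0_lor (a K : R) : (forall n : nat, a <= K * lor (n%:R : R)) -> a <= 0.
Proof.
move=> h; apply: (le0_of_cvg0 h); rewrite -[X in _ --> X](mulr0 K).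
by apply: cvgM; [exact: cvg_cst|exact: lor_nat0].
Qed.

End GOdd.

Section EFacts.
Context {R : realType}.
Implicit Types (x y b : R) (z t w : R[i]).
Variables ap am tau : R.
Hypotheses (hap : 0 < ap) (ham : 0 < am) (htau : 0 < tau)
  (haptau : ap * tau < pi) (hamtau : am * tau < pi).

Local Notation a := (amean ap am).
Local Notation rn := (gRd ap am tau).

Definition Ef z := cexp ('i * rn 0 z).

Lemma Ef_reg (X1 X2 b : R) : b < a -> reg (box X1 X2 (- b) b) Ef.
Proof.
move=> ba; apply: reg_exp; apply: regZ.
by exists (rn 1); exact: (gRd_regd hap ham htau haptau hamtau).
Qed.

Lemma Ef_near1 b : b < a -> exists2 K : R, 0 <= K & forall z, `|Im z| <= b -> 0 <= Re z ->
  normc (Ef z - 1) <= K * expR (- (2 * tau * Re z)).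
Proof.
move=> ba; have [K K0 hK] := gRd_decay hap ham htau haptau hamtau 0 ba.
exists (2 * K * expR K); first by rewrite !mulr_ge0 ?expR_ge0.
move=> z hz z0; have h := hK z hz.
have e1 : expR (- (2 * tau * Re z)) <= 1.
  by rewrite expR_le1 oppr_le0 !mulr_ge0// ltW.
have hK' : normc (rn 0 z) <= K by rewrite (le_trans h)// ler_piMr.
rewrite (le_trans (cexp_taylor1 _))// Normc.normcM normci mul1r.
set e := expR (- _) in h e1 *.
rewrite (_ : 2 * K * expR K * e = 2 * (K * e) * expR K); last by ring.
by rewrite ler_pM ?mulr_ge0 ?expR_ge0 ?normc_ge0 ?ler_expR ?ler_pM2l.
Qed.

Lemma Ef_bnd b : b < a -> exists2 K : R, 0 <= K & forall z, `|Im z| <= b -> 0 <= Re z ->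
  normc (Ef z) <= K.
Proof.
move=> ba; have [K K0 hK] := Ef_near1 ba; exists (1 + K); first by rewrite addr_ge0.
move=> z hz z0; have -> : Ef z = 1 + (Ef z - 1) by rewrite addrC subrK.
rewrite (le_trans (le_normcD _ _))// (normcr 1) normr1 lerD2l (le_trans (hK z hz z0))//.
by rewrite ler_piMr// expR_le1 oppr_le0 !mulr_ge0// ltW.
Qed.

Lemma Ef_reflect z : `|Im z| < a ->
  Ef z * Ef (- z) = cexp ('i * (2 * (chi ap am)%:C + (alpha ap am)%:C * z ^+ 2 / 2)).
Proof.
move=> hz; have hz' : `|Im (- z)| < a by rewrite ImN normrN.
rewrite /Ef -cexpD -mulrDr (gRd0 hap ham htau haptau hamtau hz).
by rewrite (gRd0 hap ham htau haptau hamtau hz') gR_reflect.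
Qed.

(** The reflection expresses [Ef z] by [Ef (- z)], which is bounded away from 0,
    and an explicit Gaussian. *)
Lemma Ef_neg b : b < a -> exists2 K : R, 0 <= K & forall z, `|Im z| <= b -> Re z <= 0 ->
  normc (Ef z) <= K * expR (- (alpha ap am * Re z * Im z)).
Proof.
move=> ba; have [K K0 hK] := gRd_decay hap ham htau haptau hamtau 0 ba.
exists (expR K); first exact: expR_ge0.
move=> z hz z0; have hz' : `|Im (- z)| <= b by rewrite ImN normrN.
have h := hK _ hz'; have hK' : normc (rn 0 (- z)) <= K.
  rewrite (le_trans h)// ler_piMr// expR_le1 oppr_le0 !mulr_ge0 ?(ltW htau)//.
  by rewrite ReN oppr_ge0.
have -> : Ef z = cexp ('i * (2 * (chi ap am)%:C + (alpha ap am)%:C * z ^+ 2 / 2)) *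
    cexp (- ('i * rn 0 (- z))).
  by rewrite -(Ef_reflect (le_lt_trans hz ba)) -mulrA cexpN divff ?mulr1// cexp_neq0.
rewrite Normc.normcM !normc_cexp mulrC ler_pM ?expR_ge0 ?ler_expR//.
  rewrite ReN (le_trans (ler_norm _))// normrN (le_trans (normc_Re _))//.
  by rewrite Normc.normcM normci mul1r.
have -> : z = (Re z)%:C + 'i * (Im z)%:C.
  by apply: complexP; rewrite !ReImE /=; ring.
rewrite (_ : (alpha ap am)%:C * _ / 2 = (alpha ap am / 2)%:C *
   ((Re z)%:C + 'i * (Im z)%:C) ^+ 2).
  by rewrite (natrC 2) expr2 !ReImE /=; lra.
by rewrite mulrAC (natrC 2) -fmorphV -rmorphM.
Qed.

Let k : R := 2 * pi / am.
Let k0 : 0 < k. Proof. by rewrite divr_gt0// mulr_gt0// pi_gt0. Qed.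
Let q z := 1 + cexp (- (k%:C * z)).
Let hI : R[i] := 'i * (ap / 2)%:C.

Let q_neq0 z : 2 * `|Im z| < am -> q z != 0.
Proof.
move=> hz; apply/eqP => q0; have := VintE ham htau hamtau hz.
have -> : cexp ((2 * pi / am)%:C * z) + 1 = cexp (k%:C * z) * q z.
  by rewrite /q [cexp _ * _]mulrDr mulr1 -cexpD subrr cexp0.
rewrite q0 mulr0 mul0r => /eqP; rewrite eq_sym oppr_eq0 !mulf_eq0 -!normc_eq0 normci normcr.
by rewrite normc_nat ?pnatr_eq0 ?oner_eq0 /= gtr0_norm ?gt_eqF ?divr_gt0 ?pi_gt0.
Qed.

Let Im_shift (s : R) z : Im (z + s%:C * hI) = Im z + s * (ap / 2).
Proof. by rewrite ImD ImMr /hI ImM /=; ring. Qed.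

Let Re_shift (s : R) z : Re (z + s%:C * hI) = Re z.
Proof. by rewrite ReD ReMr /hI ReM /=; ring. Qed.

Let rn1_diff z : 2 * `|Im z| < am ->
  (rn 1 (z + hI) - rn 1 (z - hI)) * 'i * q z = - k%:C * cexp (- (k%:C * z)).
Proof.
move=> hz; have hp : `|Im (z + hI)| < a.
  have := Im_shift 1 z; rewrite !mul1r => ->; rewrite (le_lt_trans (ler_normD _ _))//.
  by rewrite (gtr0_norm (divr_gt0 hap _))// /amean; lra.
have hm : `|Im (z - hI)| < a.
  have := Im_shift (-1) z; rewrite rmorphN1 !mulN1r => ->; rewrite (le_lt_trans (ler_normB _ _))//.
  by rewrite (gtr0_norm (divr_gt0 hap _))// /amean; lra.
have dp := gRd_Cdom hap ham htau haptau hamtau 1 hp.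
have dm := gRd_Cdom hap ham htau haptau hamtau 1 hm.
have dV := Cdom_fV ham htau hamtau hz.
have -> : rn 1 (z + hI) - rn 1 (z - hI) = - Vint am tau z.
  rewrite /gRd /Lap -(CintB dp dm) -(CintN dV); apply: eq_Cint => x.
  have t0 := xy_neq0 x htau; have sp := csinh_line_neq0 x hap htau haptau.
  have sm := csinh_line_neq0 x ham htau hamtau.
  have i0 : 'i != 0 :> R[i] by rewrite -normc_gt0 normci.
  rewrite expr1 -mulrBr [gexp tau x * (z + hI)]mulrDr [gexp tau x * (z - hI)]mulrBr.
  rewrite [cexp (_ + _)]cexpD [cexp (_ - _)]cexpD.
  have E : gexp tau x * hI = - (ap%:C * (x +i* tau)).
    have i2 : 'i * 'i = - 1 :> R[i] by rewrite -expr2 sqr_i.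
    rewrite /gexp /hI rmorphM fmorphV rmorph_nat.
    by transitivity (('i * 'i) * (ap%:C * (x +i* tau))); [field|rewrite i2 mulN1r].
  have Es : cexp (ap%:C * (x +i* tau)) = 2 * csinh (ap%:C * (x +i* tau)) + cexp (- (ap%:C * (x +i* tau))).
    by rewrite /csinh; field.
  rewrite E opprK Es /fV /gwt /gker /gexp.
  move: t0 sp sm; move: (x +i* tau) (cexp (2 * 'i * _ * z)) (cexp (- _)) (csinh (am%:C * _)) (csinh (ap%:C * _)) => t e1 e2 s2 s1 t0 s10 s20.
  by field; rewrite t0 s10 s20 i0.
have V := VintE ham htau hamtau hz.
have Q : cexp (- (k%:C * z)) * (cexp (k%:C * z) + 1) = q z.
  by rewrite mulrDr cexpNV mulr1.
rewrite -Q (_ : _ * _ = - 'i * cexp (- (k%:C * z)) * ((cexp (k%:C * z) + 1) * Vint am tau z)); last by ring.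
rewrite V; have -> : k%:C = 2 * (pi / am)%:C by rewrite /k -mulrA rmorphM rmorph_nat.
have i2 : 'i * 'i = - 1 :> R[i] by rewrite -expr2 sqr_i.
transitivity ('i * 'i * (2 * (pi / am)%:C * cexp (- (2 * (pi / am)%:C * z)))); first by ring.
by rewrite i2; ring.
Qed.

(** The logarithmic derivatives of both sides agree, since the difference of the
    two contour integrals is [Vint]. Hence the ratio of the two sides is constant
    on horizontal lines, and it tends to 1 at +oo. *)
Lemma Ef_diff z : 2 * `|Im z| < am ->
  Ef (z + hI) = (1 + cexp (- ((2 * pi / am)%:C * z))) * Ef (z - hI).
Proof.
move=> hz.
pose b := (`|Im z| + ap / 2 + a) / 2.
have h2 : 0 < ap / 2 by rewrite divr_gt0.
have hb1 : `|Im z| + ap / 2 < b by rewrite /b /amean; lra.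
have hb2 : b < a by rewrite /b /amean; lra.
have hp x : `|Im (z + hI + x%:C * 1)| < b.
  rewrite ImD ImMr mulr0 addr0; have := Im_shift 1 z; rewrite !mul1r => ->.
  by rewrite (le_lt_trans (ler_normD _ _))// (gtr0_norm h2).
have hm x : `|Im (z - hI + x%:C * 1)| < b.
  rewrite ImD ImMr mulr0 addr0; have := Im_shift (-1) z; rewrite rmorphN1 !mulN1r => ->.
  by rewrite (le_lt_trans (ler_normB _ _))// (gtr0_norm h2).
have dr w x : (forall x, `|Im (w + x%:C * 1)| < b) ->
    cder (fun x => rn 0 (w + x%:C * 1)) x (rn 1 (w + x%:C * 1)).
  move=> hw; have [hol _ _ _] := gRd_regd hap ham htau haptau hamtau (Re (w + x%:C * 1) - 1)
    (Re (w + x%:C * 1) + 1) 0 hb2.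
  have := hol_line (v := 1) hol (z := w) (t := x); rewrite mul1r; apply.
  by rewrite /box; have := hw x; rewrite ltr_norml => /andP[-> ->]; apply/andP; split => //; lra.
have hx x : 2 * `|Im (z + x%:C * 1)| < am by rewrite ImD ImMr mulr0 addr0.
have dq x : cder (fun x => q (z + x%:C * 1)) x (- k%:C * cexp (- (k%:C * (z + x%:C * 1)))).
  have D := cder_exp (cderN (cderZ k%:C (cderD (cder_cst z x) (cderM (cder_real x) (cder_cst (1 : R[i]) x))))).
  apply: cder_eq (cderD (cder_cst 1 x) D) _.
  by rewrite !add0r mul1r mulr0 addr0 mulr1.
pose W x := 'i * (rn 0 (z + hI + x%:C * 1) - rn 0 (z - hI + x%:C * 1)).
pose B x := cexp (W x) * (q (z + x%:C * 1))^-1.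
have alg (u v r : R[i]) : u != 0 -> 'i * r * v * u^-1 + v * (- ('i * r * u) / u ^+ 2) = 0.
  by move=> u0; field.
have dB x : cder B x 0.
  have q0 := q_neq0 (hx x).
  apply: cder_eq (cderM (cder_exp (cderZ 'i%R (cderB (dr _ x hp) (dr _ x hm)))) (cderV q0 (dq x))) _.
  have := rn1_diff (hx x); rewrite addrAC [z + _ - hI]addrAC => H.
  cbv beta; rewrite (_ : - k%:C * _ = 'i * (rn 1 (z + hI + x%:C * 1) - rn 1 (z - hI + x%:C * 1)) *
    q (z + x%:C * 1)); last by rewrite -H; ring.
  exact: alg.
have B0 x : cexp (W x) = B 0 * q (z + x%:C * 1).
  by rewrite (cder0_cst dB 0 x) /B divfK// q_neq0.
have [K K0 hK] := gRd_decay hap ham htau haptau hamtau 0 hb2.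
have t20 : 0 < 2 * tau by rewrite mulr_gt0.
have [C1 [C10 hC1]] := lor_exp k0; have [C2 [C20 hC2]] := lor_exp t20.
pose K' := K * expR (- (2 * tau * Re z)).
have K'0 : 0 <= K' by rewrite mulr_ge0 ?expR_ge0.
have rn_le w (n : nat) : Re w = Re z -> (forall x, `|Im (w + x%:C * 1)| < b) ->
    normc (rn 0 (w + n%:R%:C * 1)) <= K' * expR (- (2 * tau * n%:R)).
  move=> w1 hw; rewrite (le_trans (hK _ (ltW (hw _))))//.
  by rewrite ReD ReMr mulr1 w1 mulrDr opprD expRD mulrA.
suff : normc (B 0 - 1) <= 0.
  move=> h; have : normc (B 0 - 1) == 0 by rewrite eq_le h normc_ge0.
  rewrite normc_eq0 subr_eq0 => /eqP B1.
  have := B0 0; rewrite B1 mul1r mul0r addr0 /W !mul0r !addr0 mulrBr cexpB => H.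
  rewrite -[1 + _]/(q z) -H.
  by rewrite divfK// cexp_neq0.
apply: (@le0_lor _ _ (normc (B 0) * expR (- (k * Re z)) * C1 + 4 * K' * expR (2 * K') * C2)) => n.
have Wn : normc (W n%:R) <= 2 * K' * expR (- (2 * tau * n%:R)).
  rewrite /W Normc.normcM normci mul1r (le_trans (normcB _ _))//.
  have h1 : Re (z + hI) = Re z by have := Re_shift 1 z; rewrite mul1r.
  have h3 : Re (z - hI) = Re z by have := Re_shift (-1) z; rewrite rmorphN1 mulN1r.
  by have := rn_le _ n h1 hp; have := rn_le _ n h3 hm; lra.
have Wn' : normc (W n%:R) <= 2 * K'.
  rewrite (le_trans Wn)// ler_piMr ?mulr_ge0// expR_le1 oppr_le0 mulr_ge0// ltW//.
have -> : B 0 - 1 = B 0 * (1 - q (z + n%:R%:C * 1)) + (cexp (W n%:R) - 1).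
  by rewrite B0; ring.
rewrite (le_trans (le_normcD _ _))// mulrDl lerD//.
  rewrite Normc.normcM -[leRHS]mulrA -[leRHS]mulrA ler_wpM2l ?normc_ge0// /q opprD addrA subrr add0r normcN.
  rewrite normc_cexp ReN ReMr ReD ReMr mulr1 mulrDr opprD expRD ler_wpM2l ?expR_ge0//.
  by have := hC1 n%:R; rewrite ger0_norm.
rewrite (le_trans (cexp_taylor1 _))//.
rewrite (_ : 4 * K' * expR (2 * K') * C2 * _ = 2 * (2 * K' * (C2 * lor n%:R)) * expR (2 * K')); last by ring.
rewrite ler_pM ?mulr_ge0 ?normc_ge0 ?expR_ge0 ?ler_expR// ler_pM2l//.
rewrite (le_trans Wn)// ler_wpM2l ?mulr_ge0//.
by have := hC2 n%:R; rewrite ger0_norm.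

Qed.

End EFacts.

(** * The boundary of the strip *)

Section RightLimits.
Context {R : realType}.
Implicit Types (h : R -> R) (d : R).

Lemma right_cvg0 h d (v : R) : 0 < d -> (forall e, 0 < e < d -> h e = 0) ->
  h e @[e --> 0^'+] --> v -> v = 0.
Proof.
move=> d0 hd hv; have h0 : (fun=> 0 : R) e @[e --> (0:R)^'+] --> v.
  apply: cvg_trans hv; apply: near_eq_cvg; near=> e; apply: hd.
  apply/andP; split; near: e; first exact: nbhs_right_gt.
  exact: nbhs_right_lt.
exact: (cvg_unique (@Rhausdorff R) h0 (cvg_cst 0)).
Unshelve. all: by end_near. Qed.

Lemma right_cont0 h d : 0 < d -> (forall e, 0 < e < d -> h e = 0) ->
  h e @[e --> 0] --> h 0 -> h 0 = 0.
Proof. by move=> d0 hd hc; exact: (right_cvg0 d0 hd (cvg_at_right_filter hc)). Qed.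

Lemma right_der0 h d (v : R) : 0 < d -> (forall e, 0 < e < d -> h e = 0) -> h 0 = 0 ->
  is_derive (0 : R) 1 h v -> v = 0.
Proof.
move=> d0 hd h0 [dh <-]; have := cvg_dnbhs_at_right dh; apply: (right_cvg0 d0) => e he.
by rewrite /= /shift/= addr0 h0 subr0 [_%:A]mulr1 hd// /GRing.scale /= mulr0.
Qed.

Lemma right_ccont0 (f : R -> R[i]) d : 0 < d -> (forall e, 0 < e < d -> f e = 0) ->
  ccont f 0 -> f 0 = 0.
Proof.
by move=> d0 hd [h1 h2]; apply: complexP;
  [apply: (right_cont0 d0 _ h1)|apply: (right_cont0 d0 _ h2)] => e /hd ->.
Qed.

Lemma right_cder0 (f : R -> R[i]) d v : 0 < d -> (forall e, 0 < e < d -> f e = 0) ->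
  cder f 0 v -> v = 0.
Proof.
move=> d0 hd hv; have f0 := right_ccont0 d0 hd (cder_cont hv).
by case: hv => [h1 h2]; apply: complexP;
  [apply: (right_der0 d0 _ _ h1)|apply: (right_der0 d0 _ _ h2)] => [e /hd ->||e /hd ->|] //; rewrite f0.
Qed.

End RightLimits.

Section BoundaryValue.
Context {R : realType}.
Implicit Types (x y b e : R) (z t w : R[i]).
Variables ap am tau : R.
Hypotheses (hap : 0 < ap) (ham : 0 < am) (htau : 0 < tau)
  (haptau : ap * tau < pi) (hamtau : am * tau < pi).

Local Notation a := (amean ap am).
Local Notation E := (Ef ap am tau).
Let d := (am - ap) / 2.

Lemma Ef_swap z : Ef am ap tau z = E z.
Proof. by rewrite /Ef gRd_swap. Qed.

Lemma Ef_cder w v : `|Im w| < a -> exists D, cder (fun t : R => E (w + t%:C * v)) 0 D.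
Proof.
move=> hw; pose b := (`|Im w| + a) / 2; have ba : b < a by rewrite /b; lra.
have [E' [hol _ _ _]] := Ef_reg hap ham htau haptau hamtau (Re w - 1) (Re w + 1) ba.
exists (v * E' w); apply: hol; rewrite /box.
have : `|Im w| < b by rewrite /b; lra.
by rewrite ltr_norml => /andP[-> ->]; apply/andP; split => //; lra.
Qed.

Lemma absd_lt : `|d| < a.
Proof. by have := hap; have := ham; move=> h1 h2; rewrite ltr_norml /d /amean; apply/andP; split; lra. Qed.

(* the right-hand side of the difference equation, e below the boundary *)
Let fl (ap am p e : R) : R[i] :=
  (1 - cexp (- (2 * pi / am * p)%:C) * cexp (e%:C * ('i * (2 * pi / am)%:C))) *
  E (p +i* ((am - ap) / 2) + e%:C * (- 'i)).

Let fl_flux p e : 0 < e < Num.min ap am -> fl ap am p e - fl am ap p e = 0.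
Proof.
rewrite lt_min => /andP[e0 /andP[e1 e2]]; apply/eqP; rewrite subr_eq0; apply/eqP.
have H (b c : R) : 0 < b -> 0 < c -> 0 < e < c ->
    (forall z, 2 * `|Im z| < c ->
     E (z + 'i * (b / 2)%:C) = (1 + cexp (- ((2 * pi / c)%:C * z))) * E (z - 'i * (b / 2)%:C)) ->
    fl b c p e = E (p +i* (amean b c - e)).
  move=> b0 c0 /andP[_ ec] hE; have := hE (p +i* (c / 2 - e)) _.
  have hz : 2 * `|Im (p +i* (c / 2 - e))| < c.
    by rewrite mulrC -ltr_pdivlMr// ltr_norml /=; apply/andP; split; lra.
  move=> /(_ hz); rewrite (_ : _ + 'i * _ = p +i* (amean b c - e)); last first.
    by apply: complexP; rewrite !ReImE /= /amean; field.
  move=> ->; rewrite /fl; congr (_ * E _); last first.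
    by apply: complexP; rewrite !ReImE /=; field.
  congr (1 + _); rewrite -mulNr.
  have -> : - ((2 * pi / c)%:C * (p +i* (c / 2 - e))) = - (2 * pi / c * p)%:C +
     - ('i * pi%:C) + e%:C * ('i * (2 * pi / c)%:C).
    by apply: complexP; rewrite !ReImE /=; field; rewrite gt_eqF.
  by rewrite !cexpD [cexp (- ('i * _))]cexpN cexp_ipi invrN invr1 mulrN1.
rewrite (H _ _ hap ham) ?e0 ?e2//; last by move=> z hz; rewrite -Ef_diff.
rewrite (H _ _ ham hap) ?e0 ?e1//; last first.
  by move=> z hz; have := Ef_diff ham hap htau hamtau haptau hz; rewrite !Ef_swap.
by rewrite amean_swap.
Qed.

Let absd_lt' : `|(ap - am) / 2| < a.
Proof. by have := hap; have := ham; move=> h1 h2; rewrite ltr_norml /amean; apply/andP; split; lra. Qed.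

Let fl_cder p : exists D1 D2, [/\ cder (fl ap am p) 0
   (- (cexp (- (2 * pi / am * p)%:C) * ('i * (2 * pi / am)%:C)) * E (p +i* d) +
    (1 - cexp (- (2 * pi / am * p)%:C)) * D1) & cder (fl am ap p) 0
   (- (cexp (- (2 * pi / ap * p)%:C) * ('i * (2 * pi / ap)%:C)) * E (p +i* - d) +
    (1 - cexp (- (2 * pi / ap * p)%:C)) * D2)].
Proof.
have [D1 h1] := @Ef_cder (p +i* d) (- 'i) absd_lt.
have [D2 h2] := @Ef_cder (p +i* ((ap - am) / 2)) (- 'i) absd_lt'.
have hu c : cder (fun e : R => 1 - cexp (- (2 * pi / c * p)%:C) * cexp (e%:C * ('i * (2 * pi / c)%:C))) 0
    (- (cexp (- (2 * pi / c * p)%:C) * ('i * (2 * pi / c)%:C))).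
  apply: cder_eq (cderB (cder_cst _ _) (cderZ _ (cder_exp (cderM (cder_real 0) (cder_cst _ 0))))) _.
  by rewrite mulr0 addr0 mul1r mul0r cexp0 mulr1 sub0r.
exists D1, D2; split.
- apply: cder_eq (cderM (hu am) h1) _; cbv beta.
  by rewrite !mul0r addr0 cexp0 mulr1.
- apply: cder_eq (cderM (hu ap) h2) _; cbv beta.
  rewrite !mul0r addr0 cexp0 mulr1 (_ : (ap - am) / 2 = - d)//.
  by rewrite /d; field.
Qed.

(** Both difference equations reach the point p + i (a - e), from below at
    distances ap and am; let e tend to 0. *)
Lemma Ef_boundary_swap p : (1 - cexp (- (2 * pi / am * p)%:C)) * E (p +i* d) =
  (1 - cexp (- (2 * pi / ap * p)%:C)) * E (p +i* - d).
Proof.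
have m0 : 0 < Num.min ap am by rewrite lt_min hap.
have [D1 [D2 [h1 h2]]] := fl_cder p.
have := right_ccont0 m0 (@fl_flux p) (cder_cont (cderB h1 h2)).
rewrite /fl !mul0r cexp0 !mulr1 !addr0 => /eqP; rewrite subr_eq0 => /eqP.
by have -> : (ap - am) / 2 = - d by rewrite /d; field.
Qed.

(** At p = 0 both sides of [Ef_boundary_swap] vanish. The identity is that of
    their derivatives in the downward direction. *)
Lemma Ef_boundary0_swap : ap%:C * E (0 +i* d) = am%:C * E (0 +i* - d).
Proof.
have m0 : 0 < Num.min ap am by rewrite lt_min hap.
have [D1 [D2 [h1 h2]]] := fl_cder 0.
have := right_cder0 m0 (@fl_flux 0) (cderB h1 h2).
rewrite !mulr0 oppr0 cexp0 subrr !mul0r !addr0 !mul1r => H.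
have i0 : 'i != 0 :> R[i] by rewrite -normc_gt0 normci.
have ap0 : ap%:C != 0 :> R[i] by rewrite fmorph_eq0 gt_eqF.
have am0 : am%:C != 0 :> R[i] by rewrite fmorph_eq0 gt_eqF.
have p0 : (2 * pi)%:C != 0 :> R[i] by rewrite fmorph_eq0 mulf_neq0 ?pnatr_eq0// gt_eqF// pi_gt0.
have dE (c : R) : (2 * pi / c)%:C = (2 * pi)%:C / c%:C :> R[i] by rewrite rmorphM fmorphV.
move: H; rewrite !dE; move: ((2 * pi)%:C) p0 (E d*i) (E (- d)*i) => P p0 e1 e2 H.
transitivity (ap%:C * am%:C * ('i * P)^-1 * ('i * (P / am%:C) * e1)).
  by field; rewrite p0 am0 i0.
have -> : 'i * (P / am%:C) * e1 = 'i * (P / ap%:C) * e2.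
  by apply/eqP; rewrite eq_sym -subr_eq0; apply/eqP; rewrite -[RHS]H; ring.
by field; rewrite p0 ap0 i0.
Qed.

Let csin_imag (u : R) : csin (0 +i* u) = 0 +i* sinh u.
Proof.
rewrite /csin; have -> : 'i * (0 +i* u) = (- u)%:C by apply: complexP; rewrite !ReImE /=; ring.
rewrite -rmorphN opprK !cexp_real -rmorphB /=; apply: (@mulIf _ (2 * 'i)).
  by rewrite mulf_neq0 ?pnatr_eq0// -normc_gt0 normci.
rewrite divfK ?mulf_neq0 ?pnatr_eq0//; last by rewrite -normc_gt0 normci.
by apply: complexP; rewrite (natrC 2) !ReImE /= /sinh; field.
Qed.

Let g_imag (u : R) : g ap am (0 +i* u) = 0 +i* Im (g ap am (0 +i* u)).
Proof.
apply: complexP => //=.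
have F (t : R) : Re ((csin ((2 * t)%:C * (0 +i* u)) / (2 * sinh (ap * t) * sinh (am * t))%:C
     - (0 +i* u) / (ap * am * t)%:C) / t%:C) = 0.
  have -> : (2 * t)%:C * (0 +i* u) = 0 +i* (2 * t * u).
    by apply: complexP; rewrite !ReImE /=; ring.
  have divC (z : R[i]) (c : R) : z / c%:C = (c^-1)%:C * z by rewrite fmorphV mulrC.
  by rewrite csin_imag !divC !(ReB, ReMr) /= !mulr0 subrr mulr0.
rewrite /g /cintegral [LHS]/=; transitivity (Rintegral (@lebesgue_measure R) `]0, +oo[ (fun=> 0 : R)).
  by apply: eq_Rintegral => t _; exact: F.
by rewrite Rintegral_cst// ?mul0r.
Qed.

Let div4C (z : R[i]) : z / 4 = (4^-1)%:C * z.
Proof. by rewrite fmorphV rmorph_nat mulrC. Qed.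

(** The square of [Ef (i d)] is known from the reflection; it is a positive
    multiple of a phase because [g] is imaginary on the imaginary axis. *)
Lemma Ef_boundary0 : ap%:C * E (0 +i* d) =
  (Num.sqrt (ap * am))%:C * cexp ('i * ((chi ap am - alpha ap am * d ^+ 2 / 4)%:C)).
Proof.
have := g_imag d; set v := Im _ => gv.
set k := cexp ('i * _).
have E1 : E (0 +i* d) = (expR (- v))%:C * k.
  have hd : `|Im (0 +i* d)| < a by exact: absd_lt.
  rewrite /Ef (gRd0 hap ham htau haptau hamtau hd) /gR gv -cexp_real -cexpD; congr cexp.
  by apply: complexP; rewrite expr2 div4C !ReImE /=; ring.
have E2 : E (0 +i* - d) = (expR v)%:C * k.
  have hd : `|Im (0 +i* - d)| < a by rewrite /= normrN; exact: absd_lt.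
  rewrite /Ef (gRd0 hap ham htau haptau hamtau hd) /gR.
  have -> : (0 +i* - d : R[i]) = - (0 +i* d) by apply: complexP; rewrite !ReImE /= ?oppr0.
  rewrite gN gv -cexp_real -cexpD; congr cexp.
  by apply: complexP; rewrite expr2 div4C !ReImE /=; ring.
rewrite E1 mulrA; congr (_ * _); have := Ef_boundary0_swap; rewrite E1 E2 !mulrA => /mulIf.
move=> /(_ (cexp_neq0 _)); rewrite -!rmorphM => /complexI; rewrite expRN => H.
congr (_%:C); have p0 : 0 < ap * (expR v)^-1 by rewrite mulr_gt0 ?invr_gt0 ?expR_gt0.
rewrite -[LHS](gtr0_norm p0) -sqrtr_sqr expr2 {1}H; congr Num.sqrt.
by field; rewrite gt_eqF// expR_gt0.
Qed.

(** One step of the recursion that defines [G] leads from y + i a into the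
    strip. *)
Lemma GR_boundary y : GR ap am (y +i* a) = (1 - cexp (- (2 * pi / am * y)%:C)) * E (y +i* d).
Proof.
have pa0 : ap != 0 by rewrite gt_eqF.
have pm0 : am != 0 by rewrite gt_eqF.
set z := y +i* a; set w := y +i* d.
have zw : z - ap*i = w by apply: complexP; rewrite !ReImE /= /amean /d; field.
have hw : `|Im w| < a := absd_lt.
have za : a <= Im z by [].
rewrite /GR (G_up hap ham za) zw (G_strip hw) /Ef (gRd0 hap ham htau haptau hamtau hw) /gR.
rewrite /ccosh; set u := pi%:C * _ / _.
have uE : u = (pi / am * y)%:C + 'i * (pi / 2)%:C.
  by rewrite /u -fmorphV mulrC mulrA -rmorphM; apply: complexP; rewrite !ReImE /= /amean; field.
have -> : 'i * (chi ap am)%:C + 'i * (alpha ap am)%:C * z ^+ 2 / 4 =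
   'i * (chi ap am)%:C + 'i * (alpha ap am)%:C * w ^+ 2 / 4 - u.
  rewrite -addrA; congr (_ + _); rewrite uE !div4C !expr2 /alpha.
  by apply: complexP; rewrite !ReImE /= /amean /d; field; rewrite pa0 pm0.
have -> : 'i * (g ap am w + (chi ap am)%:C + (alpha ap am)%:C * w ^+ 2 / 4) =
   'i * g ap am w + ('i * (chi ap am)%:C + 'i * (alpha ap am)%:C * w ^+ 2 / 4) by ring.
rewrite cexpB [cexp ('i * g _ _ _ + _)]cexpD -cexpN.
have -> : 1 - cexp (- (2 * pi / am * y)%:C) = (cexp u + cexp (- u)) * cexp (- u).
  rewrite [RHS]mulrDl [cexp u * _]mulrC cexpNV -cexpD; congr (1 + _).
  have -> : - u + - u = - (2 * pi / am * y)%:C - 'i * pi%:C.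
    by rewrite uE; apply: complexP; rewrite !ReImE /=; field.
  by rewrite cexpB cexp_ipi invrN invr1 mulrN1.
by field.
Qed.

End BoundaryValue.

(** * Periodic holomorphic functions of small growth *)

Section PeriodicLiouville.
Context {R : realType}.
Implicit Types (x y : R) (z p : R[i]).
Local Notation mu := (@lebesgue_measure R).

Lemma cintble_cmeas (D : set (measurableTypeR R)) (f : R -> R[i]) : cintble D f -> cmeas D f.
Proof. by move=> [/measurable_int/measurable_EFinP ? /measurable_int/measurable_EFinP ?]. Qed.

Lemma csinh_lin_sym : exists2 c : R, 0 < c & forall x y, `|y| <= pi / 2 ->
  c * normc (x +i* y) <= normc (csinh (x +i* y)).
Proof.
have [c c0 hc] := @csinh_lin R; exists c => // x y hy.
have E (u v : R) : 0 <= u -> 0 <= v -> u ^+ 2 = v ^+ 2 -> u = v.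
  by move=> u0 v0 /eqP; rewrite eqrXn2// => /eqP.
have [y0|y0] := leP 0 y.
  by apply: hc; rewrite y0 (le_trans (ler_norm _)).
have e1 : normc (x +i* y) = normc (x +i* - y).
  by apply: E; rewrite ?normc_ge0// !normc_sqr /= sqrrN.
have e2 : normc (csinh (x +i* y)) = normc (csinh (x +i* - y)).
  by apply: E; rewrite ?normc_ge0// !normc_csinh_sqr sinN sqrrN.
rewrite e1 e2; apply: hc; rewrite oppr_ge0 (ltW y0)/= (le_trans _ hy)//.
by rewrite -normrN ler_norm.
Qed.

Lemma reg_ccont (f : R[i] -> R[i]) (X1 X2 Y1 Y2 x y : R) : reg (box X1 X2 Y1 Y2) f ->
  box X1 X2 Y1 Y2 (x +i* y) ->
  ccont (fun t => f (x +i* t)) y /\ ccont (fun t => f (t +i* y)) x.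
Proof.
move=> [f' [hol _ _ _]] hb.
have E1 (t : R) : x%:C + t%:C * 'i = x +i* t by apply: complexP; rewrite !ReImE /=; ring.
have E2 (t : R) : (0 +i* y) + t%:C * 1 = t +i* y by apply: complexP; rewrite !ReImE /=; ring.
split.
  apply: (ccont_ext (c := fun t : R => f (x%:C + t%:C * 'i))); first by move=> t; rewrite E1.
  by apply: (cder_cont (hol_line hol _)); rewrite E1.
apply: (ccont_ext (c := fun t : R => f ((0 +i* y) + t%:C * 1))); first by move=> t; rewrite E2.
by apply: (cder_cont (hol_line hol _)); rewrite E2.
Qed.

Section Mean.
Variables (M : R[i] -> R[i]) (A B C kap : R).
Hypotheses (hA : 0 < A) (hB : A / 2 < B) (hkap0 : 0 <= kap) (hkap : kap < 2 * pi / A)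
  (hreg : forall X, reg (box (- X) X (- B) B) M)
  (hper : forall x, M (x +i* (A / 2)) = M (x +i* - (A / 2)))
  (hgrow : forall x y, `|y| <= A / 2 -> normc (M (x +i* y)) <= C * expR (kap * `|x|)).

Let k := 2 * pi / A.
Let D p := cexp (k%:C * p) - 1.
Let Q p := (M p - M 0) / D p.
Let A2 : 0 < A / 2. Proof. by rewrite divr_gt0. Qed.
Let k0 : 0 < k. Proof. by rewrite divr_gt0// mulr_gt0// pi_gt0. Qed.
Let nA : - (A / 2) <= A / 2. Proof. by rewrite (le_trans (y := 0)) ?oppr_le0// ltW. Qed.

Let itv y : - (A / 2) <= y <= A / 2 -> `|y| <= A / 2.
Proof. by rewrite ler_norml. Qed.

Let V (f : R[i] -> R[i]) x := cintegral `[(- (A / 2)), (A / 2)] (fun y => f (x +i* y)).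

Let V_cst f (X1 X2 x1 x2 : R) : reg (box X1 X2 (- B) B) f ->
  (forall x, f (x +i* (A / 2)) = f (x +i* - (A / 2))) ->
  X1 < x1 -> x1 <= x2 -> x2 < X2 -> V f x1 = V f x2.
Proof.
move=> rf pf h1 h2 h3; have hb := hB; have hB' : - B < - (A / 2) by rewrite ltrN2.
have := cauchy_rect rf h1 h2 h3 hB' nA hb.
rewrite (eq_cintegral (g := fun x => f (x +i* - (A / 2)))) // subrr => /esym/eqP.
rewrite mulf_eq0 -normc_eq0 normci oner_eq0 /= subr_eq0 => /eqP H.
exact: esym H.
Qed.

Let DE x y : normc (cexp (k%:C * (x +i* y))) = expR (k * x).
Proof. by rewrite normc_cexp ReMr. Qed.

Let Dper x : D (x +i* (A / 2)) = D (x +i* - (A / 2)).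
Proof.
rewrite /D; have E s : k%:C * (x +i* (s * (A / 2))) = (k * x)%:C + s%:C * ('i * pi%:C).
  by apply: complexP; rewrite !ReImE /= /k; field; rewrite gt_eqF.
have := E 1; have := E (-1); rewrite rmorphN1 !mulN1r !mul1r => -> ->.
by rewrite !cexpD cexpN cexp_ipi invrN invr1.
Qed.

Let Qper x : Q (x +i* (A / 2)) = Q (x +i* - (A / 2)).
Proof. by rewrite /Q hper Dper. Qed.

Let Qreg (X1 X2 : R) : 0 < X1 \/ X2 < 0 -> reg (box X1 X2 (- B) B) Q.
Proof.
move=> hX; have rM : reg (box X1 X2 (- B) B) M.
  apply: reg_sub (hreg (`|X1| + `|X2|)) => z /andP[/andP[z1 z2] zi]; rewrite /box zi andbT.
  have := ler_norm X2; have := ler_norm (- X1); rewrite normrN => n1 n2.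
  have := normr_ge0 X1; have := normr_ge0 X2 => n3 n4.
  by apply/andP; split; lra.
have rD : reg (box X1 X2 (- B) B) D.
  by apply: regB; [apply: reg_exp; apply: regZ; apply: reg_id; exact: bnd_box|exact: reg_cst].
apply: regM; first by apply: regB => //; exact: reg_cst.
have ReE z : normc (cexp (k%:C * z)) = expR (k * Re z) by rewrite normc_cexp ReMr.
case: hX => hX.
  have e : 0 < expR (k * X1) - 1 by rewrite subr_gt0 expR_gt1 mulr_gt0.
  apply: regV e _ rD => z /andP[/andP[z1 z2] zi].
  rewrite (le_trans _ (lernormcB _ _))// ReE (normcr 1) normr1 lerD2r ler_expR ler_pM2l//.
  exact: ltW.
have e : 0 < 1 - expR (k * X2) by rewrite subr_gt0 expR_lt1 pmulr_rlt0.
apply: regV e _ rD => z /andP[/andP[z1 z2] zi].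
rewrite normc_distC (le_trans _ (lernormcB _ _))// ReE (normcr 1) normr1 lerD2l lerN2 ler_expR ler_pM2l//.
exact: ltW.
Qed.

Let C0 : 0 <= C.
Proof.
have := hgrow 0 (y := 0); rewrite normr0 mulr0 expR0 mulr1 => /(_ (ltW A2)).
exact/le_trans/normc_ge0.
Qed.

Let M_le x y : `|y| <= A / 2 -> normc (M (x +i* y) - M 0) <= 2 * C * expR (kap * `|x|).
Proof.
move=> hy; rewrite (le_trans (normcB _ _))// mulrDl mul1r mulrDl lerD//; first exact: hgrow.
rewrite (le_trans (hgrow 0 (y := 0) _)) ?normr0 ?(ltW A2)// mulr0 expR0.
by rewrite ler_wpM2l// -expR0 ler_expR mulr_ge0.
Qed.

Let c1 := (1 - expR (- k))^-1.
Let c10 : 0 < c1. Proof. by rewrite invr_gt0 subr_gt0 expR_lt1 oppr_lt0. Qed.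

(* Q tends to 0 at +oo, and to M 0 - M at -oo *)
Let right_le x y : 1 <= x -> `|y| <= A / 2 ->
  normc (Q (x +i* y)) <= 2 * C * c1 * expR (- ((k - kap) * x)).
Proof.
move=> x1 hy; have x0 : 0 <= x by rewrite (le_trans ler01).
have e1 : expR (k * x) * (1 - expR (- k)) <= normc (D (x +i* y)).
  rewrite (le_trans _ (lernormcB _ _))// DE (normcr 1) normr1 mulrBr mulr1 lerD2l lerN2.
  by rewrite -expRD -expR0 ler_expR subr_ge0 ler_peMr// ltW.
have p0 : 0 < expR (k * x) * (1 - expR (- k)).
  by rewrite mulr_gt0 ?expR_gt0// subr_gt0 expR_lt1 oppr_lt0.
rewrite Normc.normcM (le_trans (ler_pM (normc_ge0 _) (normc_ge0 _) (M_le x hy) (normc_inv_le p0 e1)))//.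
rewrite ger0_norm// invfM -expRN -/c1 (_ : - ((k - kap) * x) = kap * x + - (k * x)); last by ring.
by rewrite expRD le_eqVlt; apply/orP; left; apply/eqP; ring.
Qed.

Let left_le x y : x <= - 1 -> `|y| <= A / 2 ->
  normc (Q (x +i* y) + (M (x +i* y) - M 0)) <= 2 * C * c1 * expR ((k - kap) * x).
Proof.
move=> x1 hy; have x0 : x <= 0 by rewrite (le_trans x1)// oppr_le0.
have e1 : 1 - expR (- k) <= normc (D (x +i* y)).
  rewrite normc_distC (le_trans _ (lernormcB _ _))// DE (normcr 1) normr1 lerD2l lerN2 ler_expR.
  by rewrite -[leRHS]mulrN1 ler_pM2l.
have p0 : 0 < 1 - expR (- k) by rewrite subr_gt0 expR_lt1 oppr_lt0.
have D0 : D (x +i* y) != 0 by rewrite -normc_gt0 (lt_le_trans p0).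
have -> : Q (x +i* y) + (M (x +i* y) - M 0) =
    (M (x +i* y) - M 0) * (cexp (k%:C * (x +i* y)) * (D (x +i* y))^-1).
  rewrite /Q; have -> : cexp (k%:C * (x +i* y)) = D (x +i* y) + 1 by rewrite subrK.
  by move: D0; move: (D _) (M _) (M 0) => u v w u0; field.
rewrite !Normc.normcM DE.
rewrite (le_trans (ler_pM (normc_ge0 _) _ (M_le x hy) (ler_wpM2l (expR_ge0 _) (normc_inv_le p0 e1))))//.
  by rewrite mulr_ge0 ?expR_ge0 ?normc_ge0.
rewrite ler0_norm// -/c1 (_ : (k - kap) * x = kap * - x + k * x); last by ring.
by rewrite expRD le_eqVlt; apply/orP; left; apply/eqP; ring.
Qed.

Let kk : 0 < k - kap. Proof. by rewrite subr_gt0. Qed.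

Let M_box x y : `|y| <= A / 2 -> box (- (`|x| + 1)) (`|x| + 1) (- B) B (x +i* y).
Proof.
move=> hy; rewrite /box /= -ltr_norml ltrDl ltr01 /=.
by rewrite -ltr_norml (le_lt_trans hy).
Qed.

Let D_ge : exists2 c : R, 0 < c & forall x y, `|y| <= A / 2 ->
  c * expR (k / 2 * x) * normc (x +i* y) <= normc (D (x +i* y)).
Proof.
have [c c0 hc] := csinh_lin_sym; have k2 : 0 < k / 2 by rewrite divr_gt0.
exists (2 * c * (k / 2)); first by apply: mulr_gt0 k2; rewrite mulr_gt0.
move=> x y hy; pose w := (k / 2 * x) +i* (k / 2 * y).
have -> : D (x +i* y) = 2 * cexp w * csinh w.
  have wE : k%:C * (x +i* y) = w + w by apply: complexP; rewrite !ReImE /=; field.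
  have -> : D (x +i* y) = cexp w * cexp w - cexp (- w) * cexp w by rewrite /D wE cexpD cexpNV.
  rewrite /csinh.
  by move: (cexp w) (cexp (- w)) => u v; field.
rewrite [normc (_ * csinh w)]Normc.normcM [normc (2 * _)]Normc.normcM normc_nat normc_cexp [Re w]/=.
have h : c * normc w <= normc (csinh w).
  apply: hc; rewrite normrM gtr0_norm// (le_trans (ler_wpM2l (ltW k2) hy))//.
  by rewrite le_eqVlt; apply/orP; left; apply/eqP; rewrite /k; field; rewrite gt_eqF.
have -> : 2 * c * (k / 2) * expR (k / 2 * x) * normc (x +i* y) = 2 * expR (k / 2 * x) * (c * normc w).
  have -> : w = (k / 2)%:C * (x +i* y) by apply: complexP; rewrite !ReImE /=; ring.
  by rewrite [normc (_%:C * _)]Normc.normcM normcr gtr0_norm//; ring.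
exact: ler_wpM2l (mulr_ge0 (ler0n _ _) (expR_ge0 _)) _ _ h.
Qed.

Let Q_vert x y : x != 0 \/ y != 0 -> `|y| <= A / 2 -> ccont (fun t => Q (x +i* t)) y /\
  ccont (fun t => Q (t +i* y)) x.
Proof.
move=> hxy hy; have [c c0 hc] := D_ge.
have z0 : 0 < normc (x +i* y).
  rewrite normc_gt0 eq_complex /= negb_and; case: hxy => ->//.
  by rewrite orbT.
have D0 : D (x +i* y) != 0.
  by rewrite -normc_gt0 (lt_le_trans _ (hc x y hy))// !mulr_gt0 ?expR_gt0.
have [m1 m2] := reg_ccont (hreg (`|x| + 1)) (M_box x hy).
split.
  apply: ccontM; first by apply: ccontB => //; exact: ccont_cst.
  apply: ccontV => //; apply: ccontB; last exact: ccont_cst.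
  by apply: ccont_exp; apply: ccontZ; exact: ccont_vert.
apply: ccontM; first by apply: ccontB => //; exact: ccont_cst.
apply: ccontV => //; apply: ccontB; last exact: ccont_cst.
by apply: ccont_exp; apply: ccontZ; exact: ccont_hor.
Qed.

Let VQ_cst x1 x2 : x1 <= x2 -> 0 < x1 \/ x2 < 0 -> V Q x1 = V Q x2.
Proof.
move=> h12 [h|h].
  apply: (@V_cst Q (x1 / 2) (x2 + 1)) => //; [by apply: Qreg; left; rewrite divr_gt0|lra|lra].
apply: (@V_cst Q (x1 - 1) (x2 / 2)) => //; [by apply: Qreg; right; lra|lra|lra].
Qed.

Let VQ_right : V Q 1 = 0.
Proof.
have [C1 [C10 hC1]] := lor_exp kk.
apply/eqP; rewrite -normc_eq0 eq_le normc_ge0 andbT.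
apply: (@le0_lor _ _ (2 * (2 * C * c1 * C1 * A))) => n.
have n1 : 1 <= n.+1%:R :> R by rewrite ler1n.
have n0 : 0 < n.+1%:R :> R by rewrite (lt_le_trans ltr01).
rewrite (@VQ_cst 1 n.+1%:R)//; last by left.
rewrite (le_trans (cintegral_itv_le (B := 2 * C * c1 * (C1 * lor n%:R)) nA _ _))//.
- by move=> y /itv hy; have [] := @Q_vert n.+1%:R y _ hy; [left; rewrite gt_eqF|].
- move=> y /itv hy; rewrite (le_trans (right_le n1 hy))// ler_wpM2l ?mulr_ge0 ?(ltW c10)//.
  rewrite (le_trans _ (hC1 _))// ler_expR lerN2 ler_pM2l//.
  by rewrite ger0_norm// ler_nat.
- by rewrite le_eqVlt; apply/orP; left; apply/eqP; field.
Qed.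

Let VQ_left : V Q (- 1) = A%:C * M 0 - V M 0.
Proof.
have [C1 [C10 hC1]] := lor_exp kk.
apply/eqP; rewrite -subr_eq0 -normc_eq0 eq_le normc_ge0 andbT.
apply: (@le0_lor _ _ (2 * (2 * C * c1 * C1 * A))) => n.
have n1 : 1 <= n.+1%:R :> R by rewrite ler1n.
have n0 : 0 < n.+1%:R :> R by rewrite (lt_le_trans ltr01).
have n1' : - n.+1%:R <= - 1 :> R by rewrite lerN2.
have n0' : - n.+1%:R < 0 :> R by rewrite oppr_lt0.
rewrite -(@VQ_cst (- n.+1%:R) (- 1))//; last by right; rewrite oppr_lt0.
rewrite -(@V_cst M (- (n.+1%:R + 1)) (n.+1%:R + 1) (- n.+1%:R) 0)//; last by rewrite ltrN2 ltrDl.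
set x := - n.+1%:R.
have cM y : - (A / 2) <= y <= A / 2 -> ccont (fun y => M (x +i* y)) y.
  by move=> /itv hy; have [] := reg_ccont (hreg (`|x| + 1)) (M_box x hy).
have cQ y : - (A / 2) <= y <= A / 2 -> ccont (fun y => Q (x +i* y)) y.
  by move=> /itv hy; have [] := @Q_vert x y _ hy; [left; rewrite lt_eqF|].
have cc y : - (A / 2) <= y <= A / 2 -> ccont (fun=> M 0) y by move=> _; exact: ccont_cst.
have -> : A%:C * M 0 = cintegral `[(- (A / 2)), (A / 2)] (fun=> M 0).
  rewrite (@cintegral_ftc _ (fun u => M 0 * u%:C) (fun=> M 0))//.
    by rewrite -mulrBr -rmorphB /= opprK mulrC -splitr.
  by move=> u _; apply: cder_eq (cderZ _ (cder_real u)) _; rewrite mulr1.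
have mI : measurable (`[(- (A / 2)), (A / 2)] : set (measurableTypeR R)) by [].
have iM := ccont_itv_cintble cM; have iQ := ccont_itv_cintble cQ; have ic := ccont_itv_cintble cc.
rewrite /V opprB addrA.
rewrite -(cintegralD mI iQ iM) -(cintegralB mI (cintbleD mI iQ iM) ic).
rewrite (le_trans (cintegral_itv_le (B := 2 * C * c1 * (C1 * lor n%:R)) nA _ _))//.
- by move=> y hy; apply: ccontB; [apply: ccontD; [exact: cQ|exact: cM]|exact: cc].
- move=> y /itv hy; rewrite -addrA (le_trans (left_le n1' hy))// ler_wpM2l ?mulr_ge0 ?(ltW c10)//.
  rewrite (le_trans _ (hC1 _))// mulrN ler_expR lerN2 ler_pM2l//.
  by rewrite ger0_norm// ler_nat.
- by rewrite le_eqVlt; apply/orP; left; apply/eqP; field.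
Qed.

(* the means of Q on both sides of Re = 0 agree because Q is bounded near its
   removable singularity *)
Let VQ_cross : V Q 1 = V Q (- 1).
Proof.
have [Kq Kq0 hKq] : exists2 K : R, 0 <= K & forall x y, `|x| <= 1 -> `|y| <= A / 2 ->
    (x != 0 \/ y != 0) -> normc (Q (x +i* y)) <= K.
  have [c c0 hc] := D_ge; have [M' [hol _ bM' _]] := hreg 2.
  have [B' [B'0 hB']] := bnd_ge0 bM'.
  have cp : 0 < c * expR (- (k / 2)) by rewrite mulr_gt0 ?expR_gt0.
  exists (2 * B' * (c * expR (- (k / 2)))^-1).
    by rewrite !mulr_ge0// invr_ge0 ltW.
  move=> x y hx hy hxy; set z := x +i* y.
  have z0 : 0 < normc z.
    rewrite normc_gt0 eq_complex /= negb_and; case: hxy => ->//.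
    by rewrite orbT.
  have bz u : 0 <= u <= 1 -> box (- 2) 2 (- B) B (0 + u%:C * z).
    move=> /andP[u0 u1]; rewrite add0r /box ReMr ImMr /= -!ltr_norml !normrM (ger0_norm u0).
    apply/andP; split; first by rewrite (le_lt_trans (ler_pM u0 _ u1 hx))// mulr1 ltr1n.
    by rewrite (le_lt_trans (ler_pM u0 _ u1 hy))// mul1r.
  have m : normc (M z - M 0) <= 2 * (normc z * B') * (1 - 0).
    have := @cder_mvt _ (fun u : R => M (0 + u%:C * z)) (fun u => z * M' (0 + u%:C * z)) 0 1
      (normc z * B') ler01; rewrite !add0r mul1r mul0r; apply.
      by move=> u hu; have := hol_line hol (bz u hu); under eq_fun do rewrite add0r.
    by move=> u hu; rewrite Normc.normcM ler_wpM2l ?normc_ge0// hB'//; have := bz u hu; rewrite add0r.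
  have d : c * expR (- (k / 2)) * normc z <= normc (D z).
    rewrite (le_trans _ (hc x y hy))// ler_wpM2r ?normc_ge0// ler_wpM2l ?(ltW c0)// ler_expR.
    have k20 : 0 <= k / 2 := divr_ge0 (ltW k0) (ler0n _ _).
    rewrite -[leLHS]mulrN1; apply: (ler_wpM2l k20).
    by rewrite lerNl (le_trans (ler_norm _))// normrN.
  rewrite Normc.normcM (le_trans (ler_pM (normc_ge0 _) (normc_ge0 _) m (normc_inv_le _ d)))//.
    by rewrite mulr_gt0.
  rewrite subr0 mulr1 invfM le_eqVlt; apply/orP; left; apply/eqP.
  by field; rewrite (gt_eqF z0) (gt_eqF c0) gt_eqF ?expR_gt0.
have V1 (n : nat) : V Q 1 = V Q (1 / n.+1%:R).
  apply/esym/VQ_cst; first by rewrite ler_pdivrMr// mul1r ler1n.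
  by left; rewrite divr_gt0.
have V2 (n : nat) : V Q (- 1) = V Q (- 1 / n.+1%:R).
  apply: VQ_cst; first by rewrite mulNr lerN2 ler_pdivrMr// mul1r ler1n.
  by right; rewrite mulNr oppr_lt0 divr_gt0.
pose I : set (measurableTypeR R) := `[(- (A / 2)), (A / 2)]%classic.
have mI : measurable I := measurable_itv _.
have small (s : R) (n : nat) : `|s| = 1 -> `|s / n.+1%:R| <= 1 /\ s / n.+1%:R != 0.
  move=> s1; split.
    by rewrite normrM s1 mul1r normfV ger0_norm// invf_le1// ler1n.
  by rewrite mulf_neq0 ?invr_eq0 ?pnatr_eq0// -normr_eq0 s1 oner_eq0.
have s1 : `|1 : R| = 1 by rewrite normr1.
have sN1 : `|- 1 : R| = 1 by rewrite normrN1.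
have iQ (s : R) (n : nat) : `|s| = 1 -> cintble I (fun y => Q ((s / n.+1%:R) +i* y)).
  move=> hs; have [h1 h2] := small s n hs; apply: ccont_itv_cintble => y /itv hy.
  by have [] := @Q_vert (s / n.+1%:R) y _ hy; [left|].
have h0 : normc (cintegral I (fun y => Q ((1 / n.+1%:R) +i* y) - Q ((- 1 / n.+1%:R) +i* y)) -
    cintegral I (fun=> 0)) @[n --> \oo] --> 0.
  apply: (@cintegral_dct _ I _ _ (fun=> 2 * Kq) 0) => //.
  - move=> n; apply: cmeasB; apply: cintble_cmeas; exact: iQ.
  - apply: continuous_compact_integrable; first exact: segment_compact.
    by move=> x; exact: cvg_cst.
  - move=> n y hy; have {}hy : `|y| <= A / 2 by apply: itv; move: hy; rewrite /I /= in_itv.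
    have [a1 a2] := small 1 n s1; have [b1 b2] := small (- 1) n sN1.
    rewrite (le_trans (normcB _ _))// mulr_natl mulr2n lerD// hKq//; by left.
  - move=> y hy y0; have {}hy : `|y| <= A / 2 by apply: itv; move: hy; rewrite /I /= in_itv.
    have [_ q] := @Q_vert 0 y (or_intror y0) hy.
    have q1 := ccont_seq 1 q; have q2 := ccont_seq (- 1) q.
    apply: (squeeze_cvgr _ (cvg_cst (0 : R))); last first.
      by rewrite -[X in _ --> X](addr0 (0:R)); exact: cvgD q1 q2.
    apply: nearW => n; rewrite normc_ge0 /= subr0.
    rewrite (_ : Q _ - Q _ = (Q ((1 / n.+1%:R) +i* y) - Q (0 +i* y)) -
      (Q ((- 1 / n.+1%:R) +i* y) - Q (0 +i* y))); last by ring.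
    exact: normcB.
have : normc (V Q 1 - V Q (- 1)) <= 0.
  apply: (le0_of_cvg0 _ h0) => n.
  rewrite (cintegralB mI (iQ 1 n s1) (iQ (- 1) n sN1)) {1}(V1 n) {1}(V2 n) /V.
  have -> : cintegral I (fun=> 0 : R[i]) = 0.
    rewrite -[RHS](mul0r (cintegral I (fun=> 0))) -cintegralZ//.
      by apply: eq_cintegral => x _; rewrite mul0r.
    by apply: ccont_itv_cintble => y _; exact: ccont_cst.
  by rewrite subr0.
by move=> h; apply/eqP; rewrite -subr_eq0 -normc_eq0 eq_le h normc_ge0.
Qed.

Lemma periodic_mean : A%:C * M 0 = V M 0.
Proof. by apply/eqP; rewrite -subr_eq0 -VQ_left -VQ_cross VQ_right. Qed.

End Mean.

(** A holomorphic function of imaginary period [A] growing more slowly than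
    [exp (2 pi |Re p| / A)] is constant: the difference quotient
    (M p - M p0) / (exp (2 pi (p - p0) / A) - 1) is holomorphic and periodic, so
    its mean over a period does not depend on [Re p]; it vanishes at +oo, and
    the limit at -oo expresses [M p0] by the mean of [M]. *)
Lemma periodic_const (M : R[i] -> R[i]) (A B C kap : R) (p : R) : 0 < A -> A / 2 < B -> 0 <= kap ->
  kap < 2 * pi / A -> (forall X, reg (box (- X) X (- B) B) M) ->
  (forall x, M (x +i* (A / 2)) = M (x +i* - (A / 2))) ->
  (forall x y, `|y| <= A / 2 -> normc (M (x +i* y)) <= C * expR (kap * `|x|)) ->
  M p%:C = M 0.
Proof.
move=> A0 hB k0 k1 rM pM gM; pose N (z : R[i]) := M (1 * z + p%:C).
have NE x y : N (x +i* y) = M ((x + p) +i* y).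
  by rewrite /N; congr M; apply: complexP; rewrite mul1r !ReImE /= ?addr0.
have rN X : reg (box (- X) X (- B) B) N.
  apply: reg_affine (rM (X + `|p|)) _ => z /andP[/andP[z1 z2] zi].
  rewrite /box mul1r ReD ImD /= addr0 zi andbT.
  have := ler_norm p; have := ler_norm (- p); rewrite normrN => n1 n2.
  by apply/andP; split; lra.
have pN x : N (x +i* (A / 2)) = N (x +i* - (A / 2)) by rewrite !NE pM.
have C0 : 0 <= C.
  have := gM 0 0; rewrite !normr0 mulr0 expR0 mulr1 => /(_ (divr_ge0 (ltW A0) (ler0n _ _))).
  exact/le_trans/normc_ge0.
have gN x y : `|y| <= A / 2 -> normc (N (x +i* y)) <= C * expR (kap * `|p|) * expR (kap * `|x|).
  move=> hy; rewrite NE (le_trans (gM _ _ hy))// -mulrA -expRD ler_wpM2l// ler_expR -mulrDr.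
  by rewrite ler_wpM2l// addrC ler_normD.
have h1 := periodic_mean A0 hB k0 k1 rM pM gM.
have h2 := periodic_mean A0 hB k0 k1 rN pN gN.
have A0' : A%:C != 0 :> R[i] by rewrite fmorph_eq0 gt_eqF.
apply: (mulfI A0'); rewrite h1; have -> : M p%:C = N 0 by rewrite /N mulr0 add0r.
rewrite h2 (eq_cintegral (g := fun y => M (p +i* y))); last by move=> y _; rewrite NE add0r.
have hA : 0 < A / 2 by rewrite divr_gt0.
have nA : - (A / 2) <= A / 2 by rewrite (le_trans (y := 0)) ?oppr_le0// ltW.
have nB : - B < - (A / 2) by rewrite ltrN2.
have V_cst x1 x2 : x1 <= x2 -> cintegral `[(- (A / 2)), (A / 2)] (fun y => M (x1 +i* y)) =
    cintegral `[(- (A / 2)), (A / 2)] (fun y => M (x2 +i* y)).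
  move=> h12; set X := `|x1| + `|x2| + 1.
  have := ler_norm x2; have := ler_norm (- x1); rewrite normrN => n1 n2.
  have e1 : - X < x1 by rewrite /X; have := normr_ge0 x2; lra.
  have e2 : x2 < X by rewrite /X; have := normr_ge0 x1; lra.
  have := cauchy_rect (rM X) e1 h12 e2 nB nA hB.
  rewrite (eq_cintegral (g := fun x => M (x +i* - (A / 2)))) // subrr => /esym/eqP.
  by rewrite mulf_eq0 -normc_eq0 normci oner_eq0 /= subr_eq0 => /eqP.
by case: (leP p 0) => [/V_cst|/ltW/V_cst].
Qed.

End PeriodicLiouville.

(** * Contour shifts on half-lines *)

Section HalfLines.
Context {R : realType}.
Implicit Types (f : R -> R[i]) (x y : R).
Local Notation mu := (@lebesgue_measure R).

Lemma eq_Cint_off f h (x0 : R) : Cdom f -> Cdom h -> (forall x, x != x0 -> f x = h x) ->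
  Cint f = Cint h.
Proof.
move=> fd hd fh; have [K [K0 hK]] := Cdom_ge0 (CdomB fd hd).
have : normc (Cint (fun=> 0) - Cint (fun x => f x - h x)) <= 0.
  apply: (@le0_of_cvg0 _ _ (fun=> normc (cintegral setT (fun=> 0) - cintegral setT (fun x => f x - h x)))) => //.
  apply: (@cintegral_dct _ setT (fun _ _ => 0) _ (fun x => K * lor x) x0) => //.
  - by have [] := CdomB fd hd.
  - exact: lorZ_integrable.
  - by move=> _ x _; rewrite normc0' mulr_ge0 ?lor_ge0.
  - by move=> x _ xx0; rewrite fh// subrr subrr normc0'; exact: cvg_cst.
rewrite (CintB fd hd) (_ : Cint (fun=> 0) = 0) ?sub0r ?normcN; last first.
  by rewrite -[RHS](mul0r (Cint f)) -(CintZ 0 fd); apply: eq_Cint => x; rewrite mul0r.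
by move=> h0; apply/eqP; rewrite -subr_eq0 -normc_eq0 eq_le h0 normc_ge0.
Qed.

Lemma Cint_lim_if f (p : R -> bool) (u v : nat -> R) : Cdom (fun x => if p x then f x else 0) ->
  (forall n x, (u n <= x <= v n) = (- n%:R <= x <= n%:R) && p x) ->
  normc (cintegral `[(u n), (v n)] f - Cint (fun x => if p x then f x else 0)) @[n --> \oo] --> 0.
Proof.
move=> fd uv; set J := Cint _.
have E n : cintegral `[(u n), (v n)] f = cintegral `[(- n%:R), n%:R] (fun x => if p x then f x else 0).
  apply: complexP => /=; rewrite Rintegral_mkcond [RHS]Rintegral_mkcond;
  apply: eq_Rintegral => x _; rewrite !patchE !mem_setE !in_itv/= uv;
  by case: (- n%:R <= x <= n%:R) => //=; case: (p x).
by under eq_fun do rewrite E; exact: Cint_lim.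
Qed.

Lemma Cint_itv f (u v : R) :
  Cint (fun x => if u <= x <= v then f x else 0) = cintegral `[u, v] f.
Proof.
by apply: complexP => /=; rewrite [RHS]Rintegral_mkcond; apply: eq_Rintegral => x _;
  rewrite patchE mem_setE in_itv/=; case: ifP.
Qed.

Let zero_sum (a : R[i]) (u : nat -> R) : (forall n, normc a <= u n) -> u n @[n --> \oo] --> 0 -> a = 0.
Proof.
move=> h hu; apply/eqP; rewrite -normc_eq0 eq_le normc_ge0 andbT; exact: le0_of_cvg0 hu.
Qed.

Section Shift.
Variables (f : R[i] -> R[i]) (Y1 Y2 y1 y2 K : R).
Hypotheses (h1 : Y1 < y1) (h12 : y1 <= y2) (h2 : y2 < Y2)
  (hreg : forall X, reg (box (- X) X Y1 Y2) f).

Let fc x y : y1 <= y <= y2 -> ccont (fun t => f (x +i* t)) y /\ ccont (fun t => f (t +i* y)) x.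
Proof.
move=> /andP[a b]; apply: (reg_ccont (hreg (`|x| + 1))).
by rewrite /box /= -ltr_norml ltrDl ltr01 (lt_le_trans h1 a) (le_lt_trans b h2).
Qed.

Let I y (a b : R) := cintegral `[a, b] (fun x => f (x +i* y)).
Let V x := cintegral `[y1, y2] (fun y => f (x +i* y)).

Let rect (a b : R) : a <= b -> I y2 a b - I y1 a b = 'i * (V b - V a).
Proof.
move=> ab; set X := `|a| + `|b| + 1.
have := ler_norm b; have := ler_norm (- a); rewrite normrN => n1 n2.
have e1 : - X < a by rewrite /X; have := normr_ge0 b; lra.
have e2 : b < X by rewrite /X; have := normr_ge0 a; lra.
exact: (cauchy_rect (hreg X) e1 ab e2 h1 h12 h2).
Qed.

Let yy1 : y1 <= y1 <= y2. Proof. by rewrite lexx. Qed.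
Let yy2 : y1 <= y2 <= y2. Proof. by rewrite lexx h12. Qed.

Let V_le x (n : nat) : (forall y, y1 <= y <= y2 -> normc (f (x +i* y)) <= K * lor x) ->
  lor x = lor n%:R -> normc (V x) <= 2 * (K * (y2 - y1)) * lor n%:R.
Proof.
move=> fK xn; rewrite (le_trans (cintegral_itv_le h12 _ fK))//.
  by move=> y hy; have [] := fc x hy.
by rewrite xn le_eqVlt; apply/orP; left; apply/eqP; ring.
Qed.

Let lim (p : R -> bool) (u v : nat -> R) (b : nat -> R) (W : R[i]) :
  measurable_fun (setT : set (measurableTypeR R)) (p : measurableTypeR R -> bool) ->
  (forall x y, y1 <= y <= y2 -> p x -> normc (f (x +i* y)) <= K * lor x) ->
  (forall n x, (u n <= x <= v n) = (- n%:R <= x <= n%:R) && p x) ->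
  (forall n, normc (I y2 (u n) (v n) - I y1 (u n) (v n) - W) <= 2 * (K * (y2 - y1)) * lor n%:R) ->
  [/\ Cdom (fun x => if p x then f (x +i* y1) else 0),
      Cdom (fun x => if p x then f (x +i* y2) else 0) &
  Cint (fun x => if p x then f (x +i* y2) else 0) -
  Cint (fun x => if p x then f (x +i* y1) else 0) = W].
Proof.
move=> mp fK uv hW.
have d y : y1 <= y <= y2 -> Cdom (fun x => if p x then f (x +i* y) else 0).
  move=> hy; split.
    have mf : cmeas (setT : set (measurableTypeR R)) (fun x => f (x +i* y)).
      by apply: ccont_cmeas => // x; have [] := fc x hy.
    exact: (@cmeas_if _ setT _ (fun=> 0) _ measurableT mp mf (cmeas_cst _ 0)).
  exists `|K| => x; case: ifP => px; last by rewrite normc0' mulr_ge0 ?lor_ge0.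
  by rewrite (le_trans (fK x y hy px))// ler_wpM2r ?lor_ge0 ?ler_norm.
have d1 := d _ yy1; have d2 := d _ yy2; split=> //.
apply/eqP; rewrite -subr_eq0; apply/eqP.
have l1 := Cint_lim_if d1 uv; have l2 := Cint_lim_if d2 uv.
move: l1 l2; set J1 := Cint _; set J2 := Cint _ => l1 l2.
apply: (@zero_sum _ (fun n => normc (I y2 (u n) (v n) - J2) + normc (I y1 (u n) (v n) - J1) +
  2 * (K * (y2 - y1)) * lor n%:R)) => [n|].
  rewrite (_ : J2 - J1 - W = - (I y2 (u n) (v n) - J2) + (I y1 (u n) (v n) - J1) +
    (I y2 (u n) (v n) - I y1 (u n) (v n) - W)); last by ring.
  rewrite (le_trans (le_normcD _ _))// lerD//.
  by rewrite (le_trans (le_normcD _ _))// normcN.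
rewrite -[X in _ --> X](addr0 (0:R)); apply: cvgD.
  by rewrite -[X in _ --> X](addr0 (0:R)); apply: cvgD.
rewrite -[X in _ --> X](mulr0 (2 * (K * (y2 - y1)))); apply: cvgM; first exact: cvg_cst.
exact: lor_nat0.
Qed.

(** The remaining side of the rectangle lies on the imaginary axis. *)
Lemma half_shift_right :
  (forall x y, y1 <= y <= y2 -> 0 <= x -> normc (f (x +i* y)) <= K * lor x) ->
  [/\ Cdom (fun x => if 0 <= x then f (x +i* y1) else 0),
      Cdom (fun x => if 0 <= x then f (x +i* y2) else 0) &
  Cint (fun x => if 0 <= x then f (x +i* y2) else 0) -
  Cint (fun x => if 0 <= x then f (x +i* y1) else 0) = - ('i * V 0)].
Proof.
move=> fK; apply: (@lim (fun x => 0 <= x) (fun=> 0) (fun n => n%:R)) => //.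
- exact: measurable_fun_ler.
- move=> n x; have [x0|x0] := leP 0 x; rewrite ?andbT ?andbF//=.
  by rewrite (le_trans _ x0)// oppr_le0.
- move=> n; rewrite rect// mulrBr opprK subrK Normc.normcM normci mul1r.
  by apply: V_le => // y hy; exact: fK.
Qed.

Lemma half_shift_left :
  (forall x y, y1 <= y <= y2 -> x <= 0 -> normc (f (x +i* y)) <= K * lor x) ->
  [/\ Cdom (fun x => if x <= 0 then f (x +i* y1) else 0),
      Cdom (fun x => if x <= 0 then f (x +i* y2) else 0) &
  Cint (fun x => if x <= 0 then f (x +i* y2) else 0) -
  Cint (fun x => if x <= 0 then f (x +i* y1) else 0) = 'i * V 0].
Proof.
move=> fK; apply: (@lim (fun x => x <= 0) (fun n => - n%:R) (fun=> 0)) => //.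
- exact: measurable_fun_ler.
- move=> n x; have [x0|x0] := leP x 0; rewrite ?andbT ?andbF//=.
  by rewrite (le_trans x0)// andbT.
- move=> n; rewrite rect ?oppr_le0// mulrBr addrAC subrr sub0r normcN Normc.normcM normci mul1r.
  by apply: V_le; [move=> y hy; apply: fK; rewrite ?oppr_le0|rewrite lorN].
Qed.

End Shift.

Lemma Cint_half_exp (m k : R[i]) : Re m < 0 ->
  Cdom (fun x => if 0 <= x then cexp (m * x%:C + k) else 0) /\
  Cint (fun x => if 0 <= x then cexp (m * x%:C + k) else 0) = - (cexp k / m).
Proof.
move=> m0; have m0' : m != 0 by apply/eqP => mz; rewrite mz ltxx in m0.
have nm : 0 < - Re m by rewrite oppr_gt0.
have [C [C0 hC]] := lor_exp nm.
have le x : 0 <= x -> normc (cexp (m * x%:C + k)) <= expR (Re k) * C * lor x.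
  move=> x0; rewrite normc_cexp ReD [m * _]mulrC ReMr addrC expRD -mulrA ler_wpM2l ?expR_ge0//.
  rewrite (le_trans _ (hC x))// ler_expR ger0_norm// mulNr opprK.
  by rewrite mulrC.
have dm x : cder (fun x => m * x%:C + k) x m.
  by apply: cder_eq (cderD (cderZ m (cder_real x)) (cder_cst k x)) _; rewrite mulr1 addr0.
have cc x : ccont (fun x => cexp (m * x%:C + k)) x by apply: ccont_exp; exact: cder_cont (dm x).
have d : Cdom (fun x => if 0 <= x then cexp (m * x%:C + k) else 0).
  split.
    have mp : measurable_fun (setT : set (measurableTypeR R)) (fun x : R => 0 <= x).
      exact: measurable_fun_ler.
    have mf : cmeas (setT : set (measurableTypeR R)) (fun x => cexp (m * x%:C + k)).
      exact: ccont_cmeas.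
    exact: (@cmeas_if _ setT _ (fun=> 0) _ measurableT mp mf (cmeas_cst _ 0)).
  exists (expR (Re k) * C) => x; case: ifP => px; first exact: le.
  by rewrite normc0' !mulr_ge0 ?lor_ge0 ?expR_ge0.
split=> //; have l := @Cint_lim_if _ (fun x => 0 <= x) (fun=> 0) (fun n => n%:R) d.
have {}l := l _; move: l; set J := Cint _ => l.
apply/eqP; rewrite -subr_eq0; apply/eqP.
apply: (@zero_sum _ (fun n => normc (cintegral `[0, n%:R] (fun x => cexp (m * x%:C + k)) - J) +
   normc m^-1 * (expR (Re k) * C) * lor n%:R)) => [n|].
  rewrite (@cintegral_ftc _ (fun x => m^-1 * cexp (m * x%:C + k)))//; last first.
    by move=> u _; apply: cder_eq (cderZ m^-1 (cder_exp (dm u))) _; rewrite mulrA mulVf ?mul1r.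
  rewrite rmorph0 mulr0 add0r; set e1 := cexp (_ + k).
  rewrite (_ : J - - (cexp k / m) = - (m^-1 * e1 - m^-1 * cexp k - J) + m^-1 * e1); last by ring.
  rewrite (le_trans (le_normcD _ _))// normcN lerD2l Normc.normcM -mulrA ler_wpM2l ?normc_ge0//.
  exact: le.
rewrite -[X in _ --> X](addr0 (0:R)); apply: cvgD.
  apply: l => n x; have [x0|x0] := leP 0 x; rewrite ?andbT ?andbF//=.
  by rewrite (le_trans _ x0)// oppr_le0.
rewrite -[X in _ --> X](mulr0 (normc m^-1 * (expR (Re k) * C))); apply: cvgM; first exact: cvg_cst.
exact: lor_nat0.
Qed.

End HalfLines.

(** * The Fourier transform of exp (i gR) *)

Section FourierTransform.
Context {R : realType}.
Implicit Types (x y c b delta X : R) (z p w : R[i]).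

(* The properties of exp (i gR) from which its transform is computed: the
   behaviour at both ends of the strip and the difference equation. A is the
   smaller period. The transform along the line Im = c converges for
   c < Im p < 3 / 4 A, which leaves room around the strip |Im p| <= A / 2. *)
Variables (E : R[i] -> R[i]) (A am al : R).
Local Notation a := (amean A am).
Hypotheses (hA : 0 < A) (hAm : A <= am) (hal : al * (A * am) = 2 * pi)
  (Ereg : forall X1 X2 b, b < a -> reg (box X1 X2 (- b) b) E)
  (Enear1 : forall b, b < a -> exists2 K : R, 0 <= K & forall z, `|Im z| <= b -> 0 <= Re z ->
     normc (E z - 1) <= K * expR (- (al * (3 / 4 * A) * Re z)))
  (Eneg : forall b, b < a -> exists2 K : R, 0 <= K & forall z, `|Im z| <= b -> Re z <= 0 ->
     normc (E z) <= K * expR (- (al * Re z * Im z)))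
  (Ediff : forall z, 2 * `|Im z| < am -> E (z + 'i * (A / 2)%:C) =
     (1 + cexp (- ((al * A)%:C * z))) * E (z - 'i * (A / 2)%:C)).

Let am0 : 0 < am. Proof. exact: lt_le_trans hAm. Qed.
Let al0 : 0 < al.
Proof.
have h : 0 < A * am by rewrite mulr_gt0.
by rewrite -(pmulr_lgt0 _ h) hal mulr_gt0// pi_gt0.
Qed.

Let m c x : R[i] := - ('i * al%:C * (x +i* c)).
Let w c x : R[i] := E (x +i* c) - (if 0 <= x then 1 else 0).

(** The Fourier transform of [E] along the line Im = c; the transform of the
    step function that is subtracted for convergence is restored explicitly. *)
Definition FTreg c p := Lap (w c) (m c) 0 p.
Definition FTE c p := FTreg c p + cexp ((al * c)%:C * p) / ('i * al%:C * p).

Let Re_mp c x p : Re (m c x * p) = al * c * Re p + al * x * Im p.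
Proof. by rewrite /m !ReImE /=; ring. Qed.

Let right_bound b delta : b < a -> exists2 K : R, 0 <= K & forall c p x, `|c| <= b ->
  Im p <= 3 / 4 * A - delta -> 0 <= x ->
  normc (E (x +i* c) - 1) * expR (al * x * Im p) <= K * expR (- (al * delta * `|x|)).
Proof.
move=> ba; have [K K0 hK] := Enear1 ba; exists K => // c p x hc hp x0.
rewrite (le_trans (ler_wpM2r (expR_ge0 _) (hK (x +i* c) hc x0)))//= -[leLHS]mulrA -expRD.
rewrite ler_wpM2l// ler_expR ger0_norm//.
have : 0 <= al * x * (3 / 4 * A - delta - Im p) by rewrite !mulr_ge0 ?(ltW al0)// subr_ge0.
lra.
Qed.

Let left_bound b delta : b < a -> exists2 K : R, 0 <= K & forall c p x, `|c| <= b ->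
  c + delta <= Im p -> x <= 0 ->
  normc (E (x +i* c)) * expR (al * x * Im p) <= K * expR (- (al * delta * `|x|)).
Proof.
move=> ba; have [K K0 hK] := Eneg ba; exists K => // c p x hc hp x0.
rewrite (le_trans (ler_wpM2r (expR_ge0 _) (hK (x +i* c) hc x0)))//= -[leLHS]mulrA -expRD.
rewrite ler_wpM2l// ler_expR ler0_norm//.
have : 0 <= al * - x * (Im p - (c + delta)) by rewrite !mulr_ge0 ?(ltW al0) ?oppr_ge0// subr_ge0.
lra.
Qed.

Let E_ccont c x : `|c| < a -> ccont (fun t => E (t +i* c)) x.
Proof.
move=> hc; have hb : (`|c| + a) / 2 < a by lra.
have [] := reg_ccont (Ereg (x - 1) (x + 1) hb) (x := x) (y := c) _ => //.
rewrite /box /=; apply/andP; split; first by apply/andP; split; lra.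
by rewrite -ltr_norml; lra.
Qed.

Let m_ccont c x : ccont (m c) x.
Proof. by apply: ccontN; apply: ccontZ; exact: ccont_hor. Qed.

Let w_meas c : `|c| < a -> cmeas (setT : set (measurableTypeR R)) (w c).
Proof.
move=> hc; apply: cmeasB; first by apply: ccont_cmeas => // x; exact: E_ccont.
have mp : measurable_fun (setT : set (measurableTypeR R)) (fun x : R => 0 <= x).
  exact: measurable_fun_ler.
exact: (@cmeas_if _ setT (fun=> 1) (fun=> 0) _ measurableT mp (cmeas_cst _ 1) (cmeas_cst _ 0)).
Qed.

Let m_meas c : cmeas (setT : set (measurableTypeR R)) (m c).
Proof. by apply: ccont_cmeas => // x; exact: m_ccont. Qed.

Let FT_bound c delta n : `|c| < a -> 0 < delta -> exists2 K : R, 0 <= K & forall p x,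
  c + delta <= Im p -> Im p <= 3 / 4 * A - delta ->
  normc (m c x ^+ n * w c x * cexp (m c x * p)) <= K * expR (al * c * Re p) * lor x.
Proof.
move=> hc d0; have [K1 K10 hK1] := right_bound delta hc; have [K2 K20 hK2] := left_bound delta hc.
have ad : 0 < al * delta by rewrite mulr_gt0.
have [C [C0 hC]] := lor_expR n ad.
exists ((al * (1 + `|c|)) ^+ n * (K1 + K2) * C).
  by rewrite !mulr_ge0 ?addr_ge0// exprn_ge0// mulr_ge0 ?addr_ge0// ltW.
move=> p x h1 h2.
have wb : normc (w c x) * expR (al * x * Im p) <= (K1 + K2) * expR (- (al * delta * `|x|)).
  rewrite /w mulrDl; have e0 := expR_ge0 (- (al * delta * `|x|)).
  have [x0|x0] := leP 0 x.
    by rewrite (le_trans (hK1 c p x _ h2 x0))// lerDl mulr_ge0.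
  by rewrite subr0 (le_trans (hK2 c p x _ h1 (ltW x0)))// lerDr mulr_ge0.
have mb : normc (m c x) <= al * (1 + `|c|) * (1 + `|x|).
  rewrite /m normcN Normc.normcM Normc.normcM normci mul1r normcr gtr0_norm// -mulrA ler_pM2l//.
  rewrite (le_trans (normc_le_ReIm _))//=.
  by have := normr_ge0 x; have := normr_ge0 c => c0 x0; have := mulr_ge0 c0 x0; lra.
rewrite !Normc.normcM normcX normc_cexp Re_mp [al * c * _ + _]addrC expRD.
rewrite (_ : _ * _ * _ = normc (m c x) ^+ n * (normc (w c x) * expR (al * x * Im p)) *
  expR (al * c * Re p)); last by ring.
rewrite (_ : _ * C * _ * _ = (al * (1 + `|c|)) ^+ n * (K1 + K2) * (C * lor x) *
  expR (al * c * Re p)); last by ring.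
rewrite ler_wpM2r ?expR_ge0//.
have mb' : normc (m c x) ^+ n <= (al * (1 + `|c|) * (1 + `|x|)) ^+ n.
  by rewrite lerXn2r ?nnegrE ?normc_ge0// (le_trans (normc_ge0 _) mb).
have m0 : 0 <= normc (m c x) ^+ n by rewrite exprn_ge0// normc_ge0.
have w0 : 0 <= normc (w c x) * expR (al * x * Im p) by rewrite mulr_ge0 ?normc_ge0 ?expR_ge0.
rewrite (le_trans (ler_pM m0 w0 mb' wb))//.
have -> : (al * (1 + `|c|) * (1 + `|x|)) ^+ n * ((K1 + K2) * expR (- (al * delta * `|x|))) =
    (al * (1 + `|c|)) ^+ n * (K1 + K2) * ((1 + `|x|) ^+ n * expR (- (al * delta * `|x|))).
  by rewrite exprMn; ring.
by rewrite ler_wpM2l// mulr_ge0 ?addr_ge0// exprn_ge0// mulr_ge0 ?addr_ge0// ltW.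
Qed.

Let FT_reg c delta X1 X2 : `|c| < a -> 0 < delta ->
  reg (box X1 X2 (c + delta) (3 / 4 * A - delta)) (FTreg c).
Proof.
move=> hc d0; exists (Lap (w c) (m c) 1); apply: Lap_regd.
- by move=> z v; exact: box_open.
- exact: w_meas.
- exact: m_meas.
- move=> n; have [K K0 hK] := FT_bound n hc d0.
  exists (K * expR (al * `|c| * (`|X1| + `|X2|))) => z x /andP[/andP[z1 z2] /andP[z3 z4]].
  rewrite (le_trans (hK z x (ltW z3) (ltW z4)))// ler_wpM2r ?lor_ge0// ler_wpM2l// ler_expR.
  rewrite -!mulrA ler_pM2l// (le_trans (ler_norm _))// normrM ler_wpM2l//.
  have := ler_norm X2; have := ler_norm (- X1); rewrite normrN => n1 n2.
  by rewrite ler_norml; have := normr_ge0 X1; have := normr_ge0 X2 => n3 n4; apply/andP; split; lra.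
Qed.

Let FT_Cdom c p : `|c| < a -> c < Im p -> Im p < 3 / 4 * A ->
  Cdom (fun x => m c x ^+ 0 * w c x * cexp (m c x * p)).
Proof.
move=> hc h1 h2; pose delta := Num.min (Im p - c) (3 / 4 * A - Im p).
have d0 : 0 < delta by rewrite lt_min !subr_gt0 h1.
have d1 : c + delta <= Im p by rewrite -lerBrDl ge_min lexx.
have d2 : Im p <= 3 / 4 * A - delta by rewrite lerBrDr -lerBrDl ge_min lexx orbT.
have [K K0 hK] := FT_bound 0 hc d0; split.
  apply: cmeasM; last first.
    by apply: ccont_cmeas => // x; apply: ccont_exp; apply: ccontM; [exact: m_ccont|exact: ccont_cst].
  by apply: cmeasM; [apply: cmeasX; exact: m_meas|exact: w_meas].
by exists (K * expR (al * c * Re p)) => x; exact: hK.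
Qed.

Let FT_le c delta : `|c| < a -> 0 < delta -> exists2 K : R, 0 <= K & forall p,
  c + delta <= Im p -> Im p <= 3 / 4 * A - delta -> normc (FTreg c p) <= K * expR (al * c * Re p).
Proof.
move=> hc d0; have [K K0 hK] := FT_bound 0 hc d0; exists (2 * pi * K).
  by rewrite !mulr_ge0// pi_ge0.
move=> p h1 h2; rewrite -mulrA; apply: Cint_le; last by move=> x; exact: hK.
by have [] := @FT_Cdom c p hc _ _; first lra; first lra.
Qed.

(** The line of integration may be moved; the correction at the discontinuity
    of the step function is the change of the explicit term. *)
Lemma FTE_indep c1 c2 p : `|c1| < a -> `|c2| < a -> c1 <= c2 -> c2 < Im p -> Im p < 3 / 4 * A ->
  p != 0 -> FTE c1 p = FTE c2 p.
Proof.
move=> hc1 hc2 h12 h2 h3 p0.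
pose e z := cexp (- ('i * al%:C * z) * p).
pose fR z := (E z - 1) * e z; pose fL z := E z * e z.
pose b0 := Num.max `|c1| `|c2|; pose b := (b0 + a) / 2.
have b0a : b0 < a by rewrite gt_max hc1.
have ba : b < a by rewrite /b; lra.
have b0b : b0 < b by rewrite /b; lra.
have cb c : c1 <= c <= c2 -> `|c| <= b0.
  move=> /andP[k1 k2]; rewrite le_max; case: (ger0P c) => c0.
    by rewrite (le_trans k2 (ler_norm _)) orbT.
  by rewrite -[`|c1|]normrN (le_trans _ (ler_norm _))// lerN2.
pose delta := Num.min (Im p - c2) (3 / 4 * A - Im p).
have d0 : 0 < delta by rewrite lt_min !subr_gt0 h2.
have d1 : c2 + delta <= Im p by rewrite -lerBrDl ge_min lexx.
have d2 : Im p <= 3 / 4 * A - delta by rewrite lerBrDr -lerBrDl ge_min lexx orbT.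
have ad : 0 < al * delta by rewrite mulr_gt0.
have [C [C0 hC]] := lor_exp ad.
have ne x y : normc (e (x +i* y)) = expR (al * x * Im p) * expR (al * y * Re p).
  by rewrite -expRD /e normc_cexp -/(m y x) Re_mp addrC.
have ey y : c1 <= y <= c2 -> expR (al * y * Re p) <= expR (al * b0 * `|Re p|).
  move=> hy; rewrite ler_expR -!mulrA ler_pM2l// (le_trans (ler_norm _))// normrM.
  by rewrite ler_wpM2r// cb.
have fb (f : R[i] -> R[i]) K x y : 0 <= K -> c1 <= y <= c2 ->
    normc (f (x +i* y)) * expR (al * x * Im p) <= K * expR (- (al * delta * `|x|)) ->
    normc (f (x +i* y) * e (x +i* y)) <= K * expR (al * b0 * `|Re p|) * C * lor x.
  move=> K0 hy hK; rewrite Normc.normcM ne mulrA.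
  rewrite (le_trans (ler_pM _ (expR_ge0 _) hK (ey y hy)))// ?mulr_ge0 ?normc_ge0 ?expR_ge0//.
  rewrite mulrAC -[leRHS]mulrA ler_wpM2l// mulr_ge0// expR_ge0//.
have [KR KR0 hKR] := right_bound delta b0a; have [KL KL0 hKL] := left_bound delta b0a.
have boundR x y : c1 <= y <= c2 -> 0 <= x ->
    normc (fR (x +i* y)) <= KR * expR (al * b0 * `|Re p|) * C * lor x.
  by move=> hy x0; apply: (fb (fun z => E z - 1)) => //; apply: hKR => //; exact: cb.
have boundL x y : c1 <= y <= c2 -> x <= 0 ->
    normc (fL (x +i* y)) <= KL * expR (al * b0 * `|Re p|) * C * lor x.
  move=> hy x0; apply: (fb E) => //; apply: hKL => //; first exact: cb.
  by case/andP: hy => _ hy; rewrite (le_trans _ d1)// lerD2r.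
have re X : reg (box (- X) X (- b) b) e.
  apply: reg_exp; apply: regM; last exact: reg_cst.
  by apply: regN; apply: regZ; apply: reg_id; exact: bnd_box.
have rR X : reg (box (- X) X (- b) b) fR.
  by apply: regM => //; apply: regB; [exact: Ereg|exact: reg_cst].
have rL X : reg (box (- X) X (- b) b) fL by apply: regM => //; exact: Ereg.
have hb1 : - b < c1.
  by rewrite ltrNl (le_lt_trans _ b0b)// (le_trans (ler_norm _))// normrN cb// lexx.
have hb2 : c2 < b by rewrite (le_lt_trans _ b0b)// (le_trans (ler_norm _))// cb// lexx h12.
have [dR1 dR2 ER] := half_shift_right hb1 h12 hb2 rR boundR.
have [dL1 dL2 EL] := half_shift_left hb1 h12 hb2 rL boundL.
have split c : `|c| < a -> c < Im p ->
    Cdom (fun x => if 0 <= x then fR (x +i* c) else 0) ->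
    Cdom (fun x => if x <= 0 then fL (x +i* c) else 0) ->
    FTreg c p = Cint (fun x => if 0 <= x then fR (x +i* c) else 0) +
                Cint (fun x => if x <= 0 then fL (x +i* c) else 0).
  move=> k1 k2 dR dL; rewrite -(CintD dR dL).
  apply: (@eq_Cint_off _ _ _ 0 (FT_Cdom k1 k2 h3) (CdomD dR dL)) => x.
  rewrite expr0 mul1r /w /fR /fL /e -/(m c x).
  by case: ltgtP => // x0 _; rewrite ?addr0 ?add0r ?subr0.
have cE (f : R[i] -> R[i]) y : (forall X, reg (box (- X) X (- b) b) f) -> c1 <= y <= c2 ->
    ccont (fun y => f (0 +i* y)) y.
  move=> rf /andP[k1 k2]; have [] := reg_ccont (rf 1) (x := 0) (y := y) _ => //.
  by rewrite /box /= oppr_lt0 ltr01 (lt_le_trans hb1 k1) (le_lt_trans k2 hb2).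
have mI : measurable (`[c1, c2] : set (measurableTypeR R)) by [].
have V : cintegral `[c1, c2] (fun y => fL (0 +i* y)) - cintegral `[c1, c2] (fun y => fR (0 +i* y)) =
    (cexp ((al * c2)%:C * p) - cexp ((al * c1)%:C * p)) / (al%:C * p).
  rewrite -cintegralB//; [|by apply: ccont_itv_cintble => u; exact: cE|
    by apply: ccont_itv_cintble => u; exact: cE].
  have ap0 : al%:C * p != 0 by rewrite mulf_neq0// fmorph_eq0 gt_eqF.
  pose G u := (al%:C * p)^-1 * cexp ((al * u)%:C * p).
  rewrite (@cintegral_ftc _ G)//.
  - by rewrite /G -mulrBr mulrC.
  - move=> u _; rewrite /G.
    have D : cder (fun u : R => (al * u)%:C * p) u (al%:C * p).
      apply: (cder_ext (c := fun u : R => (al%:C * p) * u%:C)).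
        by move=> v; rewrite rmorphM /=; ring.
      by apply: cder_eq (cderZ _ (cder_real u)) _; rewrite mulr1.
    apply: cder_eq (cderZ _ (cder_exp D)) _.
    rewrite mulrA mulVf// mul1r /fL /fR -mulrBl opprB addrC subrK mul1r /e; congr cexp.
    by apply: complexP; rewrite !ReImE /=; ring.
  - by move=> u hu; apply: ccontB; exact: cE.
have i0 : 'i != 0 :> R[i] by rewrite -normc_gt0 normci.
have i2 : 'i * 'i = - 1 :> R[i] by rewrite -expr2 sqr_i.
have al0' : al%:C != 0 :> R[i] by rewrite fmorph_eq0 gt_eqF.
have h1 : c1 < Im p := le_lt_trans h12 h2.
apply/eqP; rewrite eq_sym -subr_eq0; apply/eqP.
rewrite /FTE (split c1)// (split c2)//.
have fin (R1 R2 L1 L2 u1 u2 VR VL : R[i]) : R2 - R1 = - ('i * VR) -> L2 - L1 = 'i * VL ->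
    VL - VR = (u2 - u1) / (al%:C * p) ->
    R2 + L2 + u2 / ('i * al%:C * p) - (R1 + L1 + u1 / ('i * al%:C * p)) = 0.
  move=> hR hL hV; transitivity ((R2 - R1) + (L2 - L1) + (u2 - u1) / ('i * al%:C * p)); first by ring.
  rewrite hR hL [- _ + _]addrC -mulrBr hV.
  transitivity (('i * 'i + 1) * ((u2 - u1) / ('i * al%:C * p))); first by field; rewrite p0 al0' i0.
  by rewrite i2 addNr mul0r.
exact: fin ER EL V.
Qed.

Let a_ge : A <= a. Proof. by have := hAm; rewrite /amean => h; lra. Qed.

(* for Im q < 0 the transform converges without the step function *)
Let FTE_half c q : `|c| < a -> c < Im q -> Im q < 0 ->
  Cdom (fun x => E (x +i* c) * cexp (m c x * q)) /\
  FTE c q = Cint (fun x => E (x +i* c) * cexp (m c x * q)).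
Proof.
move=> hc h1 h2; have hq : Im q < 3 / 4 * A by have := hA => ?; lra.
have dF := FT_Cdom hc h1 hq.
have mE x : m c x * q = - ('i * al%:C * q) * x%:C + (al * c)%:C * q.
  by apply: complexP; rewrite /m !ReImE /=; ring.
have mq : Re (- ('i * al%:C * q)) < 0.
  have -> : Re (- ('i * al%:C * q)) = al * Im q by rewrite !ReImE /=; ring.
  by rewrite pmulr_rlt0.
have [dH H] := Cint_half_exp ((al * c)%:C * q) mq.
have S x : m c x ^+ 0 * w c x * cexp (m c x * q) +
   (if 0 <= x then cexp (- ('i * al%:C * q) * x%:C + (al * c)%:C * q) else 0) =
   E (x +i* c) * cexp (m c x * q).
  by rewrite -mE expr0 mul1r /w; case: (0 <= x); rewrite ?subr0 ?addr0//; ring.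
have d := CdomD dF dH; have I := CintD dF dH.
rewrite (_ : (fun x => _) = (fun x => m c x ^+ 0 * w c x * cexp (m c x * q) +
   (if 0 <= x then cexp (- ('i * al%:C * q) * x%:C + (al * c)%:C * q) else 0))).
  by split => //; rewrite I H /FTE /FTreg invrN mulrN opprK.
by apply/funext => x; rewrite S.
Qed.

(* two lines at distance A inside the strip, related by the difference equation *)
Let c1 := A / 4.
Let c2 := - (3 / 4 * A).
Let c1a : `|c1| < a.
Proof. by have := a_ge; have := hA => h1 h2; rewrite gtr0_norm /c1; lra. Qed.
Let c2a : `|c2| < a.
Proof. by have := a_ge; have := hA => h1 h2; rewrite /c2 normrN gtr0_norm; lra. Qed.

(* E at height c1 is E at height c2 times 1 + e^(- al A z), z being halfway between,
   and multiplication by the exponential shifts the argument of the transform *)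
Let FTE_diff p : Im p = A / 2 -> FTE c1 p = cexp ((al * A)%:C * p) *
  (FTE c2 p + cexp (- ('i * (al * A ^+ 2 / 2)%:C)) * FTE c2 (p - 'i * A%:C)).
Proof.
move=> hp; have h1 := hA; have h2 := hAm.
set q := p - _; have iq : Im q = - (A / 2) by rewrite /q !ReImE /= hp; lra.
have k1 : c1 < Im p by rewrite hp /c1; lra.
have k2 : c2 < Im p by rewrite hp /c2; lra.
have k3 : Im p < 3 / 4 * A by rewrite hp; lra.
have k4 : c2 < Im q by rewrite iq /c2; lra.
have k5 : Im q < 0 by rewrite iq; lra.
have d1 := FT_Cdom c1a k1 k3; have d2 := FT_Cdom c2a k2 k3.
have [d3 F3] := FTE_half c2a k4 k5.
have p0 : p != 0 by apply/eqP => p0; move: hp; rewrite p0 /=; lra.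
have al0' : al%:C != 0 :> R[i] by rewrite fmorph_eq0 gt_eqF.
have i0 : 'i != 0 :> R[i] by rewrite -normc_gt0 normci.
set kap := cexp (- _); set eA := cexp _.
have key x : m c1 x ^+ 0 * w c1 x * cexp (m c1 x * p) =
    eA * (m c2 x ^+ 0 * w c2 x * cexp (m c2 x * p) + kap * (E (x +i* c2) * cexp (m c2 x * q))).
  rewrite !expr0 !mul1r.
  have e1 : cexp (m c1 x * p) = eA * cexp (m c2 x * p).
    by rewrite -cexpD; congr cexp; apply: complexP; rewrite /m /c1 /c2 !ReImE /=; field.
  have e2 : E (x +i* c1) = (1 + cexp (- ((al * A)%:C * (x +i* - (A / 4))))) * E (x +i* c2).
    have hz : 2 * `|Im (x +i* - (A / 4))| < am by rewrite /= normrN gtr0_norm; lra.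
    have := Ediff hz; congr (E _ = _ * E _); apply: complexP; rewrite /c1 /c2 !ReImE /=; lra.
  have e3 : kap * cexp (m c2 x * q) = cexp (- ((al * A)%:C * (x +i* - (A / 4)))) * cexp (m c2 x * p).
    by rewrite -!cexpD; congr cexp; apply: complexP; rewrite /m /q /c2 !ReImE /=; field.
  rewrite mulrCA e3 e1 /w e2.
  by case: (0 <= x); ring.
have d23 := CdomD d2 (CdomZ kap d3).
rewrite {1}/FTE {1}/FTreg /Lap (eq_Cint key) (CintZ _ d23) (CintD d2 (CdomZ kap d3)) (CintZ _ d3) -F3.
rewrite /FTE -/(Lap _ _ 0 p) -/(FTreg c2 p).
have -> : cexp ((al * c1)%:C * p) = eA * cexp ((al * c2)%:C * p).
  by rewrite -cexpD; congr cexp; apply: complexP; rewrite /c1 /c2 !ReImE /=; field.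
rewrite -/(FTE c2 q); move: (FTreg _ _) (FTE _ _) (cexp _) => u v e.
by field; rewrite p0 al0' i0.
Qed.

Let wS (s : R) : R[i] := if 0 <= s <= 1 then (al * A)%:C else 0.
Let mS (s : R) : R[i] := (- (al * A * s))%:C.

(* (1 - exp (- al A p)) / p as an entire function *)
Let S p := Lap wS mS 0 p.

Let aA : 0 < al * A. Proof. by rewrite mulr_gt0. Qed.

Let wS_meas : cmeas (setT : set (measurableTypeR R)) wS.
Proof.
have mp : measurable_fun (setT : set (measurableTypeR R)) (fun s : R => 0 <= s <= 1).
  by apply: measurable_and; apply: measurable_fun_ler.
exact: (@cmeas_if _ setT (fun=> (al * A)%:C) (fun=> 0) _ measurableT mp (cmeas_cst _ _) (cmeas_cst _ 0)).
Qed.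

Let mS_meas : cmeas (setT : set (measurableTypeR R)) mS.
Proof.
apply: ccont_cmeas => // s.
apply: (ccont_ext (c := fun s : R => (- (al * A))%:C * s%:C)).
  by move=> u; rewrite /mS -rmorphM mulNr.
by apply: ccontZ; exact: cder_cont (cder_real s).
Qed.

Let S_bound n p s : normc (mS s ^+ n * wS s * cexp (mS s * p)) <=
  (al * A) ^+ n * (al * A) * 2 * (1 + expR (- (al * A * Re p))) * lor s.
Proof.
have r0 : 0 <= (al * A) ^+ n * (al * A) by rewrite mulr_ge0 ?exprn_ge0 ?(ltW aA).
have e0 : 0 <= 1 + expR (- (al * A * Re p)) by rewrite addr_ge0 ?expR_ge0.
rewrite /wS; case: ifP => [/andP[s0 s1]|_]; last first.
  rewrite mulr0 mul0r normc0'; apply: mulr_ge0 (lor_ge0 s); apply: mulr_ge0 e0.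
  exact: mulr_ge0 r0 (ler0n _ _).
rewrite !Normc.normcM normcX !normcr normrN (ger0_norm (mulr_ge0 (ltW aA) s0)) (gtr0_norm aA).
rewrite normc_cexp ReMr.
have e1 : expR (- (al * A * s) * Re p) <= 1 + expR (- (al * A * Re p)).
  have [p0|p0] := leP 0 (Re p).
    rewrite (le_trans (y := 1)) ?lerDl ?expR_ge0// expR_le1 mulNr oppr_le0.
    by rewrite mulr_ge0// mulr_ge0// ltW.
  rewrite (le_trans (y := expR (- (al * A * Re p)))) ?lerDr// ler_expR mulNr lerN2.
  by rewrite -[leRHS]mulrA ler_pM2l// -[leLHS]mul1r ler_wnM2r// ltW.
have e2 : (al * A * s) ^+ n <= (al * A) ^+ n.
  rewrite lerXn2r ?nnegrE ?(mulr_ge0 (ltW aA))// ?(ltW aA)//.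
  by rewrite ler_piMr// ltW.
have e3 : 1 <= 2 * lor s.
  have o0 : 0 < oneDsqr s by rewrite (lt_le_trans ltr01)// oneDsqr_ge1.
  rewrite /lor ler_pdivlMr// mul1r /oneDsqr.
  have : s ^+ 2 <= 1 by rewrite exprn_ile1.
  by lra.
rewrite (_ : (al * A) ^+ n * (al * A) * 2 * _ * _ = (al * A) ^+ n * (al * A) *
  (1 + expR (- (al * A * Re p))) * (2 * lor s)); last by ring.
rewrite (le_trans (y := (al * A) ^+ n * (al * A) * (1 + expR (- (al * A * Re p)))))//.
  apply: ler_pM e1; rewrite ?expR_ge0//; last exact: ler_wpM2r (ltW aA) _ _ e2.
  by apply: mulr_ge0 (ltW aA); rewrite exprn_ge0// mulr_ge0// ltW.
by rewrite ler_peMr// mulr_ge0.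
Qed.

Let S_reg (X1 X2 Y1 Y2 : R) : reg (box X1 X2 Y1 Y2) S.
Proof.
exists (Lap wS mS 1); apply: Lap_regd.
- by move=> z v; exact: box_open.
- exact: wS_meas.
- exact: mS_meas.
- move=> n; exists ((al * A) ^+ n * (al * A) * 2 * (1 + expR (- (al * A * X1)))).
  move=> z s /andP[/andP[z1 z2] _]; rewrite (le_trans (S_bound _ _ _))//.
  apply: ler_wpM2r (lor_ge0 _) _ _ _; apply: ler_wpM2l.
    exact: mulr_ge0 (mulr_ge0 (exprn_ge0 _ (ltW aA)) (ltW aA)) (ler0n _ _).
  by rewrite lerD2l ler_expR lerN2 ler_pM2l// ltW.
Qed.

Let S_int p : S p = cintegral `[0, 1] (fun s : R => (al * A)%:C * cexp (mS s * p)).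
Proof.
rewrite -Cint_itv; apply: eq_Cint => s; rewrite expr0 mul1r /wS.
by case: (0 <= s <= 1); rewrite ?mul0r.
Qed.

Let mS_der p s : cder (fun s => cexp (mS s * p)) s (- (al * A)%:C * p * cexp (mS s * p)).
Proof.
have D : cder (fun s => mS s * p) s (- (al * A)%:C * p).
  apply: (cder_ext (c := fun s : R => - (al * A)%:C * p * s%:C)).
    by move=> u; rewrite /mS rmorphN rmorphM /=; ring.
  by apply: cder_eq (cderZ _ (cder_real s)) _; rewrite mulr1.
exact: cder_exp D.
Qed.

Let S_eq p : p * S p = 1 - cexp (- ((al * A)%:C * p)).
Proof.
have cc u : ccont (fun s => (al * A)%:C * cexp (mS s * p)) u.
  by apply: ccontZ; exact: cder_cont (mS_der p u).
rewrite S_int -cintegralZ//; last by apply: ccont_itv_cintble => u _.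
rewrite (@cintegral_ftc _ (fun s => - cexp (mS s * p)))//.
- by rewrite /mS mulr1 mulr0 oppr0 mul0r cexp0 opprK addrC rmorphN mulNr.
- by move=> u _; apply: cder_eq (cderN (mS_der p u)) _; ring.
- by move=> u _; apply: ccontZ.
Qed.

Let S0 : S 0 = (al * A)%:C.
Proof.
rewrite S_int (@cintegral_ftc _ (fun s => (al * A)%:C * s%:C))//.
- by rewrite rmorph0 mulr0 subr0 mulr1.
- by move=> u _; apply: cder_eq (cderZ _ (cder_real u)) _; rewrite mulr0 cexp0.
- by move=> u _; apply: ccontZ; exact: cder_cont (mS_der 0 u).
Qed.

Let S_le p : normc (S p) <= 2 * pi * (al * A * 2 * (1 + expR (- (al * A * Re p)))).
Proof.
apply: Cint_le; last by move=> s; rewrite (le_trans (S_bound 0 p s))// expr0 mul1r.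
apply: cmeasM.
  by apply: cmeasM => //; exact: cmeasX.
by apply: cmeas_exp => //; apply: cmeasM => //; exact: cmeas_cst.
Qed.

(* the numerator 1 - e^(- al A p) cancels the pole of the transform at 0 *)
Let N c p := (1 - cexp (- ((al * A)%:C * p))) * FTreg c p +
  cexp ((al * c)%:C * p) * S p / ('i * al%:C).

Let i0 : 'i%R != 0 :> R[i]. Proof. by rewrite -normc_gt0 normci. Qed.
Let al0' : al%:C != 0 :> R[i]. Proof. by rewrite fmorph_eq0 gt_eqF. Qed.

Let N_FTE c p : p != 0 -> N c p = (1 - cexp (- ((al * A)%:C * p))) * FTE c p.
Proof.
move=> p0; rewrite /N /FTE -S_eq.
by move: (S p) (FTreg _ _) (cexp _) => u v e; field; rewrite p0 al0' i0.
Qed.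

Let N0 c : N c 0 = - 'i * A%:C.
Proof.
have i2 : 'i * 'i = - 1 :> R[i] by rewrite -expr2 sqr_i.
rewrite /N !mulr0 oppr0 cexp0 subrr mul0r add0r mul1r S0 rmorphM.
apply: (mulfI i0); transitivity (A%:C : R[i]); first by field; rewrite al0' i0.
by rewrite mulrA mulrN i2 opprK mul1r.
Qed.

Let N_indep d1 d2 p : `|d1| < a -> `|d2| < a -> d1 <= d2 -> d2 < Im p -> Im p < 3 / 4 * A ->
  N d1 p = N d2 p.
Proof.
move=> h1 h2 h12 h3 h4; have [->|p0] := eqVneq p 0; first by rewrite !N0.
by rewrite (N_FTE d1 p0) (N_FTE d2 p0) (FTE_indep h1 h2 h12 h3 h4 p0).
Qed.

Let N_le c delta : `|c| < a -> 0 < delta -> exists2 K : R, 0 <= K & forall p,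
  c + delta <= Im p -> Im p <= 3 / 4 * A - delta ->
  normc (N c p) <= K * (expR (al * c * Re p) + expR (al * (c - A) * Re p)).
Proof.
move=> hc d0; have [K K0 hK] := FT_le hc d0.
pose K2 := 2 * pi * (al * A * 2) / al.
have K20 : 0 <= K2 by rewrite divr_ge0 ?(ltW al0)// !mulr_ge0 ?pi_ge0// ltW.
exists (K + K2); first by rewrite addr_ge0.
move=> p h1 h2; set e1 := expR (al * c * Re p); set q := expR (- (al * A * Re p)).
have -> : expR (al * (c - A) * Re p) = e1 * q by rewrite -expRD; congr expR; ring.
have q0 : 0 <= q by exact: expR_ge0.
have e0 : 0 <= e1 by exact: expR_ge0.
have b1 : normc (1 - cexp (- ((al * A)%:C * p))) <= 1 + q.
  by rewrite (le_trans (normcB _ _))// (normcr 1) normr1 normc_cexp ReN ReMr.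
have b2 := hK p h1 h2; rewrite -/e1 in b2.
have b3 : normc (cexp ((al * c)%:C * p) * S p / ('i * al%:C)) <= e1 * (K2 * (1 + q)).
  rewrite Normc.normcM Normc.normcM Normc.normcV Normc.normcM normci mul1r normcr gtr0_norm//.
  rewrite normc_cexp ReMr -/e1 -mulrA ler_wpM2l// (_ : K2 * (1 + q) = 2 * pi * (al * A * 2 * (1 + q)) / al).
    by rewrite ler_wpM2r ?invr_ge0 ?(ltW al0)//; exact: S_le.
  by rewrite /K2; field; rewrite gt_eqF.
rewrite (le_trans (le_normcD _ _))// [X in X + _]Normc.normcM.
rewrite (le_trans (lerD (ler_pM (normc_ge0 _) (normc_ge0 _) b1 b2) b3))//.
by rewrite le_eqVlt; apply/orP; left; apply/eqP; ring.
Qed.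

Let N_reg c delta X1 X2 : `|c| < a -> 0 < delta -> reg (box X1 X2 (c + delta) (3 / 4 * A - delta)) (N c).
Proof.
move=> hc d0; have rZ (k : R[i]) : reg (box X1 X2 (c + delta) (3 / 4 * A - delta)) (fun p => k * p).
  by apply: regZ; apply: reg_id; exact: bnd_box.
apply: regD.
  apply: regM; last exact: FT_reg.
  apply: regB; first exact: reg_cst.
  by apply: reg_exp; apply: regN.
apply: regM; last exact: reg_cst.
by apply: regM; [exact: reg_exp|exact: S_reg].
Qed.

Let d := (am - A) / 2.
(* holomorphic near the strip |Im p| <= A / 2, with equal values on its two sides *)
Let M p := cexp ((al * a)%:C * p) * E (1 * p + 'i * d%:C) * N c2 p.

Let M_reg X : reg (box (- X) X (- (5 / 8 * A)) (5 / 8 * A)) M.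
Proof.
have h1 := hA; have h2 := hAm.
apply: regM; first apply: regM.
- by apply: reg_exp; apply: regZ; apply: reg_id; exact: bnd_box.
- have ba : am / 2 + A / 4 < a by rewrite /amean; lra.
  apply: reg_affine (Ereg (- X) X ba) _ => z /andP[z1 /andP[z2 z3]].
  rewrite /box mul1r ReD ImD.
  have -> : Re ('i * d%:C) = 0 :> R by rewrite !ReImE /=; ring.
  have -> : Im ('i * d%:C) = d :> R by rewrite !ReImE /=; ring.
  by rewrite addr0 z1 /d; apply/andP; split; lra.
- have d0 : 0 < A / 8 by lra.
  apply: reg_sub (N_reg (- X) X c2a d0) => z /andP[z1 /andP[z2 z3]].
  by rewrite /box z1 /c2; apply/andP; split; lra.
Qed.

Let M_per x : M (x +i* (A / 2)) = M (x +i* - (A / 2)).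
Proof.
have h1 := hA; have h2 := hAm; set p := x +i* _; set q := x +i* _.
have hp : Im p = A / 2 by [].
have qE : p - 'i * A%:C = q by apply: complexP; rewrite !ReImE /=; lra.
have p0 : p != 0 by apply/eqP => p0; move: hp; rewrite p0 /=; lra.
have q0 : q != 0 by apply/eqP => q0; have := congr1 (@complex.Im R) q0; rewrite /=; lra.
rewrite /M !mul1r !N_FTE//.
have dz : 2 * `|Im (x +i* d)| < am by rewrite /= ger0_norm /d; lra.
have eE := Ediff dz.
have D := FTE_diff hp.
have I : FTE c1 p = FTE c2 p.
  apply/esym/FTE_indep => //; rewrite ?hp /c1 /c2; lra.
rewrite I qE in D; clear I.
have pi2 : al * A * am = 2 * pi by rewrite -mulrA.
have e1 : E (p + 'i * d%:C) = (1 - cexp (- ((al * A)%:C * q))) * E (q + 'i * d%:C).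
  have -> : p + 'i * d%:C = x +i* d + 'i * (A / 2)%:C by apply: complexP; rewrite !ReImE /=; lra.
  have -> : q + 'i * d%:C = x +i* d - 'i * (A / 2)%:C by apply: complexP; rewrite !ReImE /=; lra.
  rewrite eE; congr ((1 + _) * _).
  have -> : - ((al * A)%:C * (x +i* d)) = - ((al * A)%:C * q) - 'i * pi%:C.
    apply: complexP; rewrite !ReImE /= /d; first by ring.
    have -> : (pi : R) = al * A * am / 2 by rewrite pi2; field.
    by field.
  by rewrite cexpB cexp_ipi invrN invr1 mulrN1.
have e2 : (1 - cexp (- ((al * A)%:C * p))) * FTE c2 p =
    - cexp (- ('i * (al * A ^+ 2 / 2)%:C)) * FTE c2 q.
  have X : cexp (- ((al * A)%:C * p)) * FTE c2 p = FTE c2 p + cexp (- ('i * (al * A ^+ 2 / 2)%:C)) * FTE c2 q.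
    by rewrite {1}D mulrA cexpNV mul1r.
  by rewrite mulrBl mul1r X; ring.
have e3 : cexp ((al * a)%:C * p) * - cexp (- ('i * (al * A ^+ 2 / 2)%:C)) = cexp ((al * a)%:C * q).
  have -> : (al * a)%:C * p = (al * a)%:C * q + 'i * (al * A ^+ 2 / 2)%:C + 'i * pi%:C.
    apply: complexP; rewrite !ReImE /= /amean; first by ring.
    have -> : (pi : R) = al * A * am / 2 by rewrite pi2; field.
    by field.
  rewrite !cexpD cexp_ipi cexpN; have := cexp_neq0 ('i * (al * A ^+ 2 / 2)%:C).
  by move: (cexp _) (cexp _) => u v u0; field.
rewrite e2 e1 -e3; ring.
Qed.

Let kap := 3 / 4 * (al * am).

(* For Re p < 0 the line of integration is chosen according to the sign of Im p:
   c = - A / 4 above the real axis, c = c2 below it. *)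
Let M_grow : exists C, forall x y, `|y| <= A / 2 -> normc (M (x +i* y)) <= C * expR (kap * `|x|).
Proof.
have h1 := hA; have h2 := hAm.
have ba : am / 2 < a by rewrite /amean; lra.
have d0 : 0 < A / 4 by lra.
have c3a : `|- (A / 4)| < a by rewrite normrN gtr0_norm //; have := a_ge; lra.
have [K1 K10 hK1] := Enear1 ba; have [K2 K20 hK2] := Eneg ba.
have [K3 K30 hK3] := N_le c2a d0; have [K4 K40 hK4] := N_le c3a d0.
exists ((1 + K1) * (2 * K3) + K2 * (2 * (K3 + K4))) => x y hy.
have hE : Im (x +i* y + 'i * d%:C) = y + d by rewrite !ReImE /=; ring.
have hE' : Re (x +i* y + 'i * d%:C) = x by rewrite !ReImE /=; ring.
have hyd : `|y + d| <= am / 2.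
  by move: hy; rewrite !ler_norml /d => /andP[k1 k2]; apply/andP; split; lra.
have y1 : - (A / 2) <= y by move: hy; rewrite ler_norml => /andP[].
have y2 : y <= A / 2 by move: hy; rewrite ler_norml => /andP[].
have nM : normc (M (x +i* y)) = expR (al * a * x) * normc (E (x +i* y + 'i * d%:C)) * normc (N c2 (x +i* y)).
  by rewrite /M !Normc.normcM normc_cexp ReMr mul1r.
have eN c : expR (al * c * x) * expR (- (al * c * x)) = 1 by rewrite -expRD subrr expR0.
rewrite nM; have [x0|x0] := leP 0 x.
  have b1 : normc (E (x +i* y + 'i * d%:C)) <= 1 + K1.
    rewrite -[E _](subrK 1) addrC (le_trans (le_normcD _ _))// (normcr 1) normr1 lerD2l.
    rewrite (le_trans (hK1 _ _ _)) ?hE ?hE'// ler_piMr// expR_le1 oppr_le0.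
    by rewrite !mulr_ge0 ?(ltW al0)// ltW.
  have b2 : normc (N c2 (x +i* y)) <= 2 * K3 * expR (al * c2 * x).
    have y3 : c2 + A / 4 <= Im (x +i* y) by rewrite /c2 /=; lra.
    have y4 : Im (x +i* y) <= 3 / 4 * A - A / 4 by rewrite /=; lra.
    rewrite (le_trans (hK3 _ y3 y4))//=.
    have -> : 2 * K3 * expR (al * c2 * x) = K3 * (expR (al * c2 * x) + expR (al * c2 * x)) by ring.
    apply: ler_wpM2l => //; rewrite lerD2l ler_expR; apply: ler_wpM2r => //.
    by rewrite ler_pM2l//; lra.
  rewrite -mulrA (le_trans (ler_wpM2l (expR_ge0 _) (ler_pM (normc_ge0 _) (normc_ge0 _) b1 b2)))//.
  rewrite (_ : expR _ * _ = (1 + K1) * (2 * K3) * (expR (al * a * x) * expR (al * c2 * x))); last by ring.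
  rewrite (le_trans (y := (1 + K1) * (2 * K3) * expR (kap * `|x|)))//.
    apply: ler_wpM2l; first by rewrite !mulr_ge0 ?addr_ge0.
    rewrite -expRD ler_expR ger0_norm// /kap /c2 /amean -mulrDl ler_wpM2r//.
    by rewrite -mulrDr [leRHS]mulrCA ler_wpM2l ?(ltW al0)//; lra.
  by apply: ler_wpM2r (expR_ge0 _) _ _ _; rewrite lerDl !mulr_ge0 ?addr_ge0.
have b1 : normc (E (x +i* y + 'i * d%:C)) <= K2 * expR (- (al * x * (y + d))).
  by rewrite (le_trans (hK2 _ _ _)) ?hE ?hE'// ltW.
have fin c K : 0 <= K -> K <= K3 + K4 -> y - c <= 3 / 4 * A -> normc (N c (x +i* y)) <=
    K * (expR (al * c * x) + expR (al * (c - A) * x)) ->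
    expR (al * a * x) * normc (E (x +i* y + 'i * d%:C)) * normc (N c (x +i* y)) <=
    K2 * (2 * (K3 + K4)) * expR (kap * `|x|).
  move=> K0 KK hc hN.
  have b2 : normc (N c (x +i* y)) <= 2 * (K3 + K4) * expR (al * (c - A) * x).
    have -> : 2 * (K3 + K4) * expR (al * (c - A) * x) =
      (K3 + K4) * (expR (al * (c - A) * x) + expR (al * (c - A) * x)) by ring.
    rewrite (le_trans hN)//; apply: (ler_pM K0 (addr_ge0 (expR_ge0 _) (expR_ge0 _)) KK).
    rewrite lerD2r ler_expR; apply: ler_wnM2r; first exact: ltW.
    by rewrite ler_pM2l//; lra.
  rewrite -mulrA (le_trans (ler_wpM2l (expR_ge0 _) (ler_pM (normc_ge0 _) (normc_ge0 _) b1 b2)))//.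
  have -> : expR (al * a * x) * (K2 * expR (- (al * x * (y + d))) * (2 * (K3 + K4) * expR (al * (c - A) * x))) =
    K2 * (2 * (K3 + K4)) * (expR (al * a * x) * expR (- (al * x * (y + d))) * expR (al * (c - A) * x)) by ring.
  apply: ler_wpM2l; first by rewrite !mulr_ge0 ?addr_ge0.
  rewrite -!expRD ler_expR ltr0_norm// /kap /amean /d.
  rewrite (_ : _ + _ = al * (y - c) * - x); last by field.
  rewrite ler_wpM2r ?oppr_ge0 ?(ltW x0)// mulrCA ler_wpM2l ?(ltW al0)//; lra.
rewrite (le_trans (y := K2 * (2 * (K3 + K4)) * expR (kap * `|x|)))//; last first.
  by apply: ler_wpM2r (expR_ge0 _) _ _ _; rewrite lerDr !mulr_ge0 ?addr_ge0.
have [yp|yn] := leP 0 y.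
  have -> : N c2 (x +i* y) = N (- (A / 4)) (x +i* y).
    by apply: N_indep => //=; rewrite ?/c2; lra.
  have y3 : - (A / 4) + A / 4 <= Im (x +i* y) by rewrite /=; lra.
  have y4 : Im (x +i* y) <= 3 / 4 * A - A / 4 by rewrite /=; lra.
  by apply: fin (hK4 _ y3 y4); rewrite ?lerDr//; lra.
have y3 : c2 + A / 4 <= Im (x +i* y) by rewrite /c2 /=; lra.
have y4 : Im (x +i* y) <= 3 / 4 * A - A / 4 by rewrite /=; lra.
by apply: fin (hK3 _ y3 y4); rewrite ?lerDl// /c2; lra.
Qed.

(** The transform of [E] is, up to elementary factors, the inverse of a shift of
    [E]: the product of the two extends to a periodic function without poles, of
    growth too slow for a nonconstant one. *)
Lemma FTE_mul_E (y : R) : y != 0 ->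
  cexp ((al * a)%:C * y%:C) * (1 - cexp (- ((al * A)%:C * y%:C))) * E (y +i* d) * FTE (- (a / 2)) y%:C =
  - 'i * A%:C * E (0 +i* d).
Proof.
move=> y0; have h1 := hA; have h2 := hAm.
have [C hC] := M_grow.
have A2 : A / 2 < 5 / 8 * A by lra.
have k0 : 0 <= kap by rewrite /kap !mulr_ge0 ?(ltW al0)// ltW.
have k1 : kap < 2 * pi / A.
  rewrite ltr_pdivlMr// -hal /kap (_ : _ * A = 3 / 4 * (al * (A * am))); last by ring.
  by rewrite hal; have := pi_gt0 R; lra.
have := periodic_const y hA A2 k0 k1 M_reg M_per hC.
have y0' : y%:C != 0 :> R[i] by rewrite fmorph_eq0.
have e1 : 1 * y%:C + 'i * d%:C = y +i* d by apply: complexP; rewrite !ReImE /=; ring.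
have e2 : 1 * 0 + 'i * d%:C = 0 +i* d by apply: complexP; rewrite !ReImE /=; ring.
rewrite /M e1 e2 mulr0 cexp0 mul1r N0 N_FTE//.
have a2a : `|- (a / 2)| < a by have h3 := a_ge; rewrite normrN gtr0_norm; lra.
have -> : FTE c2 y%:C = FTE (- (a / 2)) y%:C.
  have [h|/ltW h] := leP c2 (- (a / 2)).
    by apply: FTE_indep => //=; have := a_ge; lra.
  by apply/esym/FTE_indep => //=; rewrite /c2; lra.
by move=> H; rewrite [RHS]mulrC -H; ring.
Qed.

End FourierTransform.

(** * The transform in terms of GR *)

Section Prefactor.
Context {R : realType}.
Implicit Types (x y s u : R) (z w : R[i]).

Lemma GR_strip (ap am tau : R) z : 0 < ap -> 0 < am -> 0 < tau -> ap * tau < pi ->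
  am * tau < pi -> `|Im z| < amean ap am -> GR ap am z = Ef ap am tau z.
Proof.
move=> h1 h2 h3 h4 h5 hz; rewrite /GR (G_strip hz) /Ef (gRd0 h1 h2 h3 h4 h5 hz) /gR -cexpD.
by congr cexp; ring.
Qed.

(* with this tau, 2 tau = 3 / 4 alpha ap, the rate required of E at +oo *)
Let core (ap am tau y : R) : 0 < ap -> 0 < am -> ap <= am -> tau = 3 * pi / (4 * am) -> y != 0 ->
  cexp ((alpha ap am * amean ap am)%:C * y%:C) * (1 - cexp (- (2 * pi / am * y)%:C)) *
    Ef ap am tau (y +i* ((am - ap) / 2)) *
    FTE (Ef ap am tau) (alpha ap am) (- (amean ap am / 2)) y%:C =
  - 'i * ap%:C * Ef ap am tau (0 +i* ((am - ap) / 2)).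
Proof.
move=> p0 m0 pm tauE y0; have ppi := pi_gt0 R.
have ht : 0 < tau by rewrite tauE divr_gt0// mulr_gt0.
have hm : am * tau < pi.
  by rewrite (_ : am * tau = 3 / 4 * pi); [lra|rewrite tauE; field; rewrite gt_eqF].
have hp : ap * tau < pi by rewrite (le_lt_trans _ hm)// ler_wpM2r// ltW.
have h1 : alpha ap am * (ap * am) = 2 * pi.
  by rewrite /alpha divfK// mulf_neq0// gt_eqF.
have h2 : alpha ap am * ap = 2 * pi / am.
  by rewrite /alpha; field; rewrite !gt_eqF.
have h3 : 2 * tau = alpha ap am * (3 / 4 * ap).
  by rewrite mulrCA h2 tauE; field; rewrite gt_eqF.
have e1 : - (2 * pi / am * y)%:C = - ((alpha ap am * ap)%:C * y%:C) :> R[i].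
  by rewrite h2 -rmorphM.
rewrite e1; apply: (FTE_mul_E p0 pm h1) => //.
- by move=> X1 X2 b; exact: Ef_reg.
- by move=> b hb; have := Ef_near1 p0 m0 ht hp hm hb; rewrite h3.
- by move=> b hb; exact: (Ef_neg p0 m0 ht hp hm hb).
- by move=> z hz; rewrite (Ef_diff p0 m0 ht hp hm hz) h2.
Qed.

(** The transform is elementary up to a shift of [GR] itself; the statement is
    symmetric in the two periods, so the smaller one may be taken first. *)
Lemma FTE_GR (ap am tau y : R) : 0 < ap -> 0 < am -> tau = 3 * pi / (4 * Num.max ap am) -> y != 0 ->
  cexp ((alpha ap am * amean ap am)%:C * y%:C) * GR ap am (y +i* amean ap am) *
    FTE (Ef ap am tau) (alpha ap am) (- (amean ap am / 2)) y%:C =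
  - 'i * ((Num.sqrt (ap * am))%:C *
    cexp ('i * (chi ap am - alpha ap am * ((am - ap) / 2) ^+ 2 / 4)%:C)).
Proof.
move=> p0 m0 tauE y0; have ppi := pi_gt0 R.
have x0 : 0 < Num.max ap am by rewrite lt_max p0.
have ht : 0 < tau by rewrite tauE divr_gt0// mulr_gt0.
have hx : Num.max ap am * tau < pi.
  by rewrite (_ : _ * tau = 3 / 4 * pi); [lra|rewrite tauE; field; rewrite gt_eqF].
have hp : ap * tau < pi by rewrite (le_lt_trans _ hx)// ler_wpM2r ?(ltW ht)// le_max lexx.
have hm : am * tau < pi by rewrite (le_lt_trans _ hx)// ler_wpM2r ?(ltW ht)// le_max lexx orbT.
rewrite (GR_boundary p0 m0 ht hp hm) -(Ef_boundary0 p0 m0 ht hp hm) [cexp _ * (_ * _)]mulrA [RHS]mulrA.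
have [pm|/ltW mp] := leP ap am.
  have tE : tau = 3 * pi / (4 * am) by rewrite tauE max_r.
  exact: core p0 m0 pm tE y0.
have E : Ef am ap tau = Ef ap am tau by apply/funext => z; rewrite Ef_swap.
have dE : (ap - am) / 2 = - ((am - ap) / 2) by lra.
have tE : tau = 3 * pi / (4 * ap) by rewrite tauE max_l.
have B := Ef_boundary_swap p0 m0 ht hp hm y; have B0 := Ef_boundary0_swap p0 m0 ht hp hm.
have := core m0 p0 mp tE y0; rewrite E alpha_swap amean_swap dE => Q.
have alg (c u1 v1 u2 v2 f i P1 Q1 P2 Q2 : R[i]) : c * u2 * v2 * f = i * P2 * Q2 ->
    u1 * v1 = u2 * v2 -> P1 * Q1 = P2 * Q2 -> c * u1 * v1 * f = i * P1 * Q1.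
  by move=> h1 h2 h3; rewrite -[c * u1 * v1]mulrA h2 [c * _]mulrA h1 -!mulrA h3.
exact: alg Q B B0.
Qed.

End Prefactor.

(** * Asymptotics of the Toda eigenfunction *)

Section Asymptotics.
Context {R : realType}.
Implicit Types (x y s u t : R) (z w : R[i]).
Variables ap am : R.
Hypotheses (hap : 0 < ap) (ham : 0 < am).

Local Notation a := (amean ap am).
Local Notation al := (alpha ap am).
Let tau : R := 3 * pi / (4 * Num.max ap am).

Let x0 : 0 < Num.max ap am. Proof. by rewrite lt_max hap. Qed.
Let tau0 : 0 < tau. Proof. by rewrite divr_gt0// mulr_gt0// pi_gt0. Qed.
Let maxtau : Num.max ap am * tau < pi.
Proof.
rewrite (_ : _ * tau = 3 / 4 * pi); last by rewrite /tau; field; rewrite gt_eqF.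
by have := pi_gt0 R; lra.
Qed.
Let htp : ap * tau < pi.
Proof. by rewrite (le_lt_trans _ maxtau)// ler_wpM2r ?(ltW tau0)// le_max lexx. Qed.
Let htm : am * tau < pi.
Proof. by rewrite (le_lt_trans _ maxtau)// ler_wpM2r ?(ltW tau0)// le_max lexx orbT. Qed.
Let a0 : 0 < a. Proof. exact: a_gt0. Qed.
Let a2a : a / 2 < a. Proof. by have := a0; lra. Qed.
Let al0 : 0 < al. Proof. by rewrite divr_gt0 ?mulr_gt0 ?pi_gt0. Qed.

Let E := Ef ap am tau.
Let H u := E (u +i* - (a / 2)).
Let step u : R[i] := if 0 <= u then 1 else 0.

Let hIm u : `|Im (u +i* - (a / 2))| <= a / 2.
Proof. by rewrite /= normrN ger0_norm// ltW// divr_gt0. Qed.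

Let H_GR u : GR ap am (u +i* - (a / 2)) = H u.
Proof. by apply: GR_strip => //; exact: le_lt_trans (hIm u) _. Qed.

Let H_le : exists2 K : R, 0 <= K & forall u, normc (H u) <= K /\ normc (H u) <= K * expR (al * a / 2 * u).
Proof.
have [K1 K10 h1] := Ef_bnd hap ham tau0 htp htm a2a.
have [K2 K20 h2] := Ef_neg hap ham tau0 htp htm a2a.
have k0 : 0 <= al * a / 2 by rewrite divr_ge0// mulr_ge0// ltW.
exists (K1 + K2) => [|u]; first by rewrite addr_ge0.
have [u0|/ltW u0] := leP 0 u.
  have b : normc (H u) <= K1 + K2 by rewrite (le_trans (h1 _ (hIm u) u0))// lerDl.
  split=> //; rewrite (le_trans b)// ler_peMr ?addr_ge0//.
  by rewrite -[leLHS]expR0 ler_expR; exact: mulr_ge0 k0 u0.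
have b : normc (H u) <= K2 * expR (al * a / 2 * u).
  rewrite (le_trans (h2 _ (hIm u) u0))// ler_wpM2l// ler_expR /=.
  by rewrite le_eqVlt; apply/orP; left; apply/eqP; field.
split; last by rewrite (le_trans b)// ler_wpM2r ?expR_ge0// lerDr.
rewrite (le_trans b)// (le_trans (y := K2)) ?lerDr// ler_piMr// expR_le1.
by rewrite mulr_ge0_le0.
Qed.

Let H1_le : exists2 K : R, 0 <= K & forall u, normc (H u - 1) <= K /\
  normc (H u - 1) <= K * expR (- (2 * tau * u)).
Proof.
have [K1 K10 h1] := Ef_near1 hap ham tau0 htp htm a2a.
have [K2 K20 h2] := H_le.
have t0 : 0 <= 2 * tau by rewrite mulr_ge0// ltW.
exists (K1 + (K2 + 1)) => [|u]; first by rewrite !addr_ge0.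
have K21 : 0 <= K2 + 1 by rewrite addr_ge0.
have [u0|/ltW u0] := leP 0 u.
  have b : normc (H u - 1) <= K1 * expR (- (2 * tau * u)) by exact: h1 (hIm u) u0.
  split; last by rewrite (le_trans b)// ler_wpM2r ?expR_ge0// lerDl.
  rewrite (le_trans b)// (le_trans (y := K1)) ?lerDl// ler_piMr// expR_le1.
  by rewrite oppr_le0 mulr_ge0.
have b : normc (H u - 1) <= K1 + (K2 + 1).
  rewrite (le_trans (normcB _ _))// (normcr 1) normr1 addrA lerD2r.
  by have [b _] := h2 u; rewrite (le_trans b)// lerDr.
split=> //; rewrite (le_trans b)// ler_peMr ?addr_ge0//.
by rewrite -[leLHS]expR0 ler_expR oppr_ge0; exact: mulr_ge0_le0 t0 u0.
Qed.

Let H_ccont u : ccont H u.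
Proof.
have ba : 3 / 4 * a < a by have := a0; lra.
have [] := reg_ccont (Ef_reg hap ham tau0 htp htm (u - 1) (u + 1) ba) (x := u) (y := - (a / 2)) _ => //.
have := a0 => h; rewrite /box /=; apply/andP; split; apply/andP; split; lra.
Qed.

Let H_meas : cmeas (setT : set (measurableTypeR R)) H.
Proof. by apply: ccont_cmeas. Qed.

Let step_meas : cmeas (setT : set (measurableTypeR R)) step.
Proof.
have mp : measurable_fun (setT : set (measurableTypeR R)) (fun x : R => 0 <= x).
  exact: measurable_fun_ler.
exact: (@cmeas_if _ setT (fun=> 1) (fun=> 0) _ measurableT mp (cmeas_cst _ 1) (cmeas_cst _ 0)).
Qed.

Let e (k : R) t : R[i] := cexp ('i * (k * t)%:C).

Let e_norm k t : normc (e k t) = 1.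
Proof. by rewrite /e normc_cexp ReM /= mul0r mul1r subrr expR0. Qed.

Let eD k t u : e k (t + u) = e k t * e k u.
Proof. by rewrite /e mulrDr rmorphD mulrDr cexpD. Qed.

Let eN k t : e k (- t) = e (- k) t.
Proof. by rewrite /e mulrN mulNr. Qed.

Let e_der k t : cder (e k) t ('i * k%:C * e k t).
Proof.
have D : cder (fun t : R => 'i * (k * t)%:C) t ('i * k%:C).
  apply: (cder_ext (c := fun t : R => 'i * k%:C * t%:C)).
    by move=> u; rewrite rmorphM mulrA.
  by apply: cder_eq (cderZ _ (cder_real t)) _; rewrite mulr1.
exact: cder_exp D.
Qed.

Let e_ccont k t : ccont (e k) t. Proof. exact: cder_cont (e_der k t). Qed.

Let e_Cdom k f : Cdom f -> Cdom (fun t => e k t * f t).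
Proof.
move=> [mf [K hK]]; split; first by apply: cmeasM => //; apply: ccont_cmeas.
by exists K => x; rewrite Normc.normcM e_norm mul1r.
Qed.

Let h u := H u - step u.

Let h_Cdom : Cdom h.
Proof.
split; first exact: cmeasB.
have [K1 K10 h1] := H1_le; have [K2 K20 h2] := H_le.
have t0 : 0 < 2 * tau by rewrite mulr_gt0.
have k0 : 0 < al * a / 2 by rewrite divr_gt0// mulr_gt0.
have [C1 [C10 hC1]] := lor_exp t0; have [C2 [C20 hC2]] := lor_exp k0.
exists (K1 * C1 + K2 * C2) => x; rewrite mulrDl /h /step.
have [xp|xn] := leP 0 x.
  have [_ b] := h1 x; rewrite (le_trans b)// (le_trans (y := K1 * C1 * lor x))//.
    by rewrite -[leRHS]mulrA; apply: ler_wpM2l => //; rewrite (le_trans _ (hC1 x))// ger0_norm.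
  by rewrite lerDl !mulr_ge0 ?lor_ge0.
have [_ b] := h2 x; rewrite subr0 (le_trans b)// (le_trans (y := K2 * C2 * lor x))//.
  by rewrite -[leRHS]mulrA; apply: ler_wpM2l => //; rewrite (le_trans _ (hC2 x))// ltr0_norm// mulrN opprK.
by rewrite lerDr !mulr_ge0 ?lor_ge0.
Qed.

(* the regularized Fourier transform of [H] *)
Let ct y := Cint (fun t => e (- (al * y)) t * h t) + ('i * (al * y)%:C)^-1.

Let ct_G y : y != 0 ->
  ct y * G ap am (y +i* a) = (Num.sqrt (ap * am))%:C * cexp (- ('i * (al * y ^+ 2 / 4)%:C)).
Proof.
move=> y0; have y0' : y%:C != 0 :> R[i] by rewrite fmorph_eq0.
have al0' : al%:C != 0 :> R[i] by rewrite fmorph_eq0 gt_eqF.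
have i0 : 'i%R != 0 :> R[i] by rewrite -normc_gt0 normci.
have F : FTE E al (- (a / 2)) y%:C = cexp ((al * - (a / 2))%:C * y%:C) * ct y.
  rewrite /FTE /ct mulrDr; congr (_ + _); last first.
    by rewrite [(al * y)%:C]rmorphM mulrA.
  rewrite -(CintZ _ (e_Cdom _ h_Cdom)); apply: eq_Cint => x.
  rewrite expr0 mul1r -/(H x) -/(step x) -/(h x) mulrC mulrA; congr (_ * _).
  rewrite /e -cexpD; congr cexp.
  by apply: complexP; rewrite !ReImE /=; ring.
have := FTE_GR hap ham (erefl tau) y0; rewrite -/E F /GR.
set k := cexp ('i * (chi ap am - _)%:C); set gx := cexp (_ + _).
have P2 : cexp (- ('i * (pi / 2)%:C)) = - 'i :> R[i].
  rewrite (_ : - _ = 0 +i* - (pi / 2)); last by apply: complexP; rewrite !ReImE /=; ring.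
  by apply: complexP; rewrite /= expR0 mul1r ?cosN ?sinN ?cos_pihalf ?sin_pihalf ?oppr0.
have X : cexp ((al * a)%:C * y%:C) * gx * cexp ((al * - (a / 2))%:C * y%:C) =
   - 'i * k * cexp ('i * (al * y ^+ 2 / 4)%:C).
  rewrite -P2 -!cexpD; congr cexp.
  have d4 (z : R[i]) : z / 4 = (4^-1)%:C * z by rewrite fmorphV rmorph_nat mulrC.
  rewrite d4; apply: complexP; rewrite expr2 !ReImE /= /alpha /amean; field;
    by rewrite !gt_eqF.
move=> Y; have k0 : - 'i * k != 0 by rewrite mulf_neq0 ?oppr_eq0 ?cexp_neq0.
apply: (mulfI k0); apply: (mulIf (cexp_neq0 ('i * (al * y ^+ 2 / 4)%:C))).
have alg (q u v : R[i]) : u * v = 1 -> - 'i * k * (q * u) * v = - 'i * (q * k).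
  by move=> uv; transitivity (- 'i * (q * k) * (u * v)); [ring|rewrite uv mulr1].
rewrite [RHS](alg _ _ _ (cexpNV _)).
rewrite -Y.
transitivity (cexp ((al * a)%:C * y%:C) * gx * cexp ((al * - (a / 2))%:C * y%:C) * (ct y * G ap am (y +i* a))).
  by rewrite X; ring.
by ring.
Qed.

Let I s y := Cint (fun t => H (t + s / 2) * H (- t + s / 2) * e (al * y) t).

Let ccont_affine (c : R -> R[i]) (k b t : R) : ccont c (k * t + b) ->
  ccont (fun u => c (k * u + b)) t.
Proof.
move=> [h1 h2]; have A : k * u + b @[u --> t] --> k * t + b.
  by apply: cvgD; [apply: cvgM; [exact: cvg_cst|exact: cvg_id]|exact: cvg_cst].
by split; [exact: (cvg_comp _ _ A h1)|exact: (cvg_comp _ _ A h2)].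
Qed.

(* on each half-line, bound one factor by K and the other by the exponential *)
Let prod_le (F : R -> R[i]) (K k : R) : 0 <= K ->
  (forall u, normc (F u) <= K /\ normc (F u) <= K * expR (k * u)) -> forall s t,
  normc (F (t + s / 2) * F (- t + s / 2)) <= K ^+ 2 * expR (k * s / 2) * expR (- `|k * t|).
Proof.
move=> K0 hF s t; rewrite Normc.normcM expr2.
have [p1 p2] := hF (t + s / 2); have [q1 q2] := hF (- t + s / 2).
rewrite -mulrA -expRD; case: (ger0P (k * t)) => kt.
  rewrite (le_trans (ler_pM (normc_ge0 _) (normc_ge0 _) p1 q2))// mulrA le_eqVlt.
  by apply/orP; left; apply/eqP; congr (_ * expR _); field.
rewrite (le_trans (ler_pM (normc_ge0 _) (normc_ge0 _) p2 q1))// le_eqVlt.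
apply/orP; left; apply/eqP; rewrite mulrAC; congr (_ * expR _).
by rewrite opprK mulrDr addrC mulrA.
Qed.

Let prod_Cint (F : R -> R[i]) (K k : R) : 0 <= K -> k != 0 -> (forall u, ccont F u) ->
  (forall u, normc (F u) <= K /\ normc (F u) <= K * expR (k * u)) ->
  exists2 C : R, 0 <= C & forall s y,
    Cdom (fun t => F (t + s / 2) * F (- t + s / 2) * e y t) /\
    normc (Cint (fun t => F (t + s / 2) * F (- t + s / 2) * e y t)) <= C * expR (k * s / 2).
Proof.
move=> K0 k0 cF hF; have k0' : 0 < `|k| by rewrite normr_gt0.
have [C [C0 hC]] := lor_exp k0'; exists (2 * pi * (K ^+ 2 * C)).
  by rewrite !mulr_ge0 ?pi_ge0// exprn_ge0.
move=> s y; have b t : normc (F (t + s / 2) * F (- t + s / 2) * e y t) <=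
    K ^+ 2 * C * expR (k * s / 2) * lor t.
  rewrite Normc.normcM e_norm mulr1 (le_trans (prod_le K0 hF s t))// [K ^+ 2 * C * _]mulrAC.
  rewrite -[leRHS]mulrA; apply: ler_wpM2l; first by rewrite mulr_ge0 ?expR_ge0// exprn_ge0.
  by rewrite normrM.
have m : cmeas (setT : set (measurableTypeR R)) (fun t => F (t + s / 2) * F (- t + s / 2) * e y t).
  apply: ccont_cmeas => // t; apply: ccontM => //; apply: ccontM.
    by have := @ccont_affine F 1 (s / 2) t; under eq_fun do rewrite mul1r; apply.
  by have := @ccont_affine F (- 1) (s / 2) t; under eq_fun do rewrite mulN1r; apply.
split; first by split => //; exists (K ^+ 2 * C * expR (k * s / 2)).
by rewrite -mulrA; apply: Cint_le.
Qed.

Let r s y := Cint (fun t => (H (t + s / 2) - 1) * (H (- t + s / 2) - 1) * e (al * y) t).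

Let shift_h k s : Cint (fun t => e k t * h (t + s / 2)) =
  e k (- (s / 2)) * Cint (fun t => e k t * h t).
Proof.
have d := e_Cdom k h_Cdom; rewrite -(CintZ _ d).
rewrite -(Cint_shift (s / 2) (CdomZ _ d)); apply: eq_Cint => t.
by rewrite mulrA -eD [- _ + _]addrC addrK.
Qed.

(* The product is expanded around its limits; the three explicit terms give two
   translates of the transform and the transform of an interval. *)
Let I_split s y : 0 < s -> y != 0 ->
  I s y = e (al * y) (s / 2) * ct y + e (al * y) (- (s / 2)) * ct (- y) + r s y.
Proof.
move=> s0 y0; set k := al * y; have k0 : k != 0 by rewrite mulf_neq0// gt_eqF.
have k0' : k%:C != 0 :> R[i] by rewrite fmorph_eq0.
have i0 : 'i%R != 0 :> R[i] by rewrite -normc_gt0 normci.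
have [K K0 hK] := H1_le.
have t0 : - (2 * tau) != 0 by rewrite oppr_eq0 gt_eqF// mulr_gt0.
have c1 u : ccont (fun u => H u - 1) u by apply: ccontB => //; exact: ccont_cst.
have hK' u : normc (H u - 1) <= K /\ normc (H u - 1) <= K * expR (- (2 * tau) * u).
  by rewrite mulNr; exact: hK.
have [C C0 hC] := prod_Cint K0 t0 c1 hK'.
have [d1 _] := hC s k.
have d2 : Cdom (fun t => e k t * h (t + s / 2)) by apply: e_Cdom; exact: Cdom_shift.
have d3 : Cdom (fun t => e k t * h (- t + s / 2)).
  by apply: e_Cdom; exact: Cdom_opp (Cdom_shift (s / 2) h_Cdom).
have d4 : Cdom (fun t => if - (s / 2) <= t <= s / 2 then e k t else 0).
  split.
    have mp : measurable_fun (setT : set (measurableTypeR R)) (fun t : R => - (s / 2) <= t <= s / 2).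
      by apply: measurable_and; apply: measurable_fun_ler.
    have me : cmeas (setT : set (measurableTypeR R)) (e k) by exact: ccont_cmeas.
    exact: (@cmeas_if _ setT (e k) (fun=> 0) _ measurableT mp me (cmeas_cst _ 0)).
  exists (1 + (s / 2) ^+ 2) => t; have o0 : 0 < oneDsqr t.
    by rewrite (lt_le_trans ltr01)// oneDsqr_ge1.
  have p0 : 0 <= 1 + (s / 2) ^+ 2 by rewrite addr_ge0// sqr_ge0.
  case: ifP => [ht|_]; last by rewrite normc0' mulr_ge0// lor_ge0.
  rewrite e_norm /lor ler_pdivlMr// mul1r /oneDsqr lerD2l.
  rewrite -real_normK ?num_real// lerXn2r ?nnegrE ?ler_norml//.
  by rewrite divr_ge0// ltW.
have key t : H (t + s / 2) * H (- t + s / 2) * e k t =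
    (H (t + s / 2) - 1) * (H (- t + s / 2) - 1) * e k t + e k t * h (t + s / 2) +
    e k t * h (- t + s / 2) + (if - (s / 2) <= t <= s / 2 then e k t else 0).
  rewrite /h /step.
  have -> : (0 <= t + s / 2) = (- (s / 2) <= t) by rewrite -lerBlDr sub0r.
  have -> : (0 <= - t + s / 2) = (t <= s / 2) by rewrite addrC subr_ge0.
  have np : (- (s / 2) <= t) || (t <= s / 2).
    by case: (leP t (s / 2)); rewrite ?orbT// orbF => q; lra.
  move: np; move: (H _) (H _) (e k t) => u v w.
  by case: (- (s / 2) <= t); case: (t <= s / 2) => //= _; ring.
rewrite /I (eq_Cint key) (CintD (CdomD (CdomD d1 d2) d3) d4) (CintD (CdomD d1 d2) d3) (CintD d1 d2).
rewrite -/(r s y) shift_h Cint_itv.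
have -> : Cint (fun t => e k t * h (- t + s / 2)) = e k (s / 2) * Cint (fun t => e (- k) t * h t).
  have d5 : Cdom (fun t => e (- k) t * h (t + s / 2)) by apply: e_Cdom; exact: Cdom_shift.
  have := Cint_opp d5; rewrite shift_h eN opprK => <-; apply: eq_Cint => t.
  by rewrite eN opprK.
have -> : cintegral `[(- (s / 2)), (s / 2)] (e k) = ('i * k%:C)^-1 * e k (s / 2) - ('i * k%:C)^-1 * e k (- (s / 2)).
  rewrite (@cintegral_ftc _ (fun t => ('i * k%:C)^-1 * e k t))//.
    by lra.
  move=> u _; apply: cder_eq (cderZ _ (e_der k u)) _.
  by rewrite mulrA mulVf ?mul1r// mulf_neq0.
rewrite /ct -/k mulrN opprK rmorphN mulrN invrN; ring.
Qed.

Let sqrt_GR_near1 : exists2 K : R, 0 <= K & forall s, 0 <= s ->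
  normc ((sqrt_GR ap am s)^-1 - 1) <= K * expR (- (2 * tau * s)).
Proof.
have [K K0 hK] := gRd_decay hap ham tau0 htp htm 0 a0.
exists (2 * K * expR K) => [|s s0]; first by rewrite !mulr_ge0 ?expR_ge0.
have hs : `|Im s%:C| <= 0 by rewrite /= normr0.
have := hK s%:C hs; rewrite (gRd0 hap ham tau0 htp htm) ?(le_lt_trans hs)// [Re _]/=.
set q := gR ap am s%:C; set ex := expR _ => b.
have ex1 : ex <= 1 by rewrite expR_le1 oppr_le0 mulr_ge0// mulr_ge0// ltW.
have w : normc (- ('i * q / 2)) <= K * ex.
  rewrite normcN Normc.normcM Normc.normcV normc_nat Normc.normcM normci mul1r ler_pdivrMr//.
  by rewrite (le_trans b)// ler_peMr ?mulr_ge0 ?expR_ge0// ler1n.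
have w' : normc (- ('i * q / 2)) <= K by rewrite (le_trans w)// ler_piMr.
rewrite /sqrt_GR -cexpN (le_trans (cexp_taylor1 _))//.
have -> : 2 * K * expR K * ex = 2 * (K * ex) * expR K by ring.
apply: ler_pM; rewrite ?mulr_ge0 ?normc_ge0 ?expR_ge0 ?ler_expR//.
by rewrite ler_pM2l.
Qed.

Let sqrt_GR_left : exists2 K : R, 0 <= K & forall s, s <= 0 -> normc (sqrt_GR ap am s)^-1 <= K.
Proof.
have [K K0 hK] := gRd_decay hap ham tau0 htp htm 0 a0.
exists (expR K) => [|s s0]; first exact: expR_ge0.
have hs : `|Im (- s%:C)| <= 0 by rewrite /= oppr0 normr0.
have := hK (- s%:C) hs; rewrite (gRd0 hap ham tau0 htp htm) ?(le_lt_trans hs)// ReN [Re _]/=.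
have := gR_reflect ap am s%:C; set q := gR _ _ s%:C; set q' := gR _ _ (- _) => qq b.
have b' : normc q' <= K.
  rewrite (le_trans b)// ler_piMr// expR_le1 mulrN opprK mulr_ge0_le0//.
  by rewrite mulr_ge0// ltW.
rewrite /sqrt_GR -cexpN normc_cexp ler_expR -/q.
have d2 (z : R[i]) : z / 2 = (2^-1)%:C * z by rewrite fmorphV rmorph_nat mulrC.
have qI : Im q = - Im q'.
  have : q = 2 * (chi ap am)%:C + al%:C * s%:C ^+ 2 / 2 - q' by rewrite -qq addrK.
  by move=> ->; rewrite d2 expr2 !ReImE /=; ring.
have -> : Re (- ('i * q / 2)) = - Im q' / 2.
  by rewrite d2 ReN ReMr ReM qI /=; field.
rewrite (le_trans (ler_norm _))// normrM normrN (ger0_norm (x := 2^-1))//.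
rewrite ler_pdivrMr// (le_trans (normc_Im _))// (le_trans b')//.
by rewrite ler_peMr// ler1n.
Qed.

Variables eta y : R.
Hypothesis hy : 0 < y.

Let C0 : R[i] := sqrt_GG ap am y / (Num.sqrt (ap * am))%:C * cexp ('i * (al * y ^+ 2 / 4)%:C).

Let FT_I x : FT ap am eta x y = C0 * (sqrt_GR ap am (x - eta))^-1 * I (x - eta) y.
Proof.
rewrite /FT /C0 invfM.
have -> : cintegral setT (fun t => GR ap am ((t + (x - eta) / 2) -i* (a / 2)) *
    GR ap am ((- t + (x - eta) / 2) -i* (a / 2)) * cexp ('i * (al * t * y)%:C)) = I (x - eta) y.
  by apply: eq_Cint => t; rewrite !H_GR /e [al * t * y]mulrAC.
by move: (sqrt_GG _ _ _) (_%:C^-1) (sqrt_GR _ _ _)^-1 (cexp _) (I _ _) => u v w c J; ring.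
Qed.

Let y0 : y != 0. Proof. by rewrite gt_eqF. Qed.

Let main_term x := sqrt_uT ap am eta y * cexp ('i * (al * x * y / 2)%:C)
  + sqrt_uT ap am eta (- y) * cexp (- ('i * (al * x * y / 2)%:C)).

Let main_termE x : C0 * (e (al * y) ((x - eta) / 2) * ct y +
  e (al * y) (- ((x - eta) / 2)) * ct (- y)) = main_term x.
Proof.
have GGN : sqrt_GG ap am (- y) = sqrt_GG ap am y by rewrite /sqrt_GG opprK mulrC.
have q0 : (Num.sqrt (ap * am))%:C != 0 :> R[i].
  by rewrite fmorph_eq0 gt_eqF// sqrtr_gt0 mulr_gt0.
have P v : v != 0 -> al * v ^+ 2 = al * y ^+ 2 -> sqrt_GG ap am v = sqrt_GG ap am y ->
    C0 * (e (al * v) ((x - eta) / 2) * ct v) =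
    sqrt_uT ap am eta v * cexp ('i * (al * x * v / 2)%:C).
  move=> v0 v2 gv; have := ct_G v0; rewrite v2; set G0 := G _ _ _ => hG.
  have G00 : G0 != 0.
    apply/eqP => Gz; move: hG; rewrite Gz mulr0 => /esym/eqP.
    by rewrite mulf_eq0 (negbTE q0) (negbTE (cexp_neq0 _)).
  have -> : ct v = (Num.sqrt (ap * am))%:C * cexp (- ('i * (al * y ^+ 2 / 4)%:C)) / G0.
    by rewrite -hG mulfK.
  have -> : e (al * v) ((x - eta) / 2) =
      cexp (- ('i * (al * eta * v / 2)%:C)) * cexp ('i * (al * x * v / 2)%:C).
    rewrite /e -cexpD; congr cexp; rewrite -mulrN -mulrDr -rmorphN -rmorphD.
    by congr (_ * _%:C); field.
  rewrite /sqrt_uT gv -/G0 /C0.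
  have alg (g q c c' G1 e1 e2 : R[i]) : q != 0 -> G1 != 0 -> c' * c = 1 ->
      g / q * c * (e1 * e2 * (q * c' / G1)) = e1 * (g / G1) * e2.
    move=> h1 h2 h3; transitivity (g / q * (e1 * e2 * (q * (c' * c) / G1))); first by ring.
    by rewrite h3; field; rewrite h1 h2.
  exact: alg q0 G00 (cexpNV _).
rewrite mulrDr (P y y0 erefl erefl); congr (_ + _).
have yN : - y != 0 by rewrite oppr_eq0.
have -> : e (al * y) (- ((x - eta) / 2)) = e (al * - y) ((x - eta) / 2) by rewrite eN mulrN.
have yy : al * (- y) ^+ 2 = al * y ^+ 2 by rewrite sqrrN.
rewrite (P (- y) yN yy GGN); congr (_ * cexp _).
by rewrite mulrN mulNr rmorphN mulrN.
Qed.

(** The two factors of the integrand decay on complementary half-lines, and the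
    prefactor is bounded on the left by the reflection. *)
Lemma FT_left : exists K : R, forall x, x <= eta ->
  normc (FT ap am eta x y) <= K * expR (al * a * x / 4).
Proof.
have [K K0 hK] := H_le; have [S S0 hS] := sqrt_GR_left.
have k0 : al * a / 2 != 0 by rewrite gt_eqF// divr_gt0// mulr_gt0.
have [C C0' hC] := prod_Cint K0 k0 H_ccont hK.
exists (normc C0 * S * C * expR (- (al * a * eta / 4))) => x xe.
have [_ b] := hC (x - eta) (al * y).
have s0 : x - eta <= 0 by rewrite subr_le0.
rewrite FT_I [normc (_ * I _ _)]Normc.normcM [normc (C0 * _)]Normc.normcM.
have -> : normc C0 * S * C * expR (- (al * a * eta / 4)) * expR (al * a * x / 4) =
    normc C0 * S * (C * expR (al * a / 2 * (x - eta) / 2)).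
  by rewrite -[LHS]mulrA -expRD -[LHS]mulrA; congr (_ * (_ * expR _)); field.
apply: ler_pM b; rewrite ?mulr_ge0 ?normc_ge0//.
by apply: ler_wpM2l; [exact: normc_ge0|exact: hS].
Qed.

(** The remainder of [I_split] and the difference of [sqrt_GR] from 1 both decay
    exponentially. *)
Lemma FT_right : exists K : R, forall x, eta < x ->
  normc (FT ap am eta x y - main_term x) <= K * expR (- (tau * x)).
Proof.
have [K K0 hK] := H1_le; have [S S0 hS] := sqrt_GR_near1.
have t0 : - (2 * tau) != 0 by rewrite oppr_eq0 gt_eqF// mulr_gt0.
have c1 u : ccont (fun u => H u - 1) u by apply: ccontB => //; exact: ccont_cst.
have hK' u : normc (H u - 1) <= K /\ normc (H u - 1) <= K * expR (- (2 * tau) * u).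
  by rewrite mulNr; exact: hK.
have [C C0' hC] := prod_Cint K0 t0 c1 hK'.
pose L := normc (sqrt_uT ap am eta y) + normc (sqrt_uT ap am eta (- y)).
have L0 : 0 <= L by rewrite addr_ge0 ?normc_ge0.
exists ((S * L + normc C0 * (1 + S) * C) * expR (tau * eta)) => x xe.
set s := x - eta; have s0 : 0 < s by rewrite subr_gt0.
have ts : 0 <= tau * s by rewrite mulr_ge0// ltW.
have Sb := hS s (ltW s0); have [_ rb] := hC s (al * y).
rewrite FT_I -/s -main_termE -/s (I_split s0 y0); rewrite -/(r s y) in rb.
pose X := e (al * y) (s / 2) * ct y + e (al * y) (- (s / 2)) * ct (- y).
rewrite -/X; set Z := (sqrt_GR _ _ _)^-1 in Sb *.
have -> : C0 * Z * (X + r s y) - C0 * X = (Z - 1) * (C0 * X) + C0 * Z * r s y by ring.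
have XL : normc (C0 * X) <= L.
  have gen (u v c d : R[i]) : normc c = 1 -> normc d = 1 ->
      normc (u * c + v * d) <= normc u + normc v.
    by move=> hc hd; rewrite (le_trans (le_normcD _ _))// !Normc.normcM hc hd !mulr1.
  rewrite /X main_termE; apply: gen; rewrite normc_cexp ?ReN ReM /=;
    by rewrite mul0r mul1r subrr ?oppr0 expR0.
have Z1 : normc Z <= 1 + S.
  rewrite -[Z](subrK 1) addrC (le_trans (le_normcD _ _))// (normcr 1) normr1 lerD2l.
  rewrite (le_trans Sb)// ler_piMr// expR_le1 oppr_le0 -mulrA mulr_ge0//.
have E2 : expR (- (2 * tau * s)) <= expR (- (tau * s)).
  by rewrite ler_expR lerN2 -mulrA ler_peMl// ler1n.
have E1 : expR (- (2 * tau) * s / 2) = expR (- (tau * s)) by congr expR; field.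
have -> : (S * L + normc C0 * (1 + S) * C) * expR (tau * eta) * expR (- (tau * x)) =
    S * expR (- (tau * s)) * L + normc C0 * (1 + S) * (C * expR (- (tau * s))).
  have -> : expR (- (tau * s)) = expR (tau * eta) * expR (- (tau * x)).
    by rewrite -expRD; congr expR; rewrite /s; ring.
  by ring.
rewrite (le_trans (le_normcD _ _))// [normc ((Z - 1) * _)]Normc.normcM.
rewrite [normc (_ * r s y)]Normc.normcM [normc (C0 * Z)]Normc.normcM.
apply: lerD.
  apply: ler_pM XL; rewrite ?normc_ge0// (le_trans Sb)//.
  by apply: ler_wpM2l.
rewrite -E1; apply: ler_pM rb; rewrite ?mulr_ge0 ?normc_ge0//.
by apply: ler_wpM2l; first exact: normc_ge0.
Qed.

End Asymptotics.

Theorem mainTheorem6 (R : realType) (ap am eta y : R)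
    (hap : 0 < ap) (ham : 0 < am) (hy : 0 < y) :
  (exists K : R, \forall x \near -oo,
     normc (FT ap am eta x y) <= K * expR (alpha ap am * amean ap am * x / 4))
  /\
  normc (FT ap am eta x y
         - (sqrt_uT ap am eta y * cexp ('i * (alpha ap am * x * y / 2)%:C)
            + sqrt_uT ap am eta (- y)
              * cexp (- ('i * (alpha ap am * x * y / 2)%:C))))
    @[x --> +oo] --> 0.
Proof.
split.
  have [K hK] := FT_left hap ham eta y; exists K; near=> x; apply: hK.
  by near: x; apply: nbhs_ninfty_le; exact: num_real.
have [K hK] := FT_right hap ham eta hy.
set tau := 3 * pi / _ in hK.
have tau0 : 0 < tau by rewrite divr_gt0// mulr_gt0 ?pi_gt0// lt_max hap.
apply: (squeeze_cvgr _ (cvg_cst (0 : R))); last first.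
  rewrite -[X in _ --> X](mulr0 K); apply: cvgM; first exact: cvg_cst.
  exact: (cvg_comp (fun x : R => tau * x) (fun u : R => expR (- u)) (gt0_cvgMry tau0 cvg_id) (@cvgr_expR R)).
near=> x; rewrite normc_ge0 /=; apply: hK.
by near: x; apply: nbhs_pinfty_gt; exact: num_real.
Unshelve. all: end_near. Qed.
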